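(* Let $X_1,X_2,\ldots$ be real random variables and let $s,t$ be constants with either $-\infty<s<\infty$, $0<t<\infty$, or $s=t=0$. Let $\mu_1=s/t$ (with $\mu_1=0$ if $s=t=0$) and, for $n\ge 1$, $\mu_{n+1}=(n\bar X_n+s)/(n+t)$, where $\bar X_n=\frac1n\sum_{i=1}^n X_i$. Let $\Lambda_n=\exp\{\sum_{i=1}^n(\mu_iX_i-\mu_i^2/2)\}$ and $\tau_b=\min\{n\ge1:\Lambda_n\ge e^b\}$ ($\tau_b=\infty$ if no such $n$ exists). Then, as $b\to\infty$, the Robbins--Siegmund power one test of $H_0:\mu=0$ versus $H_1:\mu\ne0$ (reject $H_0$ if and only if $\tau_b<\infty$) has significance level $$\alpha=P_{H_0}(\tau_b<\infty)=(1+o(1))\,\gamma\,e^{-b},\qquad \gamma=\int_{-\infty}^{\infty}\nu(y)\,dG_{s,t}(y),$$ where $P_{H_0}$ is the measure under which $X_1,X_2,\ldots$ are i.i.d. $N(0,1)$, and $\nu$ and $G_{s,t}$ are as defined in the context.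
   Context: The hypotheses concern independent $N(\mu,1)$ observations $X_1,X_2,\ldots$. For $\mu\neq0$, $\nu(\mu)=2\mu^{-2}\exp\left\{-2\sum_{n=1}^{\infty}n^{-1}\Phi\left(-\tfrac12|\mu|\sqrt n\right)\right\}$, where $\Phi$ is the standard normal c.d.f. $G_{s,t}$ is the c.d.f. of the normal distribution $N\left(s/t,\ \sum_{i=1}^{\infty}1/(i+t)^2\right)$ (mean, variance), where $s/t$ is read as $0$ if $s=t=0$. *)

(* Defs.v *)
From HB Require Import structures.
From mathcomp Require Import all_boot all_order all_algebra.
From mathcomp Require Import finmap.
From mathcomp Require Import all_classical all_reals all_analysis.
Set Implicit Arguments.
Unset Strict Implicit.
Unset Printing Implicit Defensive.
Import Order.TTheory GRing.Theory Num.Theory.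
Import numFieldNormedType.Exports.
Local Open Scope classical_set_scope.
Local Open Scope ring_scope.

(* MathComp-Analysis. *)

Section independence.
Context d (T : measurableType d) (R : realType) (P : probability T R).

Definition independent_RVs (X : nat -> {RV P >-> R}) : Prop :=
  forall (J : {fset nat}) (A : nat -> set R),
    (forall i, measurable (A i)) ->
    P (\bigcap_(i in [set` J]) (X i @^-1` A i)) =
      (\prod_(i <- J) P (X i @^-1` A i))%E.

(* The laws are compared on Borel sets only: the values of a measure on
   non-measurable sets carry no information. *)
Definition iid_std_normal (X : nat -> {RV P >-> R}) : Prop :=
  independent_RVs X /\
  forall i (A : set R), measurable A ->
    distribution P (X i) A = normal_prob 0 1 A.

End independence.

Section robbins_siegmund.
Context {R : realType}.
Implicit Types (s t b y : R) (x : nat -> R) (n : nat).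

(* Observations are indexed from 0: the entry [x i] of a sample path is the
   observation X_{i+1}. *)

Definition sample_mean x n : R := n%:R^-1 * \sum_(i < n) x i.

(* [pred_mean s t x n] is mu_{n+1}.  When s = t = 0, s / t is 0 since
   division by 0 yields 0. *)
Definition pred_mean s t x n : R :=
  if n is 0 then s / t else (n%:R * sample_mean x n + s) / (n%:R + t).

Definition adaptive_lr s t x n : R :=
  expR (\sum_(i < n) (pred_mean s t x i * x i - pred_mean s t x i ^+ 2 / 2)).

(* The first crossing time; the infimum of the empty set is +oo. *)
Definition crossing_time s t b x : \bar R :=
  ereal_inf
    [set n%:R%:E | n in [set n | (0 < n)%N /\ expR b <= adaptive_lr s t x n]].

Definition std_normal_cdf y : R := fine (normal_prob 0 1 `]-oo, y]).

(* Only meaningful for y != 0. *)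
Definition nu y : R :=
  2 * y ^- 2 * expR (- 2 *
    \big[+%R/0]_(1 <= n <oo)
      (n%:R^-1 * std_normal_cdf (- (2^-1 * `|y| * Num.sqrt n%:R)))).

Definition G_variance t : R := \big[+%R/0]_(1 <= i <oo) ((i%:R + t) ^+ 2)^-1.

(* The law with c.d.f. G_{s,t}; the second parameter of [normal_prob] is the
   standard deviation. *)
Definition G s t : probability (measurableTypeR R) R :=
  normal_prob (s / t) (Num.sqrt (G_variance t)).

(* [nu 0] is irrelevant, as [G s t] has no atoms. *)
Definition gamma s t : \bar R := (\int[G s t]_y (nu y)%:E)%E.

End robbins_siegmund.

(* Main.v *)
(* Under the measure with density Lambda_n the innovations X_n - mu_n are i.i.d. N(0,1)
   and P(tau_b < oo) = e^{-b} E[exp(-(log Lambda_tau - b))].  There mu_n converges to a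
   limit with law G, and log Lambda_n is, up to a constant, a quadratic function of
   mu_{n+1}.  Integrating out the first innovation alone gives the density of the overshoot
   u at time n: mu_{n+1} must be close to y = +-sqrt(2b/n), and, seen backwards from n, the
   path is a random walk S_k = y W_k + k y^2/2 which has to stay above u for all k >= 1.
   Requiring this for 1 <= k <= K only gives an upper bound, and the sum over n becomes the
   integral of 2 y^{-2} E[int_0^{(min_{k <= K} S_k)^+} g(u) du] against G, for any weight
   0 <= g <= 1.  As K -> oo, Spitzer's identity shows that the inner integral tends to
   (y^2/2) nu(y) for g(u) = e^{-u} and to (y^2/2) (1 - nu(y)) for g(u) = 1 - e^{-u}.  Since
   the two limits add up to 1, both upper bounds are sharp.  Crossings at times larger than
   2b/delta^2 force |mu_n| to be of order delta and contribute O(delta). *)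
Require Import Defs.
From HB Require Import structures.
From mathcomp Require Import all_boot all_order all_algebra.
From mathcomp Require Import finmap.
From mathcomp Require Import all_classical all_reals all_analysis.
From mathcomp Require Import measurable_realfun.
From mathcomp Require Import ring lra zify.
Set Implicit Arguments.
Unset Strict Implicit.
Unset Printing Implicit Defensive.
Import Order.TTheory GRing.Theory Num.Theory.
Import numFieldNormedType.Exports.
Local Open Scope classical_set_scope.
Local Open Scope ring_scope.

(** The first innovation is singled out because its weight 1/(1+t) in mu_{n+1} does not decay with
    n: given the others, mu_{n+1} keeps a bounded density, and the last K innovations, which drive
    the reversed walk, are left untouched. The law G enters only through densities: averaging the
    Gaussian density of the first innovation over the older ones gives, at every finite n, an exact
    normal density, whose variance tends to that of G. Older and recent innovations are read from
    two separate paths, so that the limit factors into this density and a probability for the walk.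

    The obstacle is the lower bound: the absence of any earlier crossing is hard to control over the
    whole past, while forgetting conditions is harmless in an upper bound. This is why the
    complementary weight is carried along. It needs the limit for the constant weight 1, which is
    the mean E S_1 = y^2/2 of one step, and the fact that crossing by a time of order b has
    probability close to 1 when the innovations are i.i.d. N(0,1). *)

(** * Change of variables for nonnegative integrals *)

Section transfer.
Local Open Scope ereal_scope.
Context d1 d2 (X : measurableType d1) (Y : measurableType d2) (R : realType).
Variables (mu : {measure set X -> \bar R}) (phi : X -> Y) (g : X -> R).
Hypotheses (mphi : measurable_fun setT phi) (mg : measurable_fun setT g).
Hypothesis g0 : forall x, (0 <= g x)%R.

Import HBNNSimple.

Let mindic (A : set Y) : measurable A ->
  measurable_fun setT (fun x => (\1_A (phi x) * g x)%R%:E).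
Proof.
move=> mA; apply/measurable_EFinP/measurable_funM => //.
have h : measurable_fun setT (\1_A : Y -> R) by exact: measurable_indic.
exact: (measurableT_comp h mphi).
Qed.

(** One statement serves for densities ([phi] the identity) and for substitutions ([g] a Jacobian):
    the identity on indicators passes to simple functions by linearity and to [f] by monotone
    convergence. *)
Lemma ge0_integral_transfer (m : {measure set Y -> \bar R}) :
  (forall A, measurable A -> m A = \int[mu]_x (\1_A (phi x) * g x)%R%:E) ->
  forall f : Y -> \bar R, measurable_fun setT f -> (forall y, 0 <= f y) ->
  \int[m]_y f y = \int[mu]_x (f (phi x) * (g x)%:E).
Proof.
move=> mE f mf f0.
pose f_ := nnsfun_approx measurableT mf.
have cf y : EFin \o f_^~ y @ \oo --> f y by exact: cvg_nnsfun_approx.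
have mf_ n : measurable_fun setT (fun x => (f_ n (phi x))%:E).
  by apply/measurable_EFinP; exact: (measurableT_comp _ mphi).
transitivity (limn (fun n => \int[m]_x (f_ n x)%:E)).
  rewrite -monotone_convergence//.
  - by apply: eq_integral => y _; apply/esym/cvg_lim => //; exact: cf.
  - by move=> n; exact/measurable_EFinP/measurable_funP.
  - by move=> n y _; rewrite lee_fin.
  - by move=> y _ a b ab; rewrite lee_fin; exact/lefP/nd_nnsfun_approx.
transitivity (limn (fun n => \int[mu]_x ((f_ n (phi x))%:E * (g x)%:E))); last first.
  rewrite -monotone_convergence//.
  - apply: eq_integral => x _; apply/cvg_lim => //.
    by apply: cvgeZr => //; exact: cf.
  - move=> n; apply: emeasurable_funM => //; exact/measurable_EFinP.
  - by move=> n x _; rewrite mule_ge0 ?lee_fin.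
  - move=> x _ a b ab; apply: lee_wpmul2r; rewrite lee_fin//.
    exact/lefP/nd_nnsfun_approx.
congr (limn _); apply/funext => n.
have mk r : measurable (f_ n @^-1` [set r]) by [].
under eq_integral do rewrite fimfunE -fsumEFin//.
rewrite ge0_integral_fsum//; last 2 first.
- by move=> y; exact/measurable_EFinP/measurable_funM.
- by move=> y x _; rewrite nnfun_muleindic_ge0.
transitivity (\int[mu]_x \sum_(k \in range (f_ n)) (k * (\1_(f_ n @^-1` [set k]) (phi x) * g x))%:E).
  rewrite ge0_integral_fsum//; last 2 first.
  - move=> r; under eq_fun do rewrite EFinM.
    by apply: measurable_funeM; exact: mindic.
  - move=> r x _; rewrite mulrA lee_fin mulr_ge0//.
    by have := nnfun_muleindic_ge0 (f_ n) r (phi x); rewrite lee_fin.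
  apply: eq_fsbigr => r rf.
  rewrite integralZl_indic_nnsfun// integral_indic//= setIT mE//.
  under [RHS]eq_integral do rewrite EFinM.
  have [r0|r0] := leP 0%R r.
    rewrite ge0_integralZl//; first exact: mindic.
    by move=> x _; rewrite lee_fin mulr_ge0.
  rewrite preimage_nnfun0//.
  rewrite integral0_eq ?mule0; last by move=> x _; rewrite indic0 mul0r.
  by rewrite integral0_eq// => x _; rewrite indic0 mul0r mule0.
apply: eq_integral => x _.
rewrite -EFinM fsumEFin// [in RHS]fimfunE.
congr _%:E; rewrite [in RHS]mulrC mulr_fsumr; apply: eq_fsbigr => r _.
by rewrite mulrA mulrC.
Qed.

(** The image under [phi] of [mu] weighted by [g], as a measure. Substitution formulas follow once
    it is recognised on intervals, by uniqueness of Lebesgue measure. *)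
Lemma transfer_measure : exists m : {measure set Y -> \bar R},
  forall A, measurable A -> m A = \int[mu]_x (\1_A (phi x) * g x)%R%:E.
Proof.
pose nu (A : set Y) := \int[mu]_x (\1_A (phi x) * g x)%R%:E.
have nu0 : nu set0 = 0.
  by rewrite /nu integral0_eq// => x _; rewrite indic0 mul0r.
have nug A : 0 <= nu A.
  by apply: integral_ge0 => x _; rewrite lee_fin mulr_ge0.
have nus : semi_sigma_additive nu.
  move=> F mF tF mUF.
  rewrite [X in _ --> X](_ : _ = \sum_(n <oo) nu (F n)); last first.
    rewrite /nu -integral_nneseries//; last 2 first.
    - by move=> n; apply: mindic.
    - by move=> n x _; rewrite lee_fin mulr_ge0.
    apply: eq_integral => x _.
    have [[k _ Fk]|nF] := pselect ((\bigcup_n F n) (phi x)).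
      rewrite (@nneseriesD1 _ _ k)//; last by move=> n _; rewrite lee_fin mulr_ge0.
      rewrite eseries0 ?adde0; last first.
        move=> i _ /= ik; rewrite indicE memNset ?mul0r// => Fi.
        by move/eqP: ik; apply; apply: (tF i k) => //; exists (phi x).
      by rewrite !indicE !mem_set//; exists k.
    rewrite indicE memNset// mul0r eseries0// => i _ _.
    by rewrite indicE memNset ?mul0r// => Fi; apply: nF; exists i.
  by apply: is_cvg_ereal_nneg_natsum_cond => n _ _.
pose M := isMeasure.Build _ _ _ nu nu0 nug nus.
pose m : {measure set Y -> \bar R} := HB.pack nu M.
by exists m.
Qed.
End transfer.

(** * Affine substitutions and the standard normal law *)

Section gauss.
Local Open Scope ereal_scope.
Context (R : realType).
Local Notation mu := (@lebesgue_measure R).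
Local Notation N01 := (normal_prob 0 1 : probability (measurableTypeR R) R).

(** By uniqueness, a map under which half-open intervals keep their length preserves Lebesgue
    measure; shifts and the reflection are the instances. *)
Lemma ge0_integral_comp (h : R -> R) (f : R -> \bar R) :
  measurable_fun setT h ->
  (forall a b, mu (h @^-1` `]a, b]) = mu `]a, b]%classic) ->
  measurable_fun setT f -> (forall x, 0 <= f x) ->
  \int[mu]_x f x = \int[mu]_x f (h x).
Proof.
move=> mh hE mf f0.
have [m mE] := @transfer_measure _ _ (measurableTypeR R) (measurableTypeR R) R mu h
  (cst 1%R) mh (measurable_cst _) (fun=> ler01).
have pE A : measurable A -> \int[mu]_x (\1_A (h x) * cst 1 x)%R%:E = mu (h @^-1` A).
  move=> mA; under eq_integral do rewrite /cst mulr1.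
  rewrite (_ : (fun x => _) = (fun x => (\1_(h @^-1` A) x)%:E)); last by apply/funext.
  rewrite integral_indic ?setIT//.
  by rewrite -[X in measurable X]setTI; exact: mh.
have mmu A : measurable A -> mu A = m A.
  apply: lebesgue_measure_unique => _ [[a b]] _ <-.
  by rewrite mE// pE// hE.
apply: (etrans (@ge0_integral_transfer _ _ (measurableTypeR R) (measurableTypeR R) R mu h
  (cst 1%R) mh (measurable_cst _) (fun=> ler01) mu _ f mf f0)).
  by move=> A mA; exact: etrans (mmu A mA) (mE A mA).
by apply: eq_integral => x _; rewrite mule1.
Qed.

Lemma ge0_integral_shift (c : R) (f : R -> \bar R) :
  measurable_fun setT f -> (forall x, 0 <= f x) ->
  \int[mu]_x f x = \int[mu]_x f (x + c)%R.
Proof.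
apply: (@ge0_integral_comp (fun x => x + c)%R); first by apply: measurable_funD.
move=> a b.
rewrite (_ : _ @^-1` _ = `](a - c)%R, (b - c)%R]%classic); last first.
  by apply/seteqP; split => x /=; rewrite !in_itv/= ltrBlDr lerBrDr.
rewrite !lebesgue_measure_itv/= !lte_fin ltrD2r.
by case: ifP => // _; rewrite -!EFinB; congr _%:E; ring.
Qed.

Lemma ge0_integral_opp (f : R -> \bar R) :
  measurable_fun setT f -> (forall x, 0 <= f x) ->
  \int[mu]_x f x = \int[mu]_x f (- x)%R.
Proof.
apply: (@ge0_integral_comp -%R); first exact: measurable_funN.
by move=> a b; exact: lebesgue_measureN.
Qed.

Lemma ge0_integral_scale (c : R) (f : R -> \bar R) : (0 < c)%R ->
  measurable_fun setT f -> (forall x, 0 <= f x) ->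
  \int[mu]_x f x = c%:E * \int[mu]_x f (c * x)%R.
Proof.
move=> c0 mf f0.
have mh : measurable_fun setT (fun x : measurableTypeR R => (c * x)%R : measurableTypeR R).
  by apply: measurable_funM.
have c0' : (forall x : measurableTypeR R, 0 <= (cst c x : R))%R by move=> ?; exact: ltW.
have [m mE] := @transfer_measure _ _ (measurableTypeR R) (measurableTypeR R) R mu
  (fun x => c * x)%R (cst c) mh (measurable_cst _) c0'.
have pE A : measurable A -> \int[mu]_x (\1_A (c * x)%R * cst c x)%R%:E =
    c%:E * mu ((fun x => c * x)%R @^-1` A).
  move=> mA.
  have mA' : measurable ((fun x : measurableTypeR R => (c * x)%R : measurableTypeR R) @^-1` A).
    by rewrite -[X in measurable X]setTI; exact: mh.
  transitivity (\int[mu]_x (c%:E * (\1_((fun x => c * x)%R @^-1` A) x)%:E)).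
    by apply: eq_integral => x _; rewrite /cst mulrC EFinM.
  have c0e : 0 <= c%:E by rewrite lee_fin ltW.
  rewrite (ge0_integralZl _ _ _ _ c0e)//=; last first.
    exact/measurable_EFinP/measurable_indic.
  by rewrite integral_indic// setIT.
have mmu A : measurable A -> mu A = m A.
  apply: lebesgue_measure_unique => _ [[a b]] _ <-.
  rewrite mE// pE//.
  rewrite (_ : _ @^-1` _ = `](a / c)%R, (b / c)%R]%classic); last first.
    by apply/seteqP; split => x /=; rewrite !in_itv/= ltr_pdivrMr// ler_pdivlMr// mulrC.
  rewrite !lebesgue_measure_itv/= !lte_fin ltr_pM2r ?invr_gt0//.
  case: ifP => [_|]; last by rewrite mule0.
  by rewrite -!EFinB -EFinM -mulrBl mulrC divfK ?gt_eqF.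
rewrite -ge0_integralZl//=; last by rewrite lee_fin ltW.
  apply: (etrans (@ge0_integral_transfer _ _ (measurableTypeR R) (measurableTypeR R) R mu
  (fun x => c * x)%R (cst c) mh (measurable_cst _) c0' mu _ f mf f0)).
    by move=> A mA; exact: etrans (mmu A mA) (mE A mA).
  by apply: eq_integral => x _; rewrite muleC.
exact: (measurableT_comp mf mh).
Qed.

Lemma normal_pdf01E (x : R) :
  normal_pdf 0 1 x = (normal_peak 1 * expR (- (x ^+ 2 / 2)))%R.
Proof.
rewrite normal_pdfE ?oner_eq0// /normal_fun subr0 expr1n mulNr.
by [].
Qed.

Lemma normal_pdf_shift (x m : R) :
  normal_pdf 0 1 (x + m) = (expR (- (m * x + m ^+ 2 / 2)) * normal_pdf 0 1 x)%R.
Proof.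
rewrite !normal_pdf01E mulrCA -expRD.
by congr (_ * expR _)%R; field.
Qed.

Lemma normal_pdfN (x : R) : normal_pdf 0 1 (- x) = normal_pdf 0 1 x.
Proof. by rewrite !normal_pdf01E sqrrN. Qed.

Lemma ge0_integral_N01 (f : R -> \bar R) :
  measurable_fun setT f -> (forall x, 0 <= f x) ->
  \int[N01]_x f x = \int[mu]_x (f x * (normal_pdf 0 1 x)%:E).
Proof.
move=> mf f0.
apply: (@ge0_integral_transfer _ _ (measurableTypeR R) (measurableTypeR R) R mu
  idfun (normal_pdf 0 1) (@measurable_id _ _ _) (@measurable_normal_pdf R 0 1)
  (@normal_pdf_ge0 R 0 1) N01 _ f mf f0).
move=> A mA; rewrite /= /normal_prob integral_mkcond.
apply: eq_integral => x _; rewrite patchE indicE.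
by case: (x \in A); rewrite ?mul1r ?mul0r.
Qed.

(** Cameron--Martin formula in one dimension; with [m] the current predictive mean it is one step of
    the change of measure. *)
Lemma N01_shift (m : R) (f : R -> \bar R) :
  measurable_fun setT f -> (forall x, 0 <= f x) ->
  \int[N01]_x f x = \int[N01]_z (f (z + m)%R * (expR (- (m * z + m ^+ 2 / 2)))%:E).
Proof.
move=> mf f0.
have mm : measurable_fun setT (fun x : R => (x + m)%R : R) by apply: measurable_funD.
rewrite !ge0_integral_N01//; last 2 first.
- apply: emeasurable_funM; first exact: (measurableT_comp mf mm).
  apply/measurable_EFinP; apply: measurableT_comp => //.
  by apply: measurableT_comp => //; apply: measurable_funD => //; apply: measurable_funM.
- by move=> x; rewrite mule_ge0// lee_fin expR_ge0.
rewrite (ge0_integral_shift m); last 2 first.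
- by apply: emeasurable_funM => //; apply/measurable_EFinP; exact: measurable_normal_pdf.
- by move=> x; rewrite mule_ge0// lee_fin normal_pdf_ge0.
apply: eq_integral => x _; rewrite -muleA; congr (_ * _).
by rewrite normal_pdf_shift EFinM.
Qed.

Lemma N01_sym (f : R -> \bar R) :
  measurable_fun setT f -> (forall x, 0 <= f x) ->
  \int[N01]_x f x = \int[N01]_x f (- x)%R.
Proof.
move=> mf f0.
have mm : measurable_fun setT (fun x : R => (- x)%R : R) by exact: measurable_funN.
rewrite !ge0_integral_N01//; last first.
  exact: (measurableT_comp mf mm).
rewrite ge0_integral_opp; last 2 first.
- by apply: emeasurable_funM => //; apply/measurable_EFinP; exact: measurable_normal_pdf.
- by move=> x; rewrite mule_ge0// lee_fin normal_pdf_ge0.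
by apply: eq_integral => x _; rewrite normal_pdfN.
Qed.

End gauss.

(** * Independent standard normal sequences *)

Section path_space.
Context (R : realType).
Implicit Types (J : {fset nat}) (A : nat -> set R).

Definition cyl J A : set (nat -> R) := [set x | forall i, i \in J -> A i (x i)].

Definition cylinders : set (set (nat -> R)) :=
  [set C | exists J A, (forall i, measurable (A i)) /\ C = cyl J A].

Definition sample_path : Type := g_sigma_algebraType cylinders.
HB.instance Definition _ := Measurable.on sample_path.

Lemma measurable_coord i : measurable_fun setT (fun x : sample_path => x i : R).
Proof.
move=> _ A mA; apply: sub_sigma_algebra.
exists [fset i]%fset, (fun=> A); split => //.
rewrite setTI; apply/seteqP; split => x /=.
  by move=> Axi j; rewrite inE => /eqP ->.
by move=> /(_ i); apply; rewrite inE.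
Qed.

Lemma measurable_cyl J A : (forall i, measurable (A i)) ->
  measurable (cyl J A : set sample_path).
Proof. by move=> mA; apply: sub_sigma_algebra; exists J, A. Qed.

Lemma measurable_path d (T : measurableType d) (f : T -> sample_path) :
  (forall i, measurable_fun setT (fun t => f t i)) -> measurable_fun setT f.
Proof.
move=> mf; apply: (@measurability _ _ T sample_path setT f cylinders) => //.
move=> _ [_ [J [A [mA ->]]] <-]; rewrite setTI.
rewrite (_ : _ @^-1` _ = \bigcap_(i in [set` J]) ((fun t => f t i) @^-1` A i)).
  apply: fin_bigcap_measurable; first exact: finite_fset.
  by move=> i _; rewrite -[X in measurable X]setTI; exact: mf.
by apply/seteqP; split.
Qed.

Lemma cylinders_setI : setI_closed cylinders.
Proof.
move=> _ _ [J [A [mA ->]]] [K [B [mB ->]]].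
exists (J `|` K)%fset, (fun i => (if i \in J then A i else setT) `&` (if i \in K then B i else setT)).
split.
  by move=> i; apply: measurableI; case: ifP.
apply/seteqP; split => x /=.
  by move=> [h1 h2] i iJK; split; case: ifPn => // ?; [exact: h1|exact: h2].
move=> h; split => i iJ.
- by have := h i; rewrite inE iJ /= => /(_ isT)[].
- by have := h i; rewrite inE iJ orbT /= => /(_ isT)[].
Qed.

Local Notation N01 := (normal_prob 0 1 : probability (measurableTypeR R) R).

(* The coordinates of [f] are independent and N(0,1) under [P]; in particular
   [iid_map LL idfun] says that [LL] is the law of such a sequence. *)
Definition iid_map d (T : measurableType d) (P : probability T R) (f : T -> sample_path) :=
  forall J A, (forall i, measurable (A i)) ->
    P (f @^-1` cyl J A) = (\prod_(i <- J) N01 (A i))%E.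

(** An i.i.d. N(0,1) sequence has only one law: two of them agree on the cylinders, a generating
    pi-system. Expectations can therefore be moved to any space that carries such a sequence. *)
Lemma iid_integral d1 d2 (T1 : measurableType d1) (T2 : measurableType d2)
  (P1 : probability T1 R) (P2 : probability T2 R) (f1 : T1 -> sample_path) (f2 : T2 -> sample_path) :
  measurable_fun setT f1 -> measurable_fun setT f2 ->
  iid_map P1 f1 -> iid_map P2 f2 ->
  forall F : sample_path -> \bar R, measurable_fun setT F -> (forall x, 0 <= F x)%E ->
  (\int[P1]_x F (f1 x) = \int[P2]_x F (f2 x))%E.
Proof.
move=> mf1 mf2 i1 i2 F mF F0.
have h d (T : measurableType d) (P : probability T R) (f : T -> sample_path) (mf : measurable_fun setT f) :
  (\int[P]_x F (f x) = \int[pushforward P f]_x F x)%E.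
  by rewrite ge0_integral_pushforward.
pose Q1 := isMeasurableFun.Build _ _ _ _ _ mf1.
pose g1 : {mfun T1 >-> sample_path} := HB.pack f1 Q1.
pose Q2 := isMeasurableFun.Build _ _ _ _ _ mf2.
pose g2 : {mfun T2 >-> sample_path} := HB.pack f2 Q2.
rewrite (h _ _ P1 f1 mf1) (h _ _ P2 f2 mf2).
apply: eq_measure_integral => /= A mA _.
apply: (@measure_unique _ R sample_path cylinders (fun=> setT) _ _ _ _ (pushforward P1 g1) (pushforward P2 g2)) => //.
- exact: cylinders_setI.
- by move=> _; exists fset0, (fun=> setT); split => //; apply/seteqP; split.
- by apply/seteqP; split => // x _; exists 0%N.
- by move=> _ [J [B [mB ->]]]; exact: etrans (i1 J B mB) (esym (i2 J B mB)).
- have e : (P1 setT < +oo)%E by rewrite probability_setT ltry.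
  by move=> k; exact: e.
Qed.

End path_space.

Lemma integral_prob_cst d (T : measurableType d) (R : realType) (P : probability T R) (c : \bar R) :
  (\int[P]_x cst c x = c)%E.
Proof. by rewrite integral_cst//= probability_setT mule1. Qed.

Section law.
Context (R : realType).
Local Notation N01 := (normal_prob 0 1 : probability (measurableTypeR R) R).
Local Notation sample_path := (sample_path R).
Variable LL : probability sample_path R.
Hypothesis iidLL : iid_map LL idfun.
Local Open Scope ereal_scope.

(* For injective [s], mixing two independent i.i.d. paths gives an i.i.d. path;
   resampling one coordinate and permuting coordinates are special cases. *)
Definition mix (s : nat -> nat + nat) (w : sample_path * sample_path) : sample_path :=
  fun i => match s i with inl j => w.1 j | inr j => w.2 j end.

Lemma measurable_mix s : measurable_fun setT (mix s).
Proof.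
apply: measurable_path => i; rewrite /mix; case: (s i) => j.
  by apply: (measurableT_comp (measurable_coord j)); exact: measurable_fst.
by apply: (measurableT_comp (measurable_coord j)); exact: measurable_snd.
Qed.

Lemma iid_seq (r : seq nat) (A : nat -> set R) : uniq r -> (forall i, measurable (A i)) ->
  LL [set x | forall i, i \in r -> A i (x i)] = \prod_(i <- r) N01 (A i).
Proof.
move=> ur mA.
rewrite (_ : [set x | _] = idfun @^-1` cyl [fset i in r]%fset A); last first.
  by apply/seteqP; split => x /= h i ir; apply: h; move: ir; rewrite inE.
rewrite iidLL//; apply: perm_big.
by apply: uniq_perm => // i; rewrite inE.
Qed.

Definition lefts (s : nat -> nat + nat) (r : seq nat) : seq nat :=
  pmap (fun i => if s i is inl j then Some j else None) r.
Definition rights (s : nat -> nat + nat) (r : seq nat) : seq nat :=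
  pmap (fun i => if s i is inr j then Some j else None) r.

Lemma mem_lefts s r j : injective s -> (j \in lefts s r) -> exists2 i, i \in r & s i = inl j.
Proof.
move=> sI; rewrite mem_pmap => /mapP[i ir]; case E : (s i) => [k|k] // [->].
by exists i.
Qed.

Lemma mem_rights s r j : injective s -> (j \in rights s r) -> exists2 i, i \in r & s i = inr j.
Proof.
move=> sI; rewrite mem_pmap => /mapP[i ir]; case E : (s i) => [k|k] // [->].
by exists i.
Qed.

(** By injectivity each coordinate of either path is read at most once, so the preimage of a
    cylinder is a rectangle of two cylinders and the product of the factors is merely reordered. *)
Lemma mix_iid s : injective s -> iid_map (LL \x LL) (mix s).
Proof.
move=> sI J A mA.
(* [inv] inverts [s] on [J]; elsewhere its default value only has to give a measurable set. *)
pose inv (v : nat + nat) := nth 0%N J (index v (map s J)).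
have invE i : i \in J -> inv (s i) = i.
  by move=> iJ; rewrite /inv index_map// nth_index.
pose B1 j := A (inv (inl j)); pose B2 j := A (inv (inr j)).
have uJ : uniq J by exact: fset_uniq.
have u1 : uniq (lefts s J).
  elim: (enum_fset J) uJ => //= i r IH /andP[ir /IH ur].
  rewrite /lefts/=; case E : (s i) => [j|j] //=.
  rewrite ur andbT; apply: contra ir => /(mem_lefts sI)[k kr sk].
  by rewrite (sI i k)// E sk.
have u2 : uniq (rights s J).
  elim: (enum_fset J) uJ => //= i r IH /andP[ir /IH ur].
  rewrite /rights/=; case E : (s i) => [j|j] //=.
  rewrite ur andbT; apply: contra ir => /(mem_rights sI)[k kr sk].
  by rewrite (sI i k)// E sk.
rewrite (_ : mix s @^-1` cyl J A =
    [set x | forall j, j \in lefts s J -> B1 j (x j)] `*`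
    [set x | forall j, j \in rights s J -> B2 j (x j)]); last first.
  apply/seteqP; split => -[x y] /=.
    move=> h; split => j.
      move=> /(mem_lefts sI)[i iJ si]; have := h i iJ.
      by rewrite /mix si /B1 -si invE.
    move=> /(mem_rights sI)[i iJ si]; have := h i iJ.
    by rewrite /mix si /B2 -si invE.
  move=> [h1 h2] i iJ; rewrite /mix; case E : (s i) => [j|j].
    have := h1 j; rewrite /B1 -E invE//; apply.
    by rewrite mem_pmap; apply/mapP; exists i => //; rewrite E.
  have := h2 j; rewrite /B2 -E invE//; apply.
  by rewrite mem_pmap; apply/mapP; exists i => //; rewrite E.
have m1 : measurable [set x : sample_path | forall j, j \in lefts s J -> B1 j (x j)].
  rewrite (_ : [set x | _] = cyl [fset i in lefts s J]%fset B1).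
    by apply: measurable_cyl => i; exact: mA.
  by apply/seteqP; split => x /= h i ir; apply: h; move: ir; rewrite inE.
have m2 : measurable [set x : sample_path | forall j, j \in rights s J -> B2 j (x j)].
  rewrite (_ : [set x | _] = cyl [fset i in rights s J]%fset B2).
    by apply: measurable_cyl => i; exact: mA.
  by apply/seteqP; split => x /= h i ir; apply: h; move: ir; rewrite inE.
apply: etrans; first exact: (@product_measure1E _ _ sample_path sample_path R LL LL _ _ m1 m2).
apply: etrans; first exact: (congr2 (fun a b : \bar R => a * b) (iid_seq (A := B1) u1 (fun=> mA _)) (iid_seq (A := B2) u2 (fun=> mA _))).
have : forall r : seq nat, {subset r <= J} ->
  (\prod_(i <- lefts s r) N01 (B1 i)) * (\prod_(i <- rights s r) N01 (B2 i)) =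
  \prod_(i <- r) N01 (A i).
  elim => [|i r IH] rJ; first by rewrite !big_nil mule1.
  rewrite big_cons -IH; last by move=> k kr; apply: rJ; rewrite inE kr orbT.
  have iJ : i \in J by apply: rJ; rewrite inE eqxx.
  rewrite /lefts /rights/=; case E : (s i) => [j|j] /=.
    by rewrite big_cons /B1 -[in LHS]E invE// muleA.
  by rewrite big_cons /B2 -[in LHS]E invE// muleCA.
by apply.
Qed.

Lemma integral_mix s (F : sample_path -> \bar R) : injective s ->
  measurable_fun setT F -> (forall x, 0 <= F x) ->
  \int[LL]_x F x = \int[LL]_x \int[LL]_y F (mix s (x, y)).
Proof.
move=> sI mF F0.
rewrite (@iid_integral _ _ _ _ _ LL (LL \x LL) idfun (mix s) (@measurable_id _ _ _)
  (@measurable_mix s) iidLL (mix_iid sI) F mF F0).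
rewrite (@fubini_tonelli1 _ _ _ _ _ LL LL (F \o mix s))//.
  by apply: measurableT_comp => //; exact: measurable_mix.
by move=> x; exact: F0.
Qed.

Lemma integral_coord i (f : R -> \bar R) : measurable_fun setT f -> (forall x, 0 <= f x) ->
  \int[LL]_x f (x i) = \int[N01]_z f z.
Proof.
move=> mf f0.
have mi := @measurable_coord R i.
rewrite (_ : \int[LL]_x f (x i) = \int[pushforward LL (fun x : sample_path => x i : measurableTypeR R)]_z f z); last by rewrite ge0_integral_pushforward.
apply: eq_measure_integral => A mA _.
have := @iid_seq [:: i] (fun=> A) isT (fun=> mA).
rewrite big_seq1.
rewrite (_ : [set x | _] = (fun x : sample_path => x i) @^-1` A).
  by move=> h; exact: h.
apply/seteqP; split => x /=; first by apply; rewrite inE.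
by move=> Ax j; rewrite inE => /eqP ->.
Qed.

Definition upd (x : sample_path) (n : nat) (z : R) : sample_path := fun i => if i == n then z else x i.

Lemma measurable_upd n : measurable_fun setT (fun xz : sample_path * R => upd xz.1 n xz.2).
Proof.
apply: measurable_path => i; rewrite /upd; case: (i == n).
  exact: measurable_snd.
by apply: (measurableT_comp (measurable_coord i)); exact: measurable_fst.
Qed.

(** Mixing with a second path at position [n] alone. Conditioning on all coordinates but one takes
    this form throughout. *)
Lemma integral_resample n (F : sample_path -> \bar R) : 
  measurable_fun setT F -> (forall x, 0 <= F x) ->
  \int[LL]_x F x = \int[LL]_x \int[N01]_z F (upd x n z).
Proof.
move=> mF F0.
pose s i : nat + nat := if i == n then inr 0%N else inl i.
have sI : injective s.
  move=> i j; rewrite /s; case: eqP => [->|_]; case: eqP => [->|_] //.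
  by case.
rewrite (integral_mix sI)//; apply: eq_integral => x _.
rewrite -(@integral_coord 0 (fun z => F (upd x n z)))//.
- apply: eq_integral => y _; congr F; apply/funext => i.
  by rewrite /mix /s /upd; case: eqP.
- apply: (measurableT_comp mF).
  apply: (@measurableT_comp _ _ _ _ _ _ (fun xz : sample_path * R => upd xz.1 n xz.2) _ (fun z => (x, z))).
    exact: measurable_upd.
  exact: measurable_pair1.
Qed.

Lemma integral_perm s (F : sample_path -> \bar R) : injective s ->
  measurable_fun setT F -> (forall x, 0 <= F x) ->
  \int[LL]_x F x = \int[LL]_x F (fun i => x (s i)).
Proof.
move=> sI mF F0.
have sI' : injective (fun i => inl (s i) : nat + nat) by move=> i j []; exact: sI.
rewrite (integral_mix sI')//; apply: eq_integral => x _.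
rewrite (_ : (fun y => _) = cst (F (fun i => x (s i)))); last by apply/funext.
exact: integral_prob_cst.
Qed.

End law.

(** * Change of measure *)

Section change_of_measure.
Context (R : realType).
Local Notation N01 := (normal_prob 0 1 : probability (measurableTypeR R) R).
Local Notation sample_path := (sample_path R).
Variable LL : probability sample_path R.
Hypothesis iidLL : iid_map LL idfun.
Variables (s t : R).
Hypothesis st : (0 < t \/ (s = 0 /\ t = 0))%R.
Local Open Scope ereal_scope.

(* The predictive mean mu_{n+1} and log Lambda_n as functions of the innovations
   [z i] = x i - mu_{i+1}, which are i.i.d. N(0,1) under the measure with density
   Lambda_n. *)
Definition post_mean (z : nat -> R) n : R :=
  (s / t + \sum_(i < n) z i / (i.+1%:R + t))%R.

Definition log_lr (z : nat -> R) n : R :=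
  (\sum_(i < n) (post_mean z i * z i + post_mean z i ^+ 2 / 2))%R.

(* The observations whose first [k] innovations are those of [z]. *)
Definition shift_path k (z : nat -> R) : nat -> R :=
  fun i => if (i < k)%N then (z i + post_mean z i)%R else z i.

Lemma t_ge0 : (0 <= t)%R.
Proof. by case: st => [/ltW//|[_ ->]]. Qed.

Lemma tS_gt0 (i : nat) : (0 < i.+1%:R + t)%R.
Proof. by rewrite ltr_wpDr ?t_ge0// ltr0Sn. Qed.

Lemma post_meanS z n : post_mean z n.+1 = (post_mean z n + z n / (n.+1%:R + t))%R.
Proof. by rewrite /post_mean big_ord_recr/= addrA. Qed.

Lemma log_lrS z n :
  log_lr z n.+1 = (log_lr z n + (post_mean z n * z n + post_mean z n ^+ 2 / 2))%R.
Proof. by rewrite /log_lr big_ord_recr. Qed.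

Lemma post_mean_shift z k n : (n <= k)%N -> pred_mean s t (shift_path k z) n = post_mean z n.
Proof.
move=> nk.
(* The division is cleared, so that the induction also starts correctly when s = t = 0, where
   [s / t] is 0. *)
have key : (forall m, (m <= k)%N -> \sum_(i < m) shift_path k z i + s = (m%:R + t) * post_mean z m)%R.
  elim => [|m IH] mk.
    rewrite big_ord0 /post_mean big_ord0 addr0 add0r.
    case: st => [t0|[-> ->]]; last by rewrite !(mulr0, mul0r).
    by rewrite add0r mulrC divfK ?gt_eqF.
  rewrite big_ord_recr/= -addrA [X in (_ + X)%R]addrC addrA IH; last exact: ltnW.
  rewrite /shift_path mk post_meanS.
  set S := post_mean z m.
  have h : (m.+1%:R + t != 0)%R by rewrite gt_eqF// tS_gt0.
  by rewrite -natr1 in h *; field.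
case: n nk => [|n] nk; first by rewrite /pred_mean /post_mean big_ord0 addr0.
rewrite /pred_mean /sample_mean mulrA divff ?pnatr_eq0// mul1r key//.
by rewrite mulrC mulKf// gt_eqF// tS_gt0.
Qed.

Lemma adaptive_lr_shift z k n : (n <= k)%N ->
  adaptive_lr s t (shift_path k z) n = expR (log_lr z n).
Proof.
move=> nk; rewrite /adaptive_lr /log_lr; congr expR; apply: eq_bigr => i _.
have ik : (i < k)%N by exact: leq_trans nk.
rewrite post_mean_shift; last exact: ltnW.
by rewrite /shift_path ik; field.
Qed.

Lemma measurable_post_mean n : measurable_fun setT (fun z : sample_path => post_mean z n).
Proof.
apply: measurable_funD => //.
rewrite (_ : (fun z : sample_path => _) = (fun z => \sum_(i <- index_enum 'I_n) z i / (i.+1%:R + t)))%R.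
  apply: measurable_sum => i; apply: measurable_funM => //; exact: measurable_coord.
by apply/funext => z.
Qed.

Lemma measurable_log_lr n : measurable_fun setT (fun z : sample_path => log_lr z n).
Proof.
apply: measurable_sum => i; apply: measurable_funD.
  apply: measurable_funM; first exact: measurable_post_mean.
  exact: measurable_coord.
by apply: measurable_funM => //; apply: measurable_funX; exact: measurable_post_mean.
Qed.

Lemma measurable_shift_path k : measurable_fun setT (shift_path k : sample_path -> sample_path).
Proof.
apply: measurable_path => i; rewrite /shift_path; case: (i < k)%N.
  by apply: measurable_funD; [exact: measurable_coord|exact: measurable_post_mean].
exact: measurable_coord.
Qed.

Lemma post_mean_upd z k x n : (n <= k)%N -> post_mean (upd z k x) n = post_mean z n.
Proof.
move=> nk; rewrite /post_mean; congr (_ + _)%R; apply: eq_bigr => i _.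
by rewrite /upd ltn_eqF//; exact: leq_trans nk.
Qed.

Lemma log_lr_upd z k x n : (n <= k)%N -> log_lr (upd z k x) n = log_lr z n.
Proof.
move=> nk; rewrite /log_lr; apply: eq_bigr => i _.
have ik : (i < k)%N by exact: leq_trans nk.
by rewrite post_mean_upd 1?ltnW// /upd ltn_eqF.
Qed.

(** Likelihood ratio identity at a finite horizon. Passing from [k] to [k.+1] shifts coordinate [k]
    by [post_mean z k], a function of earlier innovations only; once that coordinate is resampled
    this is [N01_shift]. Both sides are expectations under [LL], on the left over observations, on
    the right over innovations. *)
Lemma change_of_measure k (f : sample_path -> \bar R) :
  measurable_fun setT f -> (forall x, 0 <= f x) ->
  \int[LL]_x f x = \int[LL]_z (f (shift_path k z) * (expR (- log_lr z k))%:E).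
Proof.
move=> mf f0; elim: k => [|k IH].
  apply: eq_integral => z _; rewrite /log_lr big_ord0 oppr0 expR0 mule1.
  by congr f; apply/funext.
have mG j : measurable_fun setT (fun z : sample_path => f (shift_path j z) * (expR (- log_lr z j))%:E).
  apply: emeasurable_funM; first exact: (measurableT_comp mf (measurable_shift_path j)).
  apply/measurable_EFinP; apply: measurableT_comp => //.
  by apply: measurableT_comp => //; exact: measurable_log_lr.
have G0 j z : 0 <= f (shift_path j z) * (expR (- log_lr z j))%:E.
  by rewrite mule_ge0// lee_fin expR_ge0.
rewrite IH (integral_resample iidLL k (mG k) (G0 k)) [RHS](integral_resample iidLL k (mG k.+1) (G0 k.+1)).
apply: eq_integral => z _.
have mu_ : measurable_fun setT (fun x : R => upd z k x : sample_path).
  apply: (@measurableT_comp _ _ _ _ _ _ (fun xz : sample_path * R => upd xz.1 k xz.2) _ (fun x => (z, x))).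
    exact: measurable_upd.
  exact: measurable_pair1.
rewrite (N01_shift (post_mean z k)); last 2 first.
- exact: (measurableT_comp (mG k) mu_).
- by move=> x; exact: G0.
apply: eq_integral => x _.
rewrite -muleA -EFinM -expRD; congr (f _ * (expR _)%:E).
  apply/funext => i; rewrite /shift_path ltnS.
  have [ik|ik|->] := ltngtP i k.
  - by rewrite !post_mean_upd 1?ltnW// /upd ltn_eqF.
  - by rewrite /upd gtn_eqF.
  - by rewrite post_mean_upd// /upd eqxx.
rewrite [in RHS]/log_lr big_ord_recr/= -/(log_lr _ k) !log_lr_upd// post_mean_upd//.
by rewrite /upd eqxx [RHS]opprD.
Qed.

End change_of_measure.

(** * First crossings and reduction to the overshoot *)

Section reduction.
Context (R : realType).
Local Notation sample_path := (sample_path R).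
Local Open Scope ereal_scope.

Definition first_hit (b : R) (l : nat -> R) (n : nat) : bool :=
  [&& (0 < n)%N, (b <= l n)%R & all (fun j => (l j < b)%R) (iota 1 n.-1)].

Lemma first_hitP (b : R) (l : nat -> R) n : first_hit b l n ->
  [/\ (0 < n)%N, (b <= l n)%R & forall j, (0 < j < n)%N -> (l j < b)%R].
Proof.
case/and3P => n0 bl /allP h; split => // j /andP[j0 jn].
by apply: h; rewrite mem_iota j0 add1n prednK.
Qed.

Lemma first_hit_uniq b l n m : first_hit b l n -> first_hit b l m -> n = m.
Proof.
move=> /first_hitP[n0 bn hn] /first_hitP[m0 bm hm].
case: (ltngtP n m) => // [nm|mn].
  by have := hm n; rewrite n0 nm => /(_ isT); rewrite ltNge bn.
by have := hn m; rewrite m0 mn => /(_ isT); rewrite ltNge bm.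
Qed.

Lemma first_hit_ex b l n : (0 < n)%N -> (b <= l n)%R -> exists m, first_hit b l m.
Proof.
move=> n0 bl.
have ex : exists n, (0 < n)%N && (b <= l n)%R by exists n; rewrite n0.
case: (ex_minnP ex) => m /andP[m0 bm] mmin; exists m; rewrite /first_hit m0 bm/=.
apply/allP => j; rewrite mem_iota add1n prednK// => /andP[j0 jm].
rewrite ltNge; apply/negP => bj; have := mmin j; rewrite j0 bj => /(_ isT).
by rewrite leqNgt jm.
Qed.

Lemma eq_first_hit b l l' n : (forall j, (j <= n)%N -> l j = l' j) ->
  first_hit b l n = first_hit b l' n.
Proof.
move=> ll'; rewrite /first_hit ll'//; congr [&& _, _ & _].
apply: eq_in_all => j; rewrite mem_iota => /andP[j0 jn].
rewrite ll'//; case: n ll' jn => [|n] ll' /=; last by rewrite add1n ltnS => /leqW.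
by rewrite addn0; case: j j0.
Qed.

Lemma measurable_first_hit b n d (T : measurableType d) (l : nat -> T -> R) :
  (forall j, measurable_fun setT (l j)) ->
  measurable [set x | first_hit b (l^~ x) n].
Proof.
move=> ml.
have mge (c : R) j : measurable [set x | (c <= l j x)%R].
  rewrite (_ : [set x | _] = l j @^-1` `[c, +oo[%classic).
    by rewrite -[X in measurable X]setTI; exact: ml.
  by apply/seteqP; split => x /=; rewrite in_itv/= andbT.
case: (posnP n) => [->|n0].
  rewrite (_ : [set x | _] = set0)//; apply/seteqP; split => x //.
rewrite (_ : [set x | _] = [set x | (b <= l n x)%R] `&`
  \bigcap_(j in [set j | (0 < j < n)%N]) ~` [set x | (b <= l j x)%R]).
  apply: measurableI => //.
  by apply: bigcap_measurableType => j _; apply: measurableC.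
apply/seteqP; split => x /=.
  move=> /first_hitP[_ bn h]; split => //.
  by move=> j /h; rewrite ltNge => /negP.
move=> [bn h]; rewrite /first_hit n0 bn/=.
apply/allP => j; rewrite mem_iota add1n prednK// => jn.
by rewrite ltNge; apply/negP/h.
Qed.

Variables (s t : R).
Hypothesis st : (0 < t \/ (s = 0 /\ t = 0))%R.

Definition lr_exponent (x : nat -> R) n : R :=
  (\sum_(i < n) (pred_mean s t x i * x i - pred_mean s t x i ^+ 2 / 2))%R.

Lemma measurable_pred_mean n : measurable_fun setT (fun x : sample_path => pred_mean s t x n).
Proof.
case: n => [|n] //=; apply: measurable_funM => //; apply: measurable_funD => //.
apply: measurable_funM => //; apply: measurable_funM => //.
by apply: measurable_sum => i; exact: measurable_coord.
Qed.

Lemma measurable_lr_exponent n : measurable_fun setT (fun x : sample_path => lr_exponent x n).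
Proof.
apply: measurable_sum => i; apply: measurable_funB.
  by apply: measurable_funM; [exact: measurable_pred_mean|exact: measurable_coord].
by apply: measurable_funM => //; apply: measurable_funX; exact: measurable_pred_mean.
Qed.

Lemma crossing_time_lty b (x : nat -> R) :
  (crossing_time s t b x < +oo) <-> (exists n, first_hit b (lr_exponent x) n).
Proof.
split.
  move=> h; apply: contrapT => nex; move: h; rewrite /crossing_time.
  rewrite (_ : [set _ | _ in _] = set0) ?ereal_inf0//.
  apply/seteqP; split => // ? [n [n0 bn] _]; apply: nex.
  apply: (@first_hit_ex _ _ n) => //.
  by rewrite -ler_expR.
move=> [n /first_hitP[n0 bn _]].
apply: (@le_lt_trans _ _ n%:R%:E); last exact: ltry.
by apply: ereal_inf_lbound; exists n => //; split => //; rewrite /adaptive_lr ler_expR.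
Qed.

(** The part of E[g(log Lambda_tau - b)] coming from tau = n, for i.i.d. innovations. The weight [g]
    is left free because the crossing probability involves e^{-u} and its lower bound 1 - e^{-u}. *)
Definition hit_term (LL : probability sample_path R) (b : R) (g : R -> R) n : \bar R :=
  \int[LL]_z ((\1_[set z | first_hit b (log_lr s t z) n] z * g (log_lr s t z n - b))%R)%:E.

(** [LL] is the image of [P] under the whole sequence. On tau = n the likelihood ratio identity is
    applied up to time [n], and exp(- log Lambda_n) splits into e^{-b} and the overshoot factor. *)
Lemma crossing_prob d (T : measurableType d) (P : probability T R) (X : nat -> {RV P >-> R})
  (H0 : iid_std_normal X) :
  exists LL : probability sample_path R, iid_map LL idfun /\
   forall b, P [set w | crossing_time s t b (fun i => X i w) < +oo] =
    (expR (- b))%:E * \sum_(n <oo) hit_term LL b (fun u => expR (- u))%R n.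
Proof.
have mX : measurable_fun setT (fun w => (fun i => X i w) : sample_path).
  by apply: measurable_path => i; exact: measurable_funP.
pose Q := isMeasurableFun.Build _ _ _ _ _ mX.
pose Xm : {mfun T >-> sample_path} := HB.pack (fun w => (fun i => X i w) : sample_path) Q.
pose LL : probability sample_path R := distribution P Xm.
have iidLL : iid_map LL idfun.
  move=> J A mA; case: H0 => iX dX.
  transitivity (P (\bigcap_(i in [set` J]) X i @^-1` A i)).
    by congr (P _); apply/seteqP; split.
  by rewrite iX//; apply: eq_bigr => i _; exact: dX.
exists LL; split => // b.
pose A n := [set x : sample_path | first_hit b (lr_exponent x) n].
have mA n : measurable (A n).
  have h := @measurable_first_hit b n _ sample_path (fun j (x : sample_path) => lr_exponent x j).
  apply: h => j.
  exact: measurable_lr_exponent.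
transitivity (LL (\bigcup_n A n)).
  congr (P _); apply/seteqP; split => w /=.
    by move/crossing_time_lty => [n hn]; exists n.
  by move=> [n _ hn]; apply/crossing_time_lty; exists n.
rewrite measure_bigcup//; last first.
  by move=> n m _ _ [x [hn hm]]; exact: first_hit_uniq hn hm.
rewrite -nneseriesZl; last first.
  move=> n _; apply: integral_ge0 => z _.
  by rewrite lee_fin mulr_ge0// expR_ge0.
rewrite (eq_eseriesl (Q := xpredT)); last by move=> i; rewrite in_setT.
apply: eq_eseriesr => n _.
have mB : measurable [set z : sample_path | first_hit b (log_lr s t z) n].
  have h := @measurable_first_hit b n _ sample_path (fun j (z : sample_path) => log_lr s t z j).
  by apply: h => j; exact: measurable_log_lr.
have mt : measurable_fun setT (fun z : sample_path =>
    ((\1_[set z | first_hit b (log_lr s t z) n] z * expR (- (log_lr s t z n - b)))%R)%:E).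
  apply/measurable_EFinP/measurable_funM; first exact: measurable_indic.
  apply: measurableT_comp => //; apply: measurableT_comp => //.
  by apply: measurable_funB => //; exact: measurable_log_lr.
have eb : 0 <= (expR (- b))%:E by rewrite lee_fin expR_ge0.
rewrite /hit_term -(ge0_integralZl _ measurableT mt _ eb)//.
rewrite -[A n]setIT -integral_indic//.
rewrite (change_of_measure iidLL s t n); last 2 first.
- exact/measurable_EFinP/measurable_indic.
- by move=> x; rewrite lee_fin.
apply: eq_integral => z _; rewrite -!EFinM; congr _%:E.
rewrite [RHS]mulrCA -expRD; congr (_ * expR _)%R; last by ring.
rewrite !indicE; congr (nat_of_bool _)%:R; apply/asbool_equiv_eq.
rewrite /A/= (@eq_first_hit b _ (log_lr s t z))// => j jn.
apply: expR_inj; rewrite -(adaptive_lr_shift st _ jn).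
by [].
Qed.

End reduction.

(** * Integrating out the first innovation *)

Section quadratic.
Context (R : realType).
Variables (s t : R).
Hypothesis st : (0 < t \/ (s = 0 /\ t = 0))%R.
Local Notation a := (s / t).
Implicit Types z : nat -> R.

(** For M the mean after n steps, (n+1+t)(M + z/(n+1+t))^2 = (n+t) M^2 + 2(M z + M^2/2) +
    z^2/(n+1+t), and the middle term is twice the increment of log Lambda. *)
Lemma log_lr_quadratic z n :
  log_lr s t z n = (n%:R + t) / 2 * post_mean s t z n ^+ 2 - t / 2 * a ^+ 2
    - \sum_(i < n) z i ^+ 2 / (i.+1%:R + t) / 2.
Proof.
elim: n => [|n IH].
  by rewrite /log_lr !big_ord0 /post_mean big_ord0; ring.
rewrite log_lrS IH post_meanS big_ord_recr/=.
have h : n.+1%:R + t != 0 by rewrite gt_eqF// (tS_gt0 st).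
move: h; rewrite -natr1; set S := \sum_(i < n) _; set M := post_mean _ _ _ _ => h.
by set a0 := a; field; rewrite h.
Qed.

(* The predictive means recovered backwards in time, from the last one [y] and the
   innovations [r] in reversed order. *)
Definition back_mean (D : nat -> R) (y : R) (r : nat -> R) i : R :=
  y - \sum_(l < i.+1) r l / D l.

Definition back_incr D y r j : R :=
  \sum_(i < j) (back_mean D y r i * r i + back_mean D y r i ^+ 2 / 2).

Lemma post_mean_back z n i : (i < n)%N ->
  post_mean s t z (n.-1 - i) = back_mean (fun l => (n - l)%:R + t) (post_mean s t z n)
    (fun l => z (n.-1 - l)%N) i.
Proof.
rewrite /back_mean; elim: i => [|i IH] ni.
  rewrite big_ord_recr big_ord0/= !subn0 add0r; case: n ni => // n _ /=.
  by rewrite post_meanS addrK.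
rewrite big_ord_recr/= opprD addrA -IH; last exact: ltnW.
have e : (n.-1 - i = (n.-1 - i.+1).+1)%N by lia.
rewrite [in RHS]e post_meanS.
have -> : (n - i.+1 = (n.-1 - i.+1).+1)%N by lia.
by rewrite addrK.
Qed.

(** Past means are functions of the last one and of the reversed innovations; the absence of earlier
    crossings thereby becomes a condition on a walk started at time [n]. *)
Lemma log_lr_back z n j : (j <= n)%N ->
  log_lr s t z n - log_lr s t z (n - j) =
  back_incr (fun l => (n - l)%:R + t) (post_mean s t z n) (fun l => z (n.-1 - l)%N) j.
Proof.
rewrite /back_incr; elim: j => [|j IH] jn; first by rewrite big_ord0 subn0 subrr.
rewrite big_ord_recr/= -IH; last exact: ltnW.
rewrite -post_mean_back//.
have e : (n - j = (n.-1 - j).+1)%N by lia.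
have -> : (n - j.+1 = n.-1 - j)%N by lia.
by rewrite e log_lrS; ring.
Qed.

End quadratic.

(** Inversion is discontinuous at 0, where its value is 0; on each open half-line it is written with
    exp and ln. *)
Lemma measurable_inv (R : realType) : measurable_fun setT (fun x : R => x^-1).
Proof.
rewrite (_ : (fun x => _) = (fun x : R => if 0 < x then expR (- ln x) else
    if 0 < - x then - expR (- ln (- x)) else 0)).
  apply: measurable_fun_ifT; first exact: measurable_fun_ltr.
    apply: measurableT_comp => //; apply: measurableT_comp => //; exact: measurable_ln.
  apply: measurable_fun_ifT => //; first by apply: measurable_fun_ltr => //; exact: measurable_funN.
  apply: measurableT_comp => //; apply: measurableT_comp => //; apply: measurableT_comp => //.
  by apply: measurableT_comp; [exact: measurable_ln|exact: measurable_funN].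
apply/funext => x; rewrite oppr_gt0.
have [x0|x0|<-] := ltgtP 0 x; last by rewrite invr0.
- by rewrite expRN lnK.
- by rewrite expRN lnK ?posrE ?oppr_gt0// invrN opprK.
Qed.

Lemma measurable_sqrtr (R : realType) : measurable_fun setT (@Num.sqrt R).
Proof. by apply: continuous_measurable_fun; exact: sqrt_continuous. Qed.

(** * The substitution u = k v^2 / 2 - B *)

Section sqrt_substitution.
Context (R : realType).
Local Notation mu := (@lebesgue_measure R).
Local Open Scope ereal_scope.
Variables (k B : R).
Hypotheses (k0 : (0 < k)%R) (B0 : (0 < B)%R).

Let v0 : R := Num.sqrt (2 * B / k).
Let phi (u : R) : R := Num.sqrt (2 * (u + B) / k).
Let jac (u : R) : R := (Num.sqrt (2 * k * (u + B)))^-1.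
Let h (v : R) : R := (k * v ^+ 2 / 2 - B)%R.

Let v00 : (0 < v0)%R. Proof. by rewrite sqrtr_gt0 divr_gt0// mulr_gt0. Qed.

Let phiK v : (0 <= v)%R -> phi (h v) = v.
Proof.
move=> v_ge0; rewrite /phi /h (_ : _ / k = v ^+ 2)%R; last by field; rewrite gt_eqF.
by rewrite sqrtr_sqr ger0_norm.
Qed.

Let hK u : (- B <= u)%R -> h (phi u) = u.
Proof.
move=> u0; rewrite /phi /h sqr_sqrtr; first by field; rewrite gt_eqF.
by apply: divr_ge0; [apply: mulr_ge0 => //; lra|exact: ltW].
Qed.

Let h_lt v w : (0 <= v)%R -> (v < w)%R -> (h v < h w)%R.
Proof.
move=> v_ge0 vw; rewrite ltrD2r ltr_pM2r// ltr_pM2l// ltr_pXn2r// nnegrE//.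
by rewrite (le_trans v_ge0)// ltW.
Qed.

Let h_v0 : h v0 = 0%R.
Proof.
rewrite /h sqr_sqrtr; first by field; rewrite gt_eqF.
by apply: divr_ge0; [apply: mulr_ge0 => //; exact: ltW|exact: ltW].
Qed.

Let h_ltE v w : (0 <= v)%R -> (0 <= w)%R -> (h v < h w)%R = (v < w)%R.
Proof.
move=> vp wp; apply/idP/idP; last exact: h_lt.
apply: contraTT; rewrite -!leNgt le_eqVlt => /predU1P[->//|wv].
by rewrite ltW// h_lt.
Qed.

Let phi_lt p u : (0 <= p)%R -> (- B <= u)%R -> (p < phi u)%R = (h p < u)%R.
Proof. by move=> p0 uB; rewrite -h_ltE ?hK// sqrtr_ge0. Qed.

Let phi_le p u : (0 <= p)%R -> (- B <= u)%R -> (phi u <= p)%R = (u <= h p)%R.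
Proof. by move=> p0 uB; rewrite !leNgt phi_lt. Qed.

Let jac_ge0 u : (0 <= jac u)%R. Proof. by rewrite invr_ge0 sqrtr_ge0. Qed.

Let derive_phi u : (- B < u)%R -> is_derive u 1%R phi (jac u).
Proof.
move=> u0.
have pos : (0 < 2 * (u + B) / k)%R by apply: divr_gt0 => //; lra.
have h1 : is_derive u 1%R (fun u : R => 2 * (u + B) / k)%R (2 / k)%R.
  rewrite (_ : (fun u => _) = (fun u : R => (2 / k) *: (u + B)))%R; last first.
    by apply/funext => x; rewrite /GRing.scale/=; ring.
  apply: is_derive_eq.
  by rewrite addr0 /GRing.scale/= mulr1.
have h2 := @is_derive1_comp R Num.sqrt (fun u : R => 2 * (u + B) / k)%R u _ _ (is_derive1_sqrt pos) h1.
apply: (is_derive_eq h2).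
rewrite /jac /GRing.scale/=.
have -> : Num.sqrt (2 * k * (u + B)) = (k * Num.sqrt (2 * (u + B) / k))%R.
  rewrite -[X in _ = (X * _)%R](ger0_norm (ltW k0)) -sqrtr_sqr -sqrtrM ?sqr_ge0//.
  by congr Num.sqrt; field; rewrite gt_eqF.
have := pos; rewrite -sqrtr_gt0; set q := Num.sqrt _ => q0.
by field; rewrite !gt_eqF.
Qed.

Let cont_jac u : (- B < u)%R -> {for u, continuous jac}.
Proof.
move=> u0; rewrite /jac; apply: cvgV.
  by rewrite gt_eqF// sqrtr_gt0; apply: mulr_gt0; [apply: mulr_gt0|lra].
apply: (continuous_comp (f := fun u => 2 * k * (u + B))%R); last exact: sqrt_continuous.
apply: cvgM; first exact: cvg_cst.
by apply: cvgD; [exact: cvg_id|exact: cvg_cst].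
Qed.

Let int_jac p q : (0 <= p)%R -> (p < q)%R ->
  \int[mu]_(u in `[p, q]) (jac u)%:E = (phi q)%:E - (phi p)%:E.
Proof.
move=> p0 pq; have b0 := B0.
have cphi x : (p <= x)%R -> {for x, continuous phi}.
  move=> px; apply: differentiable_continuous; apply/derivable1_diffP.
  by have [] := @derive_phi x ltac:(lra).
apply: continuous_FTC2 => //.
- apply: continuous_in_subspaceT => x; rewrite inE/= in_itv/= => /andP[px _].
  by apply: cont_jac; lra.
- split.
  + by move=> x; rewrite in_itv/= => /andP[px _]; have [] := @derive_phi x ltac:(lra).
  + by apply: cvg_at_right_filter; exact: cphi.
  + by apply: cvg_at_left_filter; apply: cphi; exact: ltW.
- move=> x; rewrite in_itv/= => /andP[px _]; rewrite derive1E.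
  by have [_ ->] := @derive_phi x ltac:(lra).
Qed.

Let mphi : measurable_fun setT phi.
Proof.
apply: measurableT_comp; first exact: measurable_sqrtr.
apply: measurable_funM => //; apply: measurable_funM => //.
by apply: measurable_funD.
Qed.

Let g (u : R) : R := if (0 < u)%R then jac u else 0%R.

Let mjac : measurable_fun setT jac.
Proof.
apply: (@measurableT_comp _ _ _ _ _ _ (fun x : R => x^-1)%R); first exact: measurable_inv.
apply: measurableT_comp; first exact: measurable_sqrtr.
by apply: measurable_funM => //; apply: measurable_funD.
Qed.

Let mg : measurable_fun setT g.
Proof.
apply: measurable_fun_ifT => //.
by apply: measurable_fun_ltr.
Qed.

Let g0 u : (0 <= g u)%R. Proof. by rewrite /g; case: ifP. Qed.

(** The image under [phi] of [jac] du on u > 0 is Lebesgue measure on v > v0: on intervals this is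
    the fundamental theorem of calculus, [jac] being the derivative of [phi]. *)
Lemma ge0_integral_sqrt (f : R -> \bar R) :
  measurable_fun setT f -> (forall x, 0 <= f x) ->
  \int[mu]_(v in `]v0, +oo[) f v = \int[mu]_(u in `]0%R, +oo[) (f (phi u) * (jac u)%:E).
Proof.
move=> mf f0.
have [m mE] := @transfer_measure _ _ (measurableTypeR R) (measurableTypeR R) R mu phi g mphi mg g0.
have mD : measurable (`]v0, +oo[%classic : set (measurableTypeR R)) by [].
have mDC : measurable (`]-oo, v0]%classic : set (measurableTypeR R)) by [].
(* Lebesgue measure on v <= v0 is added because uniqueness is a statement about the whole line. *)
have mmu A : measurable A -> mu A = measure_add (mrestr mu mDC) m A.
  apply: lebesgue_measure_unique => _ [[p q]] _ <-/=.
  apply: etrans (esym (measure_addE (mrestr mu mDC) m _)).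
  rewrite mE//=.
  have -> : mrestr mu mDC `]p, q] = mu `]p, Num.min q v0]%classic.
    rewrite /mrestr; congr (mu _); apply/seteqP; split => x /=; rewrite !in_itv/= le_min.
      by move=> [/andP[-> ->] ->].
    by move=> /and3P[-> -> ->].
  (* Only the part of ]p, q] beyond v0 is reached from u > 0. *)
  pose p' := Num.max p v0.
  have p'0 : (0 < p')%R by rewrite lt_max v00 orbT.
  have hp'0 : (0 <= h p')%R.
    by rewrite -h_v0 leNgt h_ltE ?ltW// -leNgt le_max lexx orbT.
  have b0 := B0.
  have E : \int[mu]_x (\1_(`]p, q]) (phi x) * g x)%:E = \int[mu]_(x in `]h p', h q]) (if (p' < q)%R then jac x else 0%R)%:E.
    rewrite [RHS]integral_mkcond; apply: eq_integral => u _.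
    rewrite patchE /g indicE.
    have [u0|u0] := ltP 0%R u; last first.
      rewrite mulr0; case: ifP => //; rewrite inE/= in_itv/= => /andP[hu _].
      by move: u0; rewrite leNgt (le_lt_trans hp'0 hu).
    have uB : (- B <= u)%R by lra.
    have [q0|q0] := ltP 0%R q; last first.
      rewrite (_ : (p' < q)%R = false); last first.
        by apply/negbTE; rewrite -leNgt (le_trans q0)// ltW.
      rewrite if_same memNset ?mul0r// /= in_itv/= => /andP[_].
      rewrite leNgt => /negP; apply; apply: (le_lt_trans q0).
      by rewrite -[X in (X < _)%R]/(0%R) sqrtr_gt0 divr_gt0//; lra.
    have vu : (v0 < phi u)%R by rewrite phi_lt ?h_v0// ltW.
    have -> : (phi u \in (`]p, q]%classic : set R)) = (u \in (`]h p', h q]%classic : set R)).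
      rewrite !mem_setE/= !in_itv/= -phi_lt ?(ltW p'0)// -phi_le ?(ltW q0)//.
      by rewrite /p' gt_max vu andbT.
    rewrite mem_setE; case: ifPn => [|_]; last by rewrite mul0r.
    rewrite in_itv/= => /andP[hpu hqu]; rewrite mul1r.
    by rewrite -h_ltE ?ltW// (lt_le_trans hpu hqu).
  rewrite E; have [p'q|qp'] := ltP p' q; last first.
    rewrite integral0_eq// adde0.
    move: qp'; rewrite /p' le_max => /orP[qp|qv].
      by rewrite !set_itv_ge// bnd_simp/= -leNgt// ge_min qp.
    by rewrite (min_idPl qv).
  have hpq : (h p' < h q)%R by exact: h_lt (ltW p'0) p'q.
  rewrite integral_itv_obnd_cbnd; last by apply/measurable_EFinP; apply: measurable_funTS; exact: mjac.
  rewrite int_jac// !phiK ?ltW//; last exact: lt_trans p'q.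
  move: p'q; rewrite /p' gt_max => /andP[pq vq].
  rewrite (min_idPr (ltW vq)) !lebesgue_measure_itv/= !lte_fin pq.
  have [pv|vp] := ltP p v0.
    by rewrite -!EFinB -EFinD; congr _%:E; ring.
  by rewrite add0e.
transitivity (\int[mu]_v (f v * (\1_(`]v0, +oo[) v)%:E)).
  rewrite integral_mkcond; apply: eq_integral => v _; rewrite patchE indicE.
  by case: ifP; rewrite ?mule1 ?mule0.
transitivity (\int[m]_v (f v * (\1_(`]v0, +oo[) v)%:E)).
  have mF : measurable_fun setT (fun v : R => f v * (\1_(`]v0, +oo[) v)%:E).
    by apply: emeasurable_funM => //; apply/measurable_EFinP; exact: measurable_indic.
  have F0 v : 0 <= f v * (\1_(`]v0, +oo[) v)%:E by rewrite mule_ge0// lee_fin.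
  rewrite (@eq_measure_integral _ _ _ _ (measure_add (mrestr mu mDC) m)); last first.
    by move=> A mA _; exact: mmu.
  rewrite ge0_integral_measure_add//.
  rewrite [X in X + _](_ : _ = 0) ?add0e//.
  have mI : measurable_fun setT (\1_(`]-oo, v0]) : measurableTypeR R -> R).
    exact: measurable_indic.
  rewrite (@ge0_integral_transfer _ _ (measurableTypeR R) (measurableTypeR R) R mu idfun
    (\1_(`]-oo, v0])) (@measurable_id _ _ _) mI _ (mrestr mu mDC))//.
    apply: integral0_eq => v _; rewrite !indicE !mem_setE/= !in_itv/= andbT.
    by have [vv|vv] := leP v v0; rewrite !(mule0, mul0e).
  move=> A mA; transitivity (mu (A `&` `]-oo, v0]%classic)); first by [].
  rewrite -integral_indic// integral_mkcond; apply: eq_integral => x _.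
  by rewrite patchE /= !indicE; case: (x \in `]-oo, v0]%classic); rewrite ?mulr1 ?mulr0.
rewrite (@ge0_integral_transfer _ _ (measurableTypeR R) (measurableTypeR R) R mu phi g mphi mg g0 m mE); last 2 first.
- by apply: emeasurable_funM => //; apply/measurable_EFinP; exact: measurable_indic.
- by move=> v; rewrite mule_ge0// lee_fin.
rewrite [RHS]integral_mkcond; apply: eq_integral => u _; rewrite patchE indicE.
rewrite !mem_setE /g !in_itv/= !andbT; have [u0|u0] := ltP 0%R u; last by rewrite mule0.
by rewrite phi_lt ?h_v0 ?u0 ?mule1 ?ltW//; have b0 := B0; lra.
Qed.

End sqrt_substitution.

Section gauss_affine.
Context (R : realType).
Local Notation mu := (@lebesgue_measure R).
Local Notation N01 := (normal_prob 0 1 : probability (measurableTypeR R) R).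
Local Open Scope ereal_scope.

Lemma ge0_integral_N01_affine (A kap : R) (G : R -> \bar R) : (0 < kap)%R ->
  measurable_fun setT G -> (forall y, 0 <= G y) ->
  \int[N01]_z G (A + z / kap)%R =
  \int[mu]_y ((kap * normal_pdf 0 1 (kap * (y - A)))%:E * G y).
Proof.
move=> k0 mG G0.
have mA : measurable_fun setT (fun z : R => (A + z / kap)%R).
  by apply: measurable_funD => //; apply: measurable_funM.
rewrite ge0_integral_N01; last 2 first.
- exact: (measurableT_comp mG mA).
- by move=> z; exact: G0.
have mP : measurable_fun setT (fun z : R => G (A + z / kap)%R * (normal_pdf 0 1 z)%:E).
  apply: emeasurable_funM; first exact: (measurableT_comp mG mA).
  by apply/measurable_EFinP; exact: measurable_normal_pdf.
have P0 (z : R) : 0 <= G (A + z / kap)%R * (normal_pdf 0 1 z)%:E.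
  by rewrite mule_ge0// lee_fin normal_pdf_ge0.
rewrite (ge0_integral_scale k0 mP P0).
have mk : measurable_fun setT (fun x : R => (kap * x)%R) by apply: measurable_funM.
rewrite (ge0_integral_shift (- A)); last 2 first.
- exact: (measurableT_comp mP mk).
- by move=> z; exact: P0.
have mka : measurable_fun setT (fun x : R => (kap * (x - A))%R).
  by apply: measurable_funM => //; apply: measurable_funD.
rewrite -ge0_integralZl//=; last 2 first.
- exact: (measurableT_comp mP mka).
- by rewrite lee_fin ltW.
apply: eq_integral => y _; rewrite EFinM -muleA; congr (_ * _).
rewrite muleC; congr (_ * G _).
by field; rewrite gt_eqF.
Qed.

(** The level k v^2/2 = B + u has two roots, each contributing the Jacobian 1 / sqrt(2 k (u + B));
    the hypothesis on [F] removes the levels u < 0. *)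
Lemma ge0_integral_quadratic (k B : R) (F : R -> \bar R) : (0 < k)%R -> (0 < B)%R ->
  measurable_fun setT F -> (forall v, 0 <= F v) ->
  (forall v, (k * v ^+ 2 / 2 < B)%R -> F v = 0) ->
  \int[mu]_v F v = \int[mu]_(u in `]0%R, +oo[)
    ((F (Num.sqrt (2 * (u + B) / k)) + F (- Num.sqrt (2 * (u + B) / k))%R) *
     ((Num.sqrt (2 * k * (u + B)))^-1)%:E).
Proof.
move=> k0 B0 mF F0 FB.
pose v0 := Num.sqrt (2 * B / k).
have v00 : (0 < v0)%R by rewrite sqrtr_gt0 divr_gt0// mulr_gt0.
have Fv0 v : (`|v| < v0)%R -> F v = 0.
  move=> vv; apply: FB.
  have : (`|v| ^+ 2 < v0 ^+ 2)%R by rewrite ltr_pXn2r// nnegrE// ltW.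
  rewrite real_normK ?num_real// sqr_sqrtr; last by rewrite divr_ge0// ?ltW// mulr_gt0.
  by rewrite ltr_pdivlMr// ltr_pdivrMr// mulrC [X in (_ < X)%R]mulrC.
have mN : measurable_fun setT (fun x : R => (- x)%R) by exact: measurable_funN.
have mFN : measurable_fun setT (fun v : R => F (- v)%R) by exact: (measurableT_comp mF mN).
have red (G : R -> \bar R) : measurable_fun setT G -> (forall v, 0 <= G v) -> (forall v : R, (`|v| < v0)%R -> G v = 0) ->
    \int[mu]_(v in `[0%R, +oo[) G v = \int[mu]_(v in `]v0, +oo[) G v.
  move=> mG G0 Gv0.
  rewrite integral_itv_obnd_cbnd; last exact: measurable_funTS.
  rewrite integral_mkcond [RHS]integral_mkcond; apply: eq_integral => v _.
  rewrite !patchE !mem_setE !in_itv/= !andbT.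
  have [vv|vv] := leP v0 v; first by rewrite (le_trans (ltW v00)).
  by case: ifPn => // v_ge0; rewrite Gv0// ger0_norm.
rewrite -(setUv `[0%R, +oo[%classic) ge0_integral_setU//=; last 3 first.
- exact: measurableC.
- by rewrite setUv.
- exact/disj_setPCl.
rewrite setCitvr.
have e1 : \int[mu]_(x in `]-oo, 0%R[) F x = \int[mu]_(v in `[0%R, +oo[) F (- v)%R.
  rewrite integral_itv_bndo_bndc; last exact: measurable_funTS.
  rewrite ge0_integration_by_substitution0//.
  by apply: eq_integral => v _; rewrite opprK.
rewrite e1 (red _ mF F0 Fv0) (red _ mFN)//; last by move=> v vv; rewrite Fv0// normrN.
rewrite -ge0_integralD//; last 2 first.
- exact: measurable_funTS.
- exact: measurable_funTS.
rewrite (ge0_integral_sqrt k0 B0)//.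
- exact: emeasurable_funD.
- by move=> x; rewrite adde_ge0.
Qed.

End gauss_affine.

(** * The density of the overshoot given the later innovations *)

Section first_coordinate.
Context (R : realType).
Local Notation mu := (@lebesgue_measure R).
Local Notation N01 := (normal_prob 0 1 : probability (measurableTypeR R) R).
Local Notation sample_path := (sample_path R).
Variables (s t : R).
Hypothesis st : 0 < t \/ (s = 0 /\ t = 0).
Implicit Types z : nat -> R.

Definition tail_mean z n : R := s / t + \sum_(1 <= i < n) z i / (i.+1%:R + t).
(* Completion of the square in the first innovation, see [log_lr_first]. *)
Definition tail_shift z n : R := (1 + t) * tail_mean z n / n.-1%:R.
Definition tail_const z n : R :=
  ((1 + t) * tail_mean z n ^+ 2 * (1 + (1 + t) / n.-1%:R) + t * (s / t) ^+ 2
   + \sum_(1 <= i < n) z i ^+ 2 / (i.+1%:R + t)) / 2.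

Lemma tail_const_ge0 z n : 0 <= tail_const z n.
Proof.
have t0 := t_ge0 st.
rewrite divr_ge0// !addr_ge0//.
- have h : 0 <= 1 + t by rewrite addr_ge0.
  by apply: mulr_ge0; [rewrite mulr_ge0 ?sqr_ge0|rewrite addr_ge0 ?divr_ge0].
- by rewrite mulr_ge0// sqr_ge0.
- by apply: sumr_ge0 => i _; rewrite divr_ge0 ?sqr_ge0// ltW// (tS_gt0 st).
Qed.

Lemma post_mean_first (z : sample_path) x n : (0 < n)%N ->
  post_mean s t (upd z 0 x) n = tail_mean z n + x / (1 + t).
Proof.
case: n => // n _; rewrite /post_mean /tail_mean -addrA; congr (_ + _).
rewrite big_ord_recl/= {1}/upd eqxx addrC; congr (_ + _).
rewrite big_add1 big_mkord; apply: eq_bigr => i _.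
by rewrite /upd.
Qed.

(** In terms of the mean y after n steps, the first innovation contributes -(1+t)(y -
    [tail_mean])^2/2. This lowers the coefficient n + t of y^2 to n - 1, whence 1 < n; the rest is
    completion of the square. *)
Lemma log_lr_first (z : sample_path) x n : (1 < n)%N ->
  log_lr s t (upd z 0 x) n = n.-1%:R * (tail_mean z n + x / (1 + t) + tail_shift z n) ^+ 2 / 2
    - tail_const z n.
Proof.
case: n => // n n1; rewrite (log_lr_quadratic st) post_mean_first//.
rewrite /tail_shift /tail_const big_ord_recl/= {1}/upd eqxx.
have -> : \sum_(i < n) upd z 0 x (bump 0 i) ^+ 2 / ((bump 0 i).+1%:R + t) / 2 =
    (\sum_(1 <= i < n.+1) z i ^+ 2 / (i.+1%:R + t)) / 2.
  by rewrite mulr_suml big_add1 big_mkord; apply: eq_bigr.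
set V := \sum_(1 <= i < n.+1) _; set A := tail_mean _ _; set a := s / t.
have n0 : n%:R != 0 :> R by rewrite pnatr_eq0 -lt0n.
have k0 : 1 + t != 0 by rewrite gt_eqF// (tS_gt0 st 0).
by rewrite -natr1; field; rewrite n0 k0.
Qed.

(** For [u] the overshoot at time n, the condition at [j] says that log Lambda was still below b at
    time n - j. *)
Definition incr_ok K D (y : R) (r : nat -> R) (u : R) : bool :=
  all (fun j => u < back_incr D y r j) (iota 1 K).

Lemma eq_back_incr D (y : R) r r' j : (forall l, (l < j)%N -> r l = r' l) ->
  back_incr D y r j = back_incr D y r' j.
Proof.
move=> rr; rewrite /back_incr; apply: eq_bigr => i _; rewrite rr//.
suff -> : back_mean D y r i = back_mean D y r' i by [].
by rewrite /back_mean; congr (_ - _); apply: eq_bigr => l _; rewrite rr// (leq_ltn_trans _ (ltn_ord i))// -ltnS.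
Qed.

Lemma measurable_back_incr d (T : measurableType d) D (Y : T -> R) (r : nat -> T -> R) j :
  measurable_fun setT Y -> (forall l, measurable_fun setT (r l)) ->
  measurable_fun setT (fun x => back_incr D (Y x) (r^~ x) j).
Proof.
move=> mY mr.
have mb i : measurable_fun setT (fun x => back_mean D (Y x) (r^~ x) i).
  apply: measurable_funB => //; apply: measurable_sum => l.
  by apply: measurable_funM.
apply: measurable_sum => i; apply: measurable_funD; first exact: measurable_funM.
by apply: measurable_funM => //; exact: measurable_funX.
Qed.

Lemma measurable_incr_ok d (T : measurableType d) K D (Y U : T -> R) (r : nat -> T -> R) :
  measurable_fun setT Y -> measurable_fun setT U -> (forall l, measurable_fun setT (r l)) ->
  measurable_fun setT (fun x => (incr_ok K D (Y x) (r^~ x) (U x))%:R : R).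
Proof.
move=> mY mU mr; rewrite /incr_ok.
rewrite (_ : (fun x => _) = (fun x => if all (fun j => U x < back_incr D (Y x) (r^~ x) j) (iota 1 K) then 1 else 0)); last first.
  by apply/funext => x; case: ifP.
apply: measurable_fun_ifT => //.
elim: (iota 1 K) => [|j l IH] /=; first exact: measurable_cst.
apply: measurable_and => //; apply: measurable_fun_ltr => //.
exact: measurable_back_incr.
Qed.

Lemma first_hit_incr_ok b z K n : first_hit b (log_lr s t z) n ->
  incr_ok (minn K n.-1) (fun l => (n - l)%:R + t) (post_mean s t z n)
    (fun l => z (n.-1 - l)%N) (log_lr s t z n - b).
Proof.
move=> /first_hitP[n0 bn h]; apply/allP => j; rewrite mem_iota => /andP[j0 jK].
have jn : (j < n)%N by move: jK; rewrite add1n ltnS leq_min => /andP[_]; case: n n0 {bn h}.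
rewrite -(log_lr_back st); last exact: ltnW.
rewrite ltrD2l ltrN2; apply: h; rewrite subn_gt0 jn/=.
by rewrite ltn_subrL j0 n0.
Qed.

(* The two values ([sg] = 1 or -1) of the predictive mean at which log Lambda_n equals
   [b + u]. *)
Definition branch (sg : R) z n b u : R :=
  sg * Num.sqrt (2 * (u + (b + tail_const z n)) / n.-1%:R) - tail_shift z n.

(* The density of the overshoot [u] at time [n] given all innovations but the first;
   the condition of no earlier crossing is kept for the last [K] steps only, which
   gives an upper bound. *)
Definition kern K z n b sg u : R :=
  (1 + t) * normal_pdf 0 1 ((1 + t) * (branch sg z n b u - tail_mean z n)) *
  (incr_ok (minn K n.-1) (fun l => (n - l)%:R + t) (branch sg z n b u) (fun l => z (n.-1 - l)%N) u)%:R.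

Lemma kern_ge0 K z n b sg u : 0 <= kern K z n b sg u.
Proof. by rewrite mulr_ge0// mulr_ge0 ?normal_pdf_ge0// addr_ge0// (t_ge0 st). Qed.

Lemma measurable_tail_mean n : measurable_fun setT (fun z : sample_path => tail_mean z n).
Proof.
apply: measurable_funD => //; apply: measurable_sum => i.
by apply: measurable_funM => //; exact: measurable_coord.
Qed.

Lemma measurable_tail_const n : measurable_fun setT (fun z : sample_path => tail_const z n).
Proof.
apply: measurable_funM => //; apply: measurable_funD.
  apply: measurable_funD => //; apply: measurable_funM => //; apply: measurable_funM => //.
  by apply: measurable_funX; exact: measurable_tail_mean.
apply: measurable_sum => i.
by apply: measurable_funM => //; apply: measurable_funX; exact: measurable_coord.
Qed.

Section measurable_kern.
Context d (T : measurableType d) (Z : T -> sample_path) (U : T -> R).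
Hypotheses (mZ : measurable_fun setT Z) (mU : measurable_fun setT U).

Lemma measurable_branch sg n b : measurable_fun setT (fun x => branch sg (Z x) n b (U x)).
Proof.
apply: measurable_funB; last first.
  apply: measurable_funM => //; apply: measurable_funM => //.
  exact: (measurableT_comp (measurable_tail_mean n) mZ).
apply: measurable_funM => //.
apply: measurableT_comp; first exact: measurable_sqrtr.
apply: measurable_funM => //; apply: measurable_funM => //; apply: measurable_funD => //.
by apply: measurable_funD => //; exact: (measurableT_comp (measurable_tail_const n) mZ).
Qed.

Lemma measurable_kern K sg n b : measurable_fun setT (fun x => kern K (Z x) n b sg (U x)).
Proof.
apply: measurable_funM; last first.
  apply: measurable_incr_ok => //; first exact: measurable_branch.
  by move=> l; exact: (measurableT_comp (@measurable_coord _ _) mZ).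
apply: measurable_funM => //; apply: measurableT_comp; first exact: measurable_normal_pdf.
apply: measurable_funM => //; apply: measurable_funB; first exact: measurable_branch.
exact: (measurableT_comp (measurable_tail_mean n) mZ).
Qed.

End measurable_kern.

Lemma eq_incr_ok K D (y : R) r r' u : (forall l, (l < K)%N -> r l = r' l) ->
  incr_ok K D y r u = incr_ok K D y r' u.
Proof.
move=> rr; apply: eq_in_all => j; rewrite mem_iota add1n => /andP[_ jK].
rewrite (@eq_back_incr _ _ _ r')// => l lj; apply: rr.
by rewrite (leq_trans lj)// -ltnS.
Qed.

(** As a function of the last mean the overshoot is the quadratic [q], so the substitution has two
    branches. The inequality comes from forgetting the earlier times and from the bound on the
    Jacobian. *)
Lemma first_coordinate_bound K (z : sample_path) n b (g : R -> R) : (1 < n)%N -> 0 < b ->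
  measurable_fun setT g -> (forall u, 0 <= g u) ->
  (\int[N01]_x ((first_hit b (log_lr s t (upd z 0 x)) n)%:R *
      g (log_lr s t (upd z 0 x) n - b))%:E <=
   ((Num.sqrt (2 * n.-1%:R * b))^-1)%:E *
   \int[mu]_(u in `]0%R, +oo[) ((kern K z n b 1 u + kern K z n b (-1) u) * g u)%:E)%E.
Proof.
move=> n1 b0 mg g0.
have k0 : 0 < 1 + t by exact: (tS_gt0 st 0).
have kn : 0 < n.-1%:R :> R by rewrite ltr0n; case: n n1 => [|[]].
set A := tail_mean z n; set d := tail_shift z n; set C := tail_const z n.
have C0 : 0 <= C by exact: tail_const_ge0.
pose q (y : R) := n.-1%:R * (y + d) ^+ 2 / 2 - C - b.
pose ok y u : R := (incr_ok (minn K n.-1) (fun l => (n - l)%:R + t) y (fun l => z (n.-1 - l)%N) u)%:R.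
(* The cut at 0 <= [q y] makes the integrand vanish where the level is not reached, as the quadratic
   substitution requires. *)
pose G (y : R) : R := if 0 <= q y then ok y (q y) * g (q y) else 0.
have mq : measurable_fun setT q.
  apply: measurable_funB => //; apply: measurable_funB => //; apply: measurable_funM => //.
  apply: measurable_funM => //; apply: measurable_funX; exact: measurable_funD.
have G0 y : 0 <= G y by rewrite /G; case: ifP => // _; rewrite mulr_ge0.
have mG : measurable_fun setT G.
  apply: measurable_fun_ifT => //; first exact: measurable_fun_ler.
  apply: measurable_funM; last exact: measurableT_comp.
  rewrite /ok; exact: (@measurable_incr_ok _ _ (minn K n.-1) (fun l => (n - l)%:R + t) (fun y => y) q (fun l _ => z (n.-1 - l)%N)).
have mEG : measurable_fun setT (fun y : R => (G y)%:E) by exact/measurable_EFinP.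
have EG0 y : (0 <= (G y)%:E)%E by rewrite lee_fin.
apply: (@le_trans _ _ (\int[N01]_x (G (A + x / (1 + t)))%:E)%E).
  have muz : measurable_fun setT (fun x : R => upd z 0 x : sample_path).
    apply: (@measurableT_comp _ _ _ _ _ _ (fun xz : sample_path * R => upd xz.1 0 xz.2) _ (fun x => (z, x))).
      exact: measurable_upd.
    exact: measurable_pair1.
  have ml : measurable_fun setT (fun x : R => log_lr s t (upd z 0 x) n).
    exact: (measurableT_comp (measurable_log_lr s t n) muz).
  apply: ge0_le_integral => //.
  - by move=> x _; rewrite lee_fin mulr_ge0.
  - apply/measurable_EFinP/measurable_funM.
      rewrite (_ : (fun x => _) = (\1_[set x : R | first_hit b (log_lr s t (upd z 0 x)) n])).
        apply: measurable_indic.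
        apply: (@measurable_first_hit _ b n _ _ (fun j (x : R) => log_lr s t (upd z 0 x) j)) => j.
        exact: (measurableT_comp (measurable_log_lr s t j) muz).
      apply/funext => x; rewrite indicE; congr (nat_of_bool _)%:R.
      by apply/idP/idP; rewrite inE.
    by apply: measurableT_comp => //; exact: measurable_funB.
  - by apply/measurable_EFinP; apply: (measurableT_comp mG); apply: measurable_funD => //; exact: measurable_funM.
  - move=> x _; rewrite lee_fin.
    case hit: (first_hit _ _ _); last by rewrite mul0r.
    have pm : post_mean s t (upd z 0 x) n = A + x / (1 + t) by rewrite post_mean_first// ltnW.
    have Lq : log_lr s t (upd z 0 x) n - b = q (A + x / (1 + t)).
      by rewrite log_lr_first// /q -addrA.
    have [_ bL _] := first_hitP hit.
    have := first_hit_incr_ok K hit; rewrite pm Lq => okh.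
    rewrite /G -Lq subr_ge0 bL /ok Lq -(@eq_incr_ok _ _ _ (fun l => upd z 0 x (n.-1 - l)%N)).
      by rewrite okh.
    (* For l < n - 1 the index n - 1 - l is positive, so the resampled first innovation is not
       read. *)
    move=> l; rewrite leq_min => /andP[_ ln]; rewrite /upd subn_eq0 leqNgt ln//.
rewrite (@ge0_integral_N01_affine _ A (1 + t) (fun y => (G y)%:E))//.
have mphi : measurable_fun setT (fun y : R => (1 + t) * normal_pdf 0 1 ((1 + t) * (y - A))).
  apply: measurable_funM => //; apply: measurableT_comp; first exact: measurable_normal_pdf.
  by apply: measurable_funM => //; exact: measurable_funB.
have phi0 (y : R) : 0 <= (1 + t) * normal_pdf 0 1 ((1 + t) * (y - A)).
  by rewrite mulr_ge0 ?normal_pdf_ge0// ltW.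
pose F (y : R) : \bar R := (((1 + t) * normal_pdf 0 1 ((1 + t) * (y - A))) * G y)%:E.
have mF : measurable_fun setT F by apply/measurable_EFinP; exact: measurable_funM.
have F0 y : (0 <= F y)%E by rewrite lee_fin mulr_ge0.
rewrite -[leLHS]/(\int[mu]_y F y)%E.
rewrite (ge0_integral_shift (- d) mF F0).
have B0 : 0 < b + C by rewrite ltr_wpDr.
have md : measurable_fun setT (fun y : R => y - d) by exact: measurable_funB.
have qd v : q (v - d) = n.-1%:R * v ^+ 2 / 2 - (b + C) by rewrite /q subrK; ring.
rewrite (@ge0_integral_quadratic _ n.-1%:R (b + C) (fun v => F (v - d)))//; last 2 first.
- exact: (measurableT_comp mF md).
- by move=> v vB; rewrite /F /G qd leNgt subr_lt0 vB/= mulr0.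
have Fb sg u : 0 < u -> sg ^+ 2 = 1 ->
    F (sg * Num.sqrt (2 * (u + (b + C)) / n.-1%:R) - d) = (kern K z n b sg u * g u)%:E.
  move=> u0 sg1.
  have qu : q (sg * Num.sqrt (2 * (u + (b + C)) / n.-1%:R) - d) = u.
    rewrite qd exprMn sg1 mul1r sqr_sqrtr; first by field; rewrite gt_eqF.
    by rewrite divr_ge0 ?ltW// mulr_gt0// addr_gt0.
  by rewrite /F /G qu ltW// /kern /branch /ok -/A -/d -/C; rewrite !mulrA.
have mk sg : measurable_fun setT (kern K z n b sg).
  exact: (@measurable_kern _ _ (fun _ : R => z : sample_path) (fun u => u)).
have mB : measurable_fun setT (fun u : R => u + (b + C)) by exact: measurable_funD.
have mr : measurable_fun setT (fun u : R => Num.sqrt (2 * (u + (b + C)) / n.-1%:R)).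
  apply: measurableT_comp; first exact: measurable_sqrtr.
  by apply: measurable_funM => //; exact: measurable_funM.
have mi : measurable_fun setT (fun u : R => (Num.sqrt (2 * n.-1%:R * (u + (b + C))))^-1).
  apply: measurableT_comp; first exact: measurable_inv.
  by apply: measurableT_comp; [exact: measurable_sqrtr|exact: measurable_funM].
rewrite -ge0_integralZl//; last 2 first.
- apply: measurable_funTS; apply/measurable_EFinP; apply: measurable_funM => //.
  by apply: measurable_funD; exact: mk.
- by move=> u _; rewrite lee_fin mulr_ge0// addr_ge0// kern_ge0.
apply: ge0_le_integral => //.
- by move=> u _; rewrite mule_ge0// ?adde_ge0// lee_fin invr_ge0 sqrtr_ge0.
- apply: measurable_funTS; apply: emeasurable_funM; last exact/measurable_EFinP.
  apply: emeasurable_funD; apply: (measurableT_comp mF); apply: measurable_funB => //.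
  exact: measurableT_comp.
- apply: measurable_funTS; apply/measurable_EFinP; apply: measurable_funM => //.
  by apply: measurable_funM => //; apply: measurable_funD; exact: mk.
move=> u; rewrite /= in_itv/= andbT => u0.
have := Fb 1 u u0; rewrite mul1r => ->; last by rewrite expr1n.
have := Fb (-1) u u0; rewrite mulN1r => ->; last by rewrite sqrrN expr1n.
rewrite -EFinD -EFinM lee_fin -mulrDl mulrC.
rewrite ler_wpM2r ?mulr_ge0 ?addr_ge0 ?kern_ge0//.
(* Since u and [C] are nonnegative, the Jacobian is at most its value for u + C = 0, which depends
   neither on the path nor on u. *)
have kb : 0 < 2 * n.-1%:R * b by rewrite !mulr_gt0.
have kub : 2 * n.-1%:R * b <= 2 * n.-1%:R * (u + (b + C)).
  by rewrite ler_wpM2l ?mulr_ge0// addrA addrAC lerDr addr_ge0// ltW.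
rewrite lef_pV2 ?posrE ?sqrtr_gt0 ?(lt_le_trans kb)//.
exact: ler_wsqrtr.
Qed.

End first_coordinate.

(** * Linear combinations of independent normal variables *)

Section gauss_sum.
Context (R : realType).
Local Notation mu := (@lebesgue_measure R).
Local Notation N01 := (normal_prob 0 1 : probability (measurableTypeR R) R).
Local Notation sample_path := (sample_path R).
Local Open Scope ereal_scope.

Lemma normal_pdf_affine_int (A kap : R) : (0 < kap)%R ->
  \int[mu]_y (kap * normal_pdf 0 1 (kap * (y - A)))%:E = 1.
Proof.
move=> k0.
have := @ge0_integral_N01_affine R A kap (cst 1) k0 (@measurable_cst _ _ _ _ _ _) (fun=> @lee01 R).
rewrite integral_prob_cst => ->.
by apply: eq_integral => y _; rewrite mule1.
Qed.

(** Completing the square in x leaves the normal density of variance al^2 + be^2 in [v], times a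
    normal density in x of total mass 1. *)
Lemma integral_N01_normal_pdf (al be v : R) : (0 < be)%R ->
  let sg := Num.sqrt (al ^+ 2 + be ^+ 2) in
  \int[N01]_x (be^-1 * normal_pdf 0 1 (be^-1 * (v - al * x)))%:E =
  (sg^-1 * normal_pdf 0 1 (sg^-1 * v))%:E.
Proof.
move=> b0 sg.
have s20 : (0 < al ^+ 2 + be ^+ 2)%R by rewrite ltr_wpDl ?sqr_ge0// exprn_gt0.
have sg0 : (0 < sg)%R by rewrite sqrtr_gt0.
have sg2 : (sg ^+ 2 = al ^+ 2 + be ^+ 2)%R by rewrite sqr_sqrtr// ltW.
have bi : (0 < be^-1)%R by rewrite invr_gt0.
have maff (c e : R) : measurable_fun setT (fun y : R => (c * (y - e))%R).
  by apply: measurable_funM => //; exact: measurable_funB.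
rewrite ge0_integral_N01; last 2 first.
- apply/measurable_EFinP; apply: measurable_funM => //.
  apply: (measurableT_comp (@measurable_normal_pdf R 0 1)).
  by apply: measurable_funM => //; apply: measurable_funB => //; exact: measurable_funM.
- by move=> x; rewrite lee_fin mulr_ge0 ?normal_pdf_ge0// ltW.
pose kap := (sg / be)%R.
have kap0 : (0 < kap)%R by rewrite divr_gt0.
transitivity (\int[mu]_x ((sg^-1 * normal_pdf 0 1 (sg^-1 * v))%:E *
    (kap * normal_pdf 0 1 (kap * (x - al * v / sg ^+ 2)))%:E)).
  apply: eq_integral => x _; rewrite -!EFinM; congr _%:E.
  rewrite !normal_pdf01E.
  transitivity (be^-1 * normal_peak 1 ^+ 2 * expR (- ((be^-1 * (v - al * x)) ^+ 2 / 2) - x ^+ 2 / 2))%R.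
    by rewrite expRD; ring.
  transitivity (be^-1 * normal_peak 1 ^+ 2 * expR (- ((sg^-1 * v) ^+ 2 / 2) -
     (kap * (x - al * v / sg ^+ 2)) ^+ 2 / 2))%R.
    congr (_ * expR _)%R.
    have al2 : (al ^+ 2 = sg ^+ 2 - be ^+ 2)%R by rewrite sg2; ring.
    have -> : ((be^-1 * (v - al * x)) ^+ 2 = (v ^+ 2 - 2 * al * x * v + al ^+ 2 * x ^+ 2) / be ^+ 2)%R.
      by field; rewrite gt_eqF.
    have -> : ((kap * (x - al * v / sg ^+ 2)) ^+ 2 =
      (sg ^+ 2 * x ^+ 2 - 2 * al * x * v + al ^+ 2 * v ^+ 2 / sg ^+ 2) / be ^+ 2)%R.
      by rewrite /kap; field; rewrite !gt_eqF.
    by rewrite al2; field; rewrite !gt_eqF.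
  by rewrite expRD /kap; field; rewrite !gt_eqF.
rewrite ge0_integralZl//.
- by rewrite normal_pdf_affine_int// mule1.
- apply/measurable_EFinP; apply: measurable_funM => //.
  exact: (measurableT_comp (@measurable_normal_pdf R 0 1) (maff _ _)).
- by move=> x _; rewrite lee_fin mulr_ge0 ?normal_pdf_ge0// ltW.
- by rewrite lee_fin mulr_ge0 ?normal_pdf_ge0// invr_ge0 ltW.
Qed.

Lemma integral_N01_convolution (al be : R) (F : R -> \bar R) : (0 < be)%R ->
  measurable_fun setT F -> (forall x, 0 <= F x) ->
  \int[N01]_x \int[N01]_z F (al * x + be * z)%R =
  \int[N01]_z F (Num.sqrt (al ^+ 2 + be ^+ 2) * z)%R.
Proof.
move=> b0 mF F0.
set sg := Num.sqrt _.
have s20 : (0 < al ^+ 2 + be ^+ 2)%R by rewrite ltr_wpDl ?sqr_ge0// exprn_gt0.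
have sg0 : (0 < sg)%R by rewrite sqrtr_gt0.
have sg2 : (sg ^+ 2 = al ^+ 2 + be ^+ 2)%R by rewrite sqr_sqrtr// ltW.
have bi : (0 < be^-1)%R by rewrite invr_gt0.
have maff (c e : R) : measurable_fun setT (fun y : R => (c * (y - e))%R).
  by apply: measurable_funM => //; exact: measurable_funB.
pose D (x v : R) : R := (be^-1 * normal_pdf 0 1 (be^-1 * (v - al * x)))%R.
have D0 x v : (0 <= D x v)%R by rewrite mulr_ge0 ?normal_pdf_ge0// ltW.
have mD2 : measurable_fun setT (fun p : R * R => (D p.1 p.2)%:E).
  apply/measurable_EFinP; apply: measurable_funM => //.
  apply: measurableT_comp; first exact: measurable_normal_pdf.
  apply: measurable_funM => //; apply: measurable_funB; first exact: measurable_snd.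
  by apply: measurable_funM => //; exact: measurable_fst.
transitivity (\int[N01]_x \int[mu]_v ((D x v)%:E * F v)).
  apply: eq_integral => x _.
  rewrite -(ge0_integral_N01_affine _ bi)//.
  by apply: eq_integral => z _; rewrite invrK mulrC [(z * be)%R]mulrC [(x * al)%R]mulrC.
rewrite (@fubini_tonelli _ _ _ _ _ N01 mu (fun p => (D p.1 p.2)%:E * F p.2))/=; last 2 first.
- apply: emeasurable_funM => //.
  by apply: (measurableT_comp mF); exact: measurable_snd.
- by move=> p; rewrite mule_ge0// lee_fin.
transitivity (\int[mu]_v ((sg^-1 * normal_pdf 0 1 (sg^-1 * (v - 0)))%:E * F v)); last first.
  rewrite -(ge0_integral_N01_affine _ _ mF)//; last by rewrite invr_gt0.
  by apply: eq_integral => z _; rewrite add0r invrK mulrC.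
apply: eq_integral => v _.
have mDv : measurable_fun setT (fun x : R => (D x v)%:E).
  have mp : measurable_fun setT (fun x : R => (x, v : R)) by exact: measurable_pair2.
  exact: (measurableT_comp mD2 mp).
have Dv0 x : 0 <= (D x v)%:E by rewrite lee_fin.
rewrite ge0_integralZr; last 4 first.
- exact: measurableT.
- exact: mDv.
- by move=> x _; exact: Dv0.
- exact: F0.
congr (_ * _).
by rewrite (integral_N01_normal_pdf _ _ b0) subr0.
Qed.

(** A negative [be] is made positive by the symmetry of N(0,1); for [be] = 0 the inner integrand is
    constant. *)
Lemma integral_N01_add (al be : R) (F : R -> \bar R) :
  measurable_fun setT F -> (forall x, 0 <= F x) ->
  \int[N01]_x \int[N01]_z F (al * x + be * z)%R =
  \int[N01]_z F (Num.sqrt (al ^+ 2 + be ^+ 2) * z)%R.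
Proof.
move=> mF F0.
have mM (c e : R) : measurable_fun setT (fun z : R => F (c + e * z)%R).
  by apply: (measurableT_comp mF); apply: measurable_funD => //; exact: measurable_funM.
have [b0|b0|->] := ltgtP be 0%R; last first.
- rewrite expr0n/= addr0 sqrtr_sqr.
  transitivity (\int[N01]_x F (al * x)%R).
    apply: eq_integral => x _.
    rewrite -[RHS](integral_prob_cst N01); apply: eq_integral => z _.
    by rewrite mul0r addr0.
  have [a0|a0] := ger0P al; first by [].
  rewrite (@N01_sym _ (fun x => F (al * x)%R))//; last exact: measurableT_comp.
  by apply: eq_integral => z _; rewrite mulrN mulNr.
- exact: integral_N01_convolution.
have nb0 : (0 < - be)%R by rewrite oppr_gt0.
rewrite -(sqrrN be) -(integral_N01_convolution al nb0 mF F0).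
apply: eq_integral => x _.
rewrite (@N01_sym _ (fun z => F (al * x + be * z)%R))//.
by apply: eq_integral => z _; rewrite mulrN mulNr.
Qed.

Variable LL : probability sample_path R.
Hypothesis iidLL : iid_map LL idfun.

Lemma integral_gauss_sum (al : nat -> R) n (F : R -> \bar R) :
  measurable_fun setT F -> (forall x, 0 <= F x) ->
  \int[LL]_z F (\sum_(i < n) al i * z i)%R =
  \int[N01]_x F (Num.sqrt (\sum_(i < n) al i ^+ 2) * x)%R.
Proof.
elim: n F => [|n IH] F mF F0.
  rewrite big_ord0 sqrtr0.
  transitivity (F 0%R); last first.
    by rewrite -[LHS](integral_prob_cst N01); apply: eq_integral => z _; rewrite mul0r.
  rewrite -[RHS](integral_prob_cst LL); apply: eq_integral => z _.
  by rewrite big_ord0.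
have ms m : measurable_fun setT (fun z : sample_path => (\sum_(i < m) al i * z i)%R).
  by apply: measurable_sum => i; apply: measurable_funM => //; exact: measurable_coord.
rewrite (integral_resample iidLL n); last 2 first.
- exact: (measurableT_comp mF).
- by [].
pose F' (y : R) := \int[N01]_x F (y + al n * x)%R.
have mF' : measurable_fun setT F'.
  have m2 : measurable_fun setT (fun p : R * R => F (p.1 + al n * p.2)%R).
    apply: (measurableT_comp mF); apply: measurable_funD; first exact: measurable_fst.
    by apply: measurable_funM => //; exact: measurable_snd.
  have := @measurable_fun_fubini_tonelli_F _ _ _ _ _ N01 (fun p : R * R => F (p.1 + al n * p.2)%R).
  by apply => // p.
have F'0 y : 0 <= F' y by apply: integral_ge0.
transitivity (\int[LL]_z F' (\sum_(i < n) al i * z i)%R).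
  apply: eq_integral => z _; apply: eq_integral => x _; congr F.
  rewrite big_ord_recr/= /upd eqxx; congr (_ + _)%R.
  by apply: eq_bigr => i _; rewrite ifF//; apply/negbTE; rewrite ltn_eqF.
rewrite (IH F' mF' F'0) /F' integral_N01_add//.
by rewrite sqr_sqrtr ?big_ord_recr// sumr_ge0// => i _; rewrite sqr_ge0.
Qed.

End gauss_sum.

Section restricted_tonelli.
Context (R : realType) d (T : measurableType d).
Local Notation mu := (@lebesgue_measure R).
Local Open Scope ereal_scope.
Variables (P : probability T R) (D : set R) (f : T -> R -> \bar R).
Hypotheses (mD : measurable D)
  (mf : measurable_fun setT (fun p : T * R => f p.1 p.2)) (f0 : forall x u, 0 <= f x u).

Let mfD : measurable_fun setT (fun p : T * R => f p.1 p.2 * (\1_D p.2)%:E).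
Proof.
apply: emeasurable_funM => //; apply/measurable_EFinP.
by apply: (measurableT_comp (measurable_indic _)) => //; exact: measurable_snd.
Qed.

Let fD0 (p : T * R) : 0 <= f p.1 p.2 * (\1_D p.2)%:E.
Proof. by rewrite mule_ge0// lee_fin. Qed.

Let intD x : \int[mu]_(u in D) f x u = \int[mu]_u (f x u * (\1_D u)%:E).
Proof. by rewrite integral_mkcond epatch_indic. Qed.

Lemma measurable_restricted_integral :
  measurable_fun setT (fun x => \int[mu]_(u in D) f x u).
Proof.
under eq_fun do rewrite intD.
exact: (@measurable_fun_fubini_tonelli_F _ _ _ _ _ mu (fun p : T * R => f p.1 p.2 * (\1_D p.2)%:E)).
Qed.

Lemma restricted_tonelli :
  \int[P]_x \int[mu]_(u in D) f x u = \int[mu]_(u in D) \int[P]_x f x u.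
Proof.
under eq_integral do rewrite intD.
rewrite (@fubini_tonelli _ _ _ _ _ P mu (fun p : T * R => f p.1 p.2 * (\1_D p.2)%:E)); last 2 first.
- exact: mfD.
- exact: fD0.
rewrite /= [RHS]integral_mkcond epatch_indic; apply: eq_integral => u _ /=.
rewrite ge0_integralZr//.
- have mp : measurable_fun setT (fun x : T => (x, u : R)) by exact: measurable_pair2.
  exact: (measurableT_comp mf mp).
Qed.

End restricted_tonelli.

Section hit_term_bound.
Context (R : realType).
Local Notation mu := (@lebesgue_measure R).
Local Notation N01 := (normal_prob 0 1 : probability (measurableTypeR R) R).
Local Notation sample_path := (sample_path R).
Variables (s t : R).
Hypothesis st : 0 < t \/ (s = 0 /\ t = 0).
Variable LL : probability sample_path R.
Hypothesis iidLL : iid_map LL idfun.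
Local Open Scope ereal_scope.

Definition mean_kern K n b sg u : \bar R := \int[LL]_z (kern s t K z n b sg u)%:E.

Lemma measurable_mean_kern K n b sg : measurable_fun setT (mean_kern K n b sg).
Proof.
have m2 : measurable_fun setT (fun p : R * sample_path => (kern s t K p.2 n b sg p.1)%:E).
  by apply/measurable_EFinP; apply: measurable_kern.
have := @measurable_fun_fubini_tonelli_F _ _ _ _ _ LL (fun p : R * sample_path => (kern s t K p.2 n b sg p.1)%:E).
by apply => // p; rewrite lee_fin (kern_ge0 st).
Qed.

Lemma mean_kern_ge0 K n b sg u : 0 <= mean_kern K n b sg u.
Proof. by apply: integral_ge0 => z _; rewrite lee_fin (kern_ge0 st). Qed.

(** The bound given all innovations but the first is averaged over them; Tonelli's theorem moves the
    average onto the kernel, at each overshoot separately. *)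
Lemma hit_term_bound K n b (g : R -> R) : (1 < n)%N -> (0 < b)%R ->
  measurable_fun setT g -> (forall u, (0 <= g u)%R) ->
  hit_term s t LL b g n <= ((Num.sqrt (2 * n.-1%:R * b))^-1)%:E *
    \int[mu]_(u in `]0%R, +oo[) ((mean_kern K n b 1 u + mean_kern K n b (-1) u) * (g u)%:E).
Proof.
move=> n1 b0 mg g0.
rewrite /hit_term.
have mh : measurable [set z : sample_path | first_hit b (log_lr s t z) n].
  apply: (@measurable_first_hit _ b n _ _ (fun j (z : sample_path) => log_lr s t z j)) => j.
  exact: measurable_log_lr.
have mF : measurable_fun setT (fun z : sample_path =>
   ((\1_[set z | first_hit b (log_lr s t z) n] z * g (log_lr s t z n - b))%R)%:E).
  apply/measurable_EFinP; apply: measurable_funM; first exact: measurable_indic.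
  by apply: measurableT_comp => //; apply: measurable_funB => //; exact: measurable_log_lr.
rewrite (integral_resample iidLL 0 mF); last by move=> z; rewrite lee_fin mulr_ge0.
have c0 : 0 <= ((Num.sqrt (2 * n.-1%:R * b))^-1)%:E by rewrite lee_fin invr_ge0.
pose k2 z u : R := ((kern s t K z n b 1 u + kern s t K z n b (-1) u) * g u)%R.
have k20 z u : (0 <= k2 z u)%R by rewrite mulr_ge0// addr_ge0// (kern_ge0 st).
have mk2 : measurable_fun setT (fun p : sample_path * R => (k2 p.1 p.2)%:E).
  apply/measurable_EFinP; apply: measurable_funM; last by apply: measurableT_comp.
  by apply: measurable_funD; apply: measurable_kern.
have mI : measurable_fun setT (fun z : sample_path => \int[mu]_(u in `]0%R, +oo[) (k2 z u)%:E).
  by apply: measurable_restricted_integral => // z u; rewrite lee_fin.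
have I0 (z : sample_path) : 0 <= \int[mu]_(u in `]0%R, +oo[) (k2 z u)%:E.
  by apply: integral_ge0 => u _; rewrite lee_fin.
have mresF : measurable_fun setT (fun z : sample_path => \int[N01]_x
   ((\1_[set z | first_hit b (log_lr s t z) n] (upd z 0 x) * g (log_lr s t (upd z 0 x) n - b))%R)%:E).
  have m2 := measurableT_comp mF (@measurable_upd R 0).
  apply: (@measurable_fun_fubini_tonelli_F _ _ _ _ _ N01 _ m2).
  by move=> p; rewrite lee_fin mulr_ge0.
apply: (@le_trans _ _ (\int[LL]_z (((Num.sqrt (2 * n.-1%:R * b))^-1)%:E * \int[mu]_(u in `]0%R, +oo[) (k2 z u)%:E))).
  apply: ge0_le_integral => //.
  - by move=> z _; apply: integral_ge0 => x _; rewrite lee_fin mulr_ge0.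
  - exact: measurable_funeM.
  - move=> z _.
    apply: le_trans (first_coordinate_bound st K z n1 b0 mg g0).
    rewrite le_eqVlt; apply/orP; left; apply/eqP; apply: eq_integral => x _.
    congr (_ * _)%:E; rewrite indicE; congr (nat_of_bool _)%:R.
    by apply/idP/idP; rewrite inE.
rewrite ge0_integralZl// lee_wpmul2l//.
rewrite (restricted_tonelli LL _ mk2)//.
rewrite le_eqVlt; apply/orP; left; apply/eqP; apply: eq_integral => u _.
have mk sg : measurable_fun setT (fun z : sample_path => (kern s t K z n b sg u)%:E).
  by apply/measurable_EFinP; apply: (@measurable_kern _ _ _ _ _ (fun z : sample_path => z) (fun=> u)).
have kk0 sg z : 0 <= (kern s t K z n b sg u)%:E by rewrite lee_fin (kern_ge0 st).
rewrite /mean_kern -ge0_integralD// -ge0_integralZr//; last 3 first.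
- exact: emeasurable_funD.
- by move=> z _; rewrite adde_ge0.
- by rewrite lee_fin.
Qed.

End hit_term_bound.

(** * Domination of the crossing density *)

Section domination.
Context (R : realType).
Local Notation mu := (@lebesgue_measure R).
Local Notation N01 := (normal_prob 0 1 : probability (measurableTypeR R) R).
Local Notation sample_path := (sample_path R).
Variables (s t : R).
Hypothesis st : 0 < t \/ (s = 0 /\ t = 0).
Variable LL : probability sample_path R.
Hypothesis iidLL : iid_map LL idfun.

Lemma expR_ge_sqr (x : R) : 0 <= x -> x ^+ 2 / 2 <= expR x.
Proof.
move=> x0; by have := expR_ge1Dxn 1 x0; rewrite (_ : 2`! = 2%N)// => h; apply: le_trans h; rewrite lerDr.
Qed.

Lemma normal_peak1_le1 : normal_peak (1 : R) <= 1.
Proof.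
have p0 : 0 < pi *+ 2 :> R by rewrite pmulrn_rgt0// pi_gt0.
rewrite /normal_peak expr1n mul1r invf_le1 ?sqrtr_gt0//.
rewrite -[leLHS]sqrtr1 ler_wsqrtr// mulr2n.
by have := @pi_ge2 R; lra.
Qed.

Lemma normal_pdf_le1 (x : R) : normal_pdf 0 1 x <= 1.
Proof. by rewrite (le_trans (normal_pdf_ub _ _ _)) ?oner_eq0// normal_peak1_le1. Qed.

(** From e^v >= v^2/2 at v = (kap w)^2/2. *)
Lemma pow4_normal_pdf_le (kap w : R) : 1 <= kap -> w ^+ 4 * normal_pdf 0 1 (kap * w) <= 8.
Proof.
move=> k1; rewrite normal_pdf01E mulrCA.
have h : w ^+ 4 * expR (- ((kap * w) ^+ 2 / 2)) <= 8.
  rewrite expRN ler_pdivrMr ?expR_gt0//.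
  have e0 : 0 <= (kap * w) ^+ 2 / 2 by rewrite divr_ge0// sqr_ge0.
  have := expR_ge_sqr e0.
  have : w ^+ 4 <= (kap * w) ^+ 4.
    by rewrite exprMn ler_peMl ?exprn_even_ge0// exprn_ege1.
  by move: (expR _) => e; rewrite (_ : ((kap * w) ^+ 2 / 2) ^+ 2 = (kap * w) ^+ 4 / 4); [lra|field].
rewrite -[8]mul1r ler_pM ?normal_peak_ge0 ?normal_peak1_le1//.
by rewrite mulr_ge0 ?exprn_even_ge0// expR_ge0.
Qed.

(** A crude bound for the value 3. Of the two factors e^{-x^2/4} in the density, one absorbs x^4 and
    the other is proportional to the N(0,2) density. *)
Lemma normal_fourth_moment : (\int[N01]_z (z ^+ 4)%:E <= 64%:E)%E.
Proof.
have m4 : measurable_fun setT (fun z : R => (z ^+ 4)%:E).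
  by apply/measurable_EFinP; exact: measurable_funX.
rewrite ge0_integral_N01//; last by move=> x; rewrite lee_fin exprn_even_ge0.
have k0 : (0 < (Num.sqrt 2)^-1 :> R)%R by rewrite invr_gt0 sqrtr_gt0.
have m1 : measurable_fun setT (fun y : R => ((Num.sqrt 2)^-1 * normal_pdf 0 1 ((Num.sqrt 2)^-1 * (y - 0)))%:E).
  apply/measurable_EFinP; apply: measurable_funM => //.
  apply: (measurableT_comp (@measurable_normal_pdf R 0 1)).
  by apply: measurable_funM => //; exact: measurable_funB.
apply: (@le_trans _ _ (\int[mu]_y (64%:E * ((Num.sqrt 2)^-1 * normal_pdf 0 1 ((Num.sqrt 2)^-1 * (y - 0)))%:E))%E); last first.
  rewrite ge0_integralZl//.
    by rewrite normal_pdf_affine_int// mule1.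
  by move=> y _; rewrite lee_fin mulr_ge0 ?normal_pdf_ge0// ltW.
apply: ge0_le_integral => //.
- by move=> x _; rewrite mule_ge0// lee_fin ?exprn_even_ge0 ?normal_pdf_ge0.
- by apply: emeasurable_funM => //; apply/measurable_EFinP; exact: measurable_normal_pdf.
- exact: measurable_funeM.
move=> x _; rewrite -!EFinM lee_fin !normal_pdf01E subr0.
have -> : ((Num.sqrt 2)^-1 * x) ^+ 2 / 2 = x ^+ 2 / 4 :> R.
  by rewrite exprMn exprVn sqr_sqrtr//; field.
have -> : x ^+ 2 / 2 = x ^+ 2 / 4 + x ^+ 2 / 4 by field.
rewrite opprD expRD.
have e0 : 0 <= x ^+ 2 / 4 by rewrite divr_ge0// sqr_ge0.
have h : x ^+ 4 * expR (- (x ^+ 2 / 4)) <= 32.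
  rewrite expRN ler_pdivrMr ?expR_gt0//; have := expR_ge_sqr e0.
  by move: (expR _) => e; rewrite (_ : (x ^+ 2 / 4) ^+ 2 = x ^+ 4 / 16); [lra|field].
have s2 : 32 <= 64 * (Num.sqrt 2)^-1 :> R.
  rewrite ler_pdivlMr ?sqrtr_gt0//.
  have : Num.sqrt 2 <= 2 :> R by rewrite -[leRHS](@ger0_norm R 2)// -sqrtr_sqr ler_wsqrtr//; lra.
  lra.
have p0 : 0 <= normal_peak (1 : R) * expR (- (x ^+ 2 / 4)) by rewrite mulr_ge0 ?normal_peak_ge0 ?expR_ge0.
have := ler_wpM2r p0 (le_trans h s2).
by rewrite !mulrA => h'; apply: le_trans h'; rewrite le_eqVlt; apply/orP; left; apply/eqP; ring.
Qed.

(** The weight of innovation [i] in [tail_mean]; it is 0 for the first one, so that sums can range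
    over all i < n. *)
Definition tail_coef (i : nat) : R := if i == 0%N then 0 else (i.+1%:R + t)^-1.

Lemma tail_mean_coef z n : tail_mean s t z n = s / t + \sum_(i < n) tail_coef i * z i.
Proof.
rewrite /tail_mean; congr (_ + _).
case: n => [|n]; first by rewrite big_ord0 big_geq.
rewrite big_add1 big_mkord big_ord_recl /tail_coef/= mul0r add0r.
by apply: eq_bigr => i _; rewrite mulrC.
Qed.

Lemma tail_coef_ge0 i : 0 <= tail_coef i.
Proof. by rewrite /tail_coef; case: ifP => // _; rewrite invr_ge0 ltW// (tS_gt0 st). Qed.

Lemma tail_coef_le i : tail_coef i <= i.+1%:R^-1.
Proof.
rewrite /tail_coef; case: ifP => // _.
by rewrite lef_pV2 ?posrE ?(tS_gt0 st)// lerDl (t_ge0 st).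
Qed.

Lemma sum_tail_coef2_le1 n : \sum_(i < n) tail_coef i ^+ 2 <= 1.
Proof.
suff h m : \sum_(i < m.+1) tail_coef i ^+ 2 <= 1 - m.+1%:R^-1.
  case: n => [|n]; first by rewrite big_ord0.
  by rewrite (le_trans (h n))// gerBl.
elim: m => [|m IH]; first by rewrite big_ord_recl big_ord0 /tail_coef/= expr0n/= invr1 subrr addr0.
rewrite big_ord_recr/=.
have c2 : tail_coef m.+1 ^+ 2 <= (m.+2%:R * m.+1%:R)^-1.
  apply: (@le_trans _ _ (m.+2%:R^-1 ^+ 2)).
    by rewrite lerXn2r ?nnegrE ?tail_coef_ge0// tail_coef_le.
  by rewrite expr2 -invfM lef_pV2 ?posrE ?mulr_gt0// ler_pM2l// ler_nat.
have -> : 1 - m.+2%:R^-1 = 1 - m.+1%:R^-1 + (m.+2%:R * m.+1%:R)^-1 :> R.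
  have m0 : m.+1%:R != 0 :> R by rewrite pnatr_eq0.
  have m10 : m.+1%:R + 1 != 0 :> R by rewrite natr1 pnatr_eq0.
  by rewrite -(natr1 m.+1); move: m0 m10; move: (m.+1%:R : R) => x x0 x1; field; rewrite x0 x1.
exact: lerD.
Qed.

(** The majorant for dominated convergence, uniform in [K], [n] and [b]. Already the condition j = 1
    bounds u by a quadratic form in the last mean y and the last innovation. The deviation w of y
    from [tail_mean] has its fourth power absorbed by the Gaussian factor, so u^2 times the kernel
    is controlled by fourth moments. *)
Lemma mean_kern_le : exists2 C : R, 0 <= C & forall K n b sg u,
  (0 < K)%N -> (1 < n)%N -> 0 < u ->
  (mean_kern s t LL K n b sg u <= (C * (1 + u ^+ 2)^-1)%:E)%E.
Proof.
pose kap := 1 + t; pose a := s / t.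
have kap1 : 1 <= kap by rewrite /kap lerDl (t_ge0 st).
have kap0 : 0 < kap by lra.
(* 513 = 1 + 64 * 8 collects f <= 1 and 64 w^4 f <= 64 * 8; it also exceeds the other coefficients
   256 and 36. *)
have [Q Q0 Q513] : exists2 Q : R, 0 <= Q & 513 <= Q by exists 513; lra.
have [M M0 M4] : exists2 M : R, 0 <= M & (\int[N01]_z (z ^+ 4)%:E <= M%:E)%E.
  by exists 64; [lra|exact: normal_fourth_moment].
have a4 : 0 <= a ^+ 4 by rewrite exprn_even_ge0.
exists (kap * (Q + Q * a ^+ 4 + Q * M + Q * M)).
  by rewrite mulr_ge0 ?(ltW kap0)// !addr_ge0// mulr_ge0.
move=> K n b sg u K0 n1 u0.
have u2 : 0 < 1 + u ^+ 2 by rewrite ltr_pwDl// sqr_ge0.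
pose S (z : sample_path) := \sum_(i < n) tail_coef i * z i.
have mS : measurable_fun setT S.
  by apply: measurable_sum => i; apply: measurable_funM => //; exact: measurable_coord.
have mS4 : measurable_fun setT (fun z : sample_path => (S z ^+ 4)%:E).
  by apply/measurable_EFinP; exact: measurable_funX.
have mz4 : measurable_fun setT (fun z : sample_path => (z n.-1 ^+ 4)%:E).
  by apply/measurable_EFinP; apply: measurable_funX; exact: measurable_coord.
have mx4 : measurable_fun setT (fun z : R => (z ^+ 4)%:E).
  by apply/measurable_EFinP; exact: measurable_funX.
have x40 (x : R) : (0 <= (x ^+ 4)%:E)%E by rewrite lee_fin exprn_even_ge0.
have ES4 : (\int[LL]_z (S z ^+ 4)%:E <= M%:E)%E.
  rewrite /S (@integral_gauss_sum _ LL iidLL tail_coef n (fun x : R => (x ^+ 4)%:E))//.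
  apply: le_trans M4; apply: ge0_le_integral => //.
    apply/measurable_EFinP; apply: measurable_funX; exact: measurable_funM.
  move=> x _; rewrite lee_fin exprMn ler_piMl ?exprn_even_ge0//.
  rewrite exprn_ile1// -[leRHS]sqrtr1 ler_wsqrtr//; exact: sum_tail_coef2_le1.
have Ez4 : (\int[LL]_z (z n.-1 ^+ 4)%:E <= M%:E)%E.
  by rewrite (@integral_coord _ LL iidLL n.-1 (fun x : R => (x ^+ 4)%:E)).
pose H (z : sample_path) := (kap / (1 + u ^+ 2)) * (Q + Q * a ^+ 4 + Q * S z ^+ 4 + Q * z n.-1 ^+ 4).
have QH z : 0 <= Q + Q * a ^+ 4 + Q * S z ^+ 4 + Q * z n.-1 ^+ 4.
  by rewrite !addr_ge0// mulr_ge0// exprn_even_ge0.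
have kH z : kern s t K z n b sg u <= H z.
  rewrite /H /kern; case ok: (incr_ok _ _ _ _ _); last first.
    by rewrite mulr0 mulr_ge0// divr_ge0 ?(ltW kap0) ?(ltW u2).
  rewrite mulr1 -/kap -mulrA ler_pM2l// ler_pdivlMl//.
  move: ok; set y := branch _ _ _ _ _ _ _ => /allP /(_ 1%N).
  rewrite mem_iota leqnn/= add1n ltnS leq_min K0 ltn_predRL n1 => /(_ isT).
  rewrite /back_incr big_ord_recl big_ord0 addr0/= /back_mean big_ord_recl big_ord0 addr0/= !subn0.
  rewrite tail_mean_coef -/(S z) -/a.
  set r := z n.-1; set w := y - (a + S z) => hu.
  have D1 : 1 <= n%:R + t by rewrite -[leLHS]addr0 lerD ?(t_ge0 st)// ler1n ltnW.
  have q2 : (r / (n%:R + t)) ^+ 2 <= r ^+ 2.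
    by rewrite exprMn ler_piMr ?sqr_ge0// exprVn invf_le1 ?exprn_gt0 ?exprn_ege1//; lra.
  have f1 := normal_pdf_le1 (kap * w); have f8 := pow4_normal_pdf_le w kap1.
  have f0 := @normal_pdf_ge0 R 0 1 (kap * w).
  have yE : y = a + S z + w by rewrite /w; ring.
  move: hu q2 f1 f8 f0; rewrite yE; move: (r / _) (normal_pdf _ _ _) => q f hu q2 f1 f8 f0.
  have u_le : u <= 8 * a ^+ 2 + 8 * S z ^+ 2 + 4 * w ^+ 2 + 3 * r ^+ 2.
    have := sqr_ge0 (a + S z + w - q - r); have := sqr_ge0 (a + S z + w + q).
    by have := sqr_ge0 (a + S z - w); have := sqr_ge0 (a - S z); move: hu q2; clear; nra.
  have u2_le : u ^+ 2 <= 256 * a ^+ 4 + 256 * S z ^+ 4 + 64 * w ^+ 4 + 36 * r ^+ 4.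
    have sq4 x : x ^+ 4 = (x ^+ 2) ^+ 2 :> R by rewrite -exprM.
    rewrite !sq4; move: u_le; have := sqr_ge0 a; have := sqr_ge0 (S z); have := sqr_ge0 w; have := sqr_ge0 r.
    move: (a ^+ 2) (S z ^+ 2) (w ^+ 2) (r ^+ 2) => x1 x2 x3 x4 p4 p3 p2 p1 ule.
    apply: (@le_trans _ _ ((8 * x1 + 8 * x2 + 4 * x3 + 3 * x4) ^+ 2)).
      by rewrite lerXn2r ?nnegrE ?(ltW u0)// (le_trans (ltW u0)).
    have := sqr_ge0 (8 * x1 - 8 * x2); have := sqr_ge0 (8 * x1 - 4 * x3).
    have := sqr_ge0 (8 * x1 - 3 * x4); have := sqr_ge0 (8 * x2 - 4 * x3).
    have := sqr_ge0 (8 * x2 - 3 * x4); have := sqr_ge0 (4 * x3 - 3 * x4).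
    by clear; nra.
  have S4 : 0 <= S z ^+ 4 by rewrite exprn_even_ge0.
  have r4 : 0 <= r ^+ 4 by rewrite exprn_even_ge0.
  apply: (@le_trans _ _ (f + 256 * a ^+ 4 + 256 * S z ^+ 4 + 64 * (w ^+ 4 * f) + 36 * r ^+ 4)).
    have := ler_wpM2r f0 u2_le.
    have := ler_wpM2l a4 f1; have := ler_wpM2l S4 f1; have := ler_wpM2l r4 f1.
    by move: (a ^+ 4) (S z ^+ 4) (r ^+ 4) (w ^+ 4) (u ^+ 2) => *; lra.
  have := ler_wpM2r a4 Q513; have := ler_wpM2r S4 Q513; have := ler_wpM2r r4 Q513.
  by move: f1 f8 Q513 a4 S4 r4; move: (w ^+ 4 * f) (a ^+ 4) (S z ^+ 4) (r ^+ 4) => *; lra.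
have mk : measurable_fun setT (fun z : sample_path => (kern s t K z n b sg u)%:E).
  by apply/measurable_EFinP; apply: (@measurable_kern _ _ _ _ _ (fun z : sample_path => z) (fun=> u)).
have mz : measurable_fun setT (fun z : sample_path => z n.-1 ^+ 4).
  by apply: measurable_funX; exact: measurable_coord.
have mSr : measurable_fun setT (fun z : sample_path => S z ^+ 4) by exact: measurable_funX.
have mH : measurable_fun setT (fun z : sample_path => (H z)%:E).
  apply/measurable_EFinP; apply: measurable_funM => //; apply: measurable_funD; last exact: measurable_funM.
  by apply: measurable_funD => //; exact: measurable_funM.
apply: (@le_trans _ _ (\int[LL]_z (H z)%:E)%E).
  apply: ge0_le_integral => //.
  - by move=> z _; rewrite lee_fin (kern_ge0 st).
  - by move=> z _; rewrite lee_fin kH.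
under eq_integral do rewrite /H EFinM.
have kap2 : 0 <= kap / (1 + u ^+ 2) by rewrite divr_ge0 ?(ltW kap0) ?(ltW u2).
have mS4' : measurable_fun setT (fun z : sample_path => (Q%:E * (S z ^+ 4)%:E)%E).
  exact: measurable_funeM.
have mz4' : measurable_fun setT (fun z : sample_path => (Q%:E * (z n.-1 ^+ 4)%:E)%E).
  exact: measurable_funeM.
have S0' z : (0 <= Q%:E * (S z ^+ 4)%:E)%E by rewrite mule_ge0.
have z0' z : (0 <= Q%:E * (z n.-1 ^+ 4)%:E)%E by rewrite mule_ge0.
pose c := Q + Q * a ^+ 4.
have c0 : 0 <= c by rewrite addr_ge0// mulr_ge0.
have mcS : measurable_fun setT (fun z : sample_path => (c%:E + Q%:E * (S z ^+ 4)%:E)%E).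
  exact: emeasurable_funD.
rewrite ge0_integralZl//; last 2 first.
- apply/measurable_EFinP; apply: measurable_funD; last exact: measurable_funM.
  by apply: measurable_funD => //; exact: measurable_funM.
- by move=> z _; rewrite lee_fin.
have e : (\int[LL]_z (Q + Q * a ^+ 4 + Q * S z ^+ 4 + Q * z n.-1 ^+ 4)%:E <= (Q + Q * a ^+ 4 + Q * M + Q * M)%:E)%E.
  under eq_integral do rewrite EFinD EFinD (EFinM Q (S _ ^+ 4)) (EFinM Q (_ n.-1 ^+ 4)).
  rewrite ge0_integralD//; last by move=> z _; rewrite adde_ge0.
  rewrite ge0_integralD// (ge0_integralZl _ _ mS4)// (ge0_integralZl _ _ mz4)//.
  rewrite (integral_prob_cst LL c%:E) !EFinD.
  by apply: leeD; [apply: leeD => //|]; rewrite EFinM lee_wpmul2l.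
apply: (@le_trans _ _ ((kap / (1 + u ^+ 2))%:E * (Q + Q * a ^+ 4 + Q * M + Q * M)%:E)%E).
  by rewrite lee_wpmul2l.
by rewrite -EFinM mulrAC.
Qed.

End domination.

(** * Limit of the crossing density *)

Section recent_split.
Context (R : realType).
Local Notation sample_path := (sample_path R).

(* The last [K] innovations before time [n] are read, backwards, from a second path,
   so that the reversed walk lives on a space which does not depend on [n]. *)
Definition recent_split (K n i : nat) : nat + nat :=
  if (n - K <= i < n)%N then inr (n.-1 - i)%N else inl i.

Lemma recent_split_inj K n : injective (recent_split K n).
Proof.
move=> i j; rewrite /recent_split; case: ifPn => hi; case: ifPn => hj // [].
  by move=> h; move: hi hj => /andP[_ hi] /andP[_ hj]; lia.
by [].
Qed.

Lemma mix_recent K n (x w : sample_path) l : (K <= n)%N -> (l < K)%N ->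
  mix (recent_split K n) (x, w) (n.-1 - l)%N = w l.
Proof.
move=> Kn lK; rewrite /mix /recent_split ifT; last by lia.
by congr (w _); lia.
Qed.

Lemma sum_mix_recent K n (x w : sample_path) (f : nat -> R -> R) : (K <= n)%N ->
  \sum_(i < n) f i (mix (recent_split K n) (x, w) i) =
  \sum_(i < n - K) f i (x i) + \sum_(l < K) f (n.-1 - l)%N (w l).
Proof.
move=> Kn; set z := mix _ _.
rewrite -(big_mkord xpredT (fun i => f i (z i))) (@big_cat_nat _ _ _ (n - K)%N)//=; last exact: leq_subr.
congr (_ + _).
  rewrite big_mkord; apply: eq_bigr => i _; congr (f _ _).
  by rewrite /z /mix /recent_split ifF// leqNgt ltn_ord.
rewrite -[X in \sum_(X <= _ < _) _](add0n (n - K)%N) big_addn subKn// big_nat_rev big_mkord/=.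
apply: eq_bigr => l _; have lK := ltn_ord l.
rewrite (_ : (0 + K - l.+1 + (n - K) = n.-1 - l)%N); last by lia.
by rewrite /z mix_recent.
Qed.

End recent_split.

(** * Null sequences and summable weights *)

Section null_sequences.
Context (R : realType).

Lemma near0_le (f g : nat -> R) : (\forall n \near \oo, `|f n| <= g n) ->
  g n @[n --> \oo] --> 0 -> f n @[n --> \oo] --> 0.
Proof.
move=> fg g0; apply: norm_cvg0.
apply: (@squeeze_cvgr _ _ _ _ (fun=> 0) g) => //; last exact: cvg_cst.
by near=> n; rewrite normr_ge0/=; near: n.
Unshelve. all: by end_near.
Qed.

Lemma cvg_inv_sqrt : (Num.sqrt n%:R)^-1 @[n --> \oo] --> (0 : R).
Proof.
have h := @cvg_harmonic R.
have : (fun n => Num.sqrt (harmonic n) : R) @ \oo --> Num.sqrt (0 : R).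
  by apply: (continuous_cvg _ _ h); exact: sqrt_continuous.
rewrite sqrtr0 => {}h; rewrite -cvg_shiftS.
apply: cvg_trans h; apply: near_eq_cvg; apply: nearW => n.
by rewrite /= sqrtrV.
Qed.

Lemma sqrt_over_pred_cvg : Num.sqrt n%:R / n.-1%:R @[n --> \oo] --> (0 : R).
Proof.
apply: (@near0_le _ (fun n => 2 * (Num.sqrt n%:R)^-1)); last first.
  by rewrite -(mulr0 2); apply: cvgMr; exact: cvg_inv_sqrt.
near=> n.
have n2 : (2 <= n)%N by near: n; exact: nbhs_infty_ge.
have k0 : 0 < n.-1%:R :> R by rewrite ltr0n ltn_predRL.
have q0 : 0 < Num.sqrt n%:R :> R by rewrite sqrtr_gt0 ltr0n ltnW.
rewrite ger0_norm ?divr_ge0// ler_pdivrMr// mulrAC ler_pdivlMr// -expr2 sqr_sqrtr//.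
by rewrite -natrM ler_nat; lia.
Unshelve. all: by end_near.
Qed.

Lemma cvgn_sub_inv l : ((n - l)%:R : R)^-1 @[n --> \oo] --> 0.
Proof.
rewrite -(cvg_shiftn l.+1); have h := @cvg_harmonic R.
apply: cvg_trans h; apply: near_eq_cvg; apply: nearW => n /=.
by rewrite (_ : (n + l.+1 - l = n.+1)%N)//; lia.
Qed.

Lemma cvg_sum_ord m (f : nat -> nat -> R) (l : nat -> R) :
  (forall i, (i < m)%N -> f i n @[n --> \oo] --> l i) ->
  \sum_(i < m) f i n @[n --> \oo] --> \sum_(i < m) l i.
Proof.
elim: m => [|m IH] fl.
  under eq_fun do rewrite big_ord0.
  by rewrite big_ord0; exact: cvg_cst.
under eq_fun do rewrite big_ord_recr/=.
rewrite big_ord_recr/=; apply: cvgD; last exact: fl.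
by apply: IH => i im; apply: fl; rewrite ltnW.
Qed.

(** The weight (i+1)^{-3/2} is summable, so almost surely sum_i z_i^2 (i+1)^{-3/2} is finite. This
    single property of a path yields all the growth bounds below. *)
Definition sum_weight (i : nat) : R := (i.+1%:R * Num.sqrt i.+1%:R)^-1.

Lemma sum_inv_sqrt_le n : \sum_(i < n) (Num.sqrt i.+1%:R)^-1 <= 2 * Num.sqrt n%:R :> R.
Proof.
elim: n => [|n IH]; first by rewrite big_ord0 sqrtr0 mulr0.
rewrite big_ord_recr/=; apply: (le_trans (lerD IH (lexx _))).
set x := Num.sqrt n%:R; set y := Num.sqrt n.+1%:R.
have x0 : 0 <= x by exact: sqrtr_ge0.
have y0 : 0 < y by rewrite sqrtr_gt0.
have xy : y ^+ 2 = x ^+ 2 + 1 by rewrite !sqr_sqrtr// natr1.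
rewrite -(ler_pM2r y0) mulrDl mulVf ?gt_eqF//.
by have := sqr_ge0 (x - y); nra.
Qed.

Lemma sum_weight_le n : \sum_(i < n) sum_weight i <= 3.
Proof.
suff h m : \sum_(i < m.+1) sum_weight i <= 3 - 2 / Num.sqrt m.+1%:R.
  case: n => [|n]; first by rewrite big_ord0.
  by rewrite (le_trans (h n))// gerBl divr_ge0.
elim: m => [|m IH].
  by rewrite big_ord_recl big_ord0 /sum_weight/= sqrtr1 mulr1 invr1; lra.
rewrite big_ord_recr/=; apply: (le_trans (lerD IH (lexx _))).
rewrite /sum_weight -{1}(@sqr_sqrtr R m.+2%:R)//.
set x := Num.sqrt m.+1%:R; set y := Num.sqrt m.+2%:R.
have x0 : 0 < x by rewrite sqrtr_gt0.
have y0 : 0 < y by rewrite sqrtr_gt0.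
have xy : y ^+ 2 = x ^+ 2 + 1 by rewrite !sqr_sqrtr// natr1.
rewrite -addrA lerD2l -(ler_pM2r (_ : 0 < x * y ^+ 3)); last by rewrite mulr_gt0 ?exprn_gt0.
have -> : (- (2 / x) + (y ^+ 2 * y)^-1) * (x * y ^+ 3) = x - 2 * y ^+ 3.
  by field; rewrite !gt_eqF.
have -> : - (2 / y) * (x * y ^+ 3) = - 2 * x * y ^+ 2 by field; rewrite gt_eqF.
by have := sqr_ge0 (x - y); nra.
Qed.

End null_sequences.

(** * Growth bounds along a fixed path *)

Section deterministic_limit.
Context (R : realType).
Local Notation sample_path := (sample_path R).
Variables (s t : R).
Hypothesis st : 0 < t \/ (s = 0 /\ t = 0).
Variables (x w : sample_path) (B : R).
Hypothesis xB : forall n, \sum_(i < n) x i ^+ 2 * sum_weight R i <= B.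

Let B0 : 0 <= B.
Proof. by have := xB 0; rewrite big_ord0. Qed.

Lemma sum_sqr_over_le n : \sum_(i < n) x i ^+ 2 * i.+1%:R^-1 <= Num.sqrt n%:R * B.
Proof.
apply: (@le_trans _ _ (Num.sqrt n%:R * \sum_(i < n) x i ^+ 2 * sum_weight R i)); last first.
  by rewrite ler_wpM2l// xB.
rewrite mulr_sumr; apply: ler_sum => i _.
rewrite mulrCA ler_wpM2l ?sqr_ge0// /sum_weight invfM mulrCA ler_peMr// ?invr_ge0//.
by rewrite ler_pdivlMr ?sqrtr_gt0// mul1r ler_wsqrtr// ler_nat.
Qed.

(** Weighted arithmetic-geometric inequality: with r = sqrt(i+1) and q = n^{1/4}, |x_i|/r^2 <= (q/2)
    x_i^2/r^3 + 1/(2 q r), and the sum of 1/r is at most 2 q^2. *)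
Lemma sum_abs_over_le n : \sum_(i < n) `|x i| * i.+1%:R^-1 <=
  Num.sqrt (Num.sqrt n%:R) * (B / 2 + 1).
Proof.
case: n => [|n]; first by rewrite big_ord0 !sqrtr0 mul0r.
set q := Num.sqrt _.
have q0 : 0 < q by rewrite !sqrtr_gt0.
have q2 : q ^+ 2 = Num.sqrt n.+1%:R by rewrite sqr_sqrtr.
apply: (@le_trans _ _ (\sum_(i < n.+1) (q / 2 * (x i ^+ 2 * sum_weight R i) + (2 * q)^-1 * (Num.sqrt i.+1%:R)^-1))).
  apply: ler_sum => i _; rewrite /sum_weight -(real_normK (num_real (x i))).
  rewrite -{1 2}(@sqr_sqrtr R i.+1%:R)//; set r := Num.sqrt _.
  have r0 : 0 < r by rewrite sqrtr_gt0.
  rewrite -(ler_pM2r (_ : 0 < 2 * q * r ^+ 3)); last by rewrite !mulr_gt0// exprn_gt0.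
  have -> : `|x i| * (r ^+ 2)^-1 * (2 * q * r ^+ 3) = 2 * (q * `|x i|) * r by field; rewrite gt_eqF.
  have -> : (q / 2 * (`|x i| ^+ 2 * (r ^+ 2 * r)^-1) + (2 * q)^-1 * r^-1) * (2 * q * r ^+ 3) =
    (q * `|x i|) ^+ 2 + r ^+ 2 by field; rewrite !gt_eqF.
  by have := sqr_ge0 (q * `|x i| - r); nra.
rewrite big_split/= -!mulr_sumr.
have h1 := ler_wpM2l (ltW (divr_gt0 q0 (ltr0Sn R 1))) (xB n.+1).
have q20 : 0 <= (2 * q)^-1 by rewrite invr_ge0 mulr_ge0// ltW.
have := ler_wpM2l q20 (sum_inv_sqrt_le R n.+1); rewrite -q2.
have -> : (2 * q)^-1 * (2 * q ^+ 2) = q by field; rewrite gt_eqF.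
by move: h1 => /= h1 h2; apply: (le_trans (lerD h1 h2)); lra.
Qed.

Variable K : nat.
Local Notation mixn n := (mix (recent_split K n) (x, w)).
(** Taken at m = n - K, the part of [tail_mean] that does not involve the last [K] innovations. *)
Definition old_mean (x : nat -> R) m : R := s / t + \sum_(i < m) tail_coef t i * x i.

Lemma tail_mean_mix n : (K <= n)%N -> tail_mean s t (mixn n) n =
  old_mean x (n - K) + \sum_(l < K) tail_coef t (n.-1 - l)%N * w l.
Proof.
move=> Kn; rewrite tail_mean_coef (sum_mix_recent x w (fun i u => tail_coef t i * u))//.
by rewrite /old_mean addrA.
Qed.

Definition abs_bound : R := `|s / t| + \sum_(l < K) `|w l| + (B / 2 + 1).

Lemma abs_tail_mean_mix n : (K <= n)%N -> (0 < n)%N ->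
  `|tail_mean s t (mixn n) n| <= abs_bound * Num.sqrt (Num.sqrt n%:R).
Proof.
move=> Kn n0; rewrite tail_mean_mix//.
set q := Num.sqrt _.
have q1 : 1 <= q by rewrite -[leLHS]sqrtr1 ler_wsqrtr// -[leLHS]sqrtr1 ler_wsqrtr// ler1n.
rewrite /abs_bound mulrDl mulrDl -addrA.
have h i u : `|tail_coef t i * u| <= `|u| * i.+1%:R^-1.
  by rewrite normrM [leLHS]mulrC (ger0_norm (tail_coef_ge0 st i)) ler_wpM2l ?(tail_coef_le st).
rewrite /old_mean -addrA; apply: (le_trans (ler_normD _ _)); apply: lerD.
  by rewrite ler_peMr.
rewrite [leRHS]addrC; apply: (le_trans (ler_normD _ _)); apply: lerD.
  apply: (le_trans (ler_norm_sum _ _ _)).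
  apply: (@le_trans _ _ (\sum_(i < n - K) `|x i| * i.+1%:R^-1)); first exact: ler_sum.
  apply: (le_trans (sum_abs_over_le _)); rewrite mulrC ler_wpM2l//.
    by rewrite addr_ge0// divr_ge0.
  by rewrite !ler_wsqrtr// ler_nat leq_subr.
apply: (le_trans (ler_norm_sum _ _ _)).
apply: (@le_trans _ _ (\sum_(l < K) `|w l|)); last by rewrite ler_peMr// sumr_ge0.
apply: ler_sum => l _; apply: (le_trans (h _ _)).
by rewrite ler_piMr// invf_le1// ler1n.
Qed.

Lemma sum_sqr_mix n : (K <= n)%N -> (0 < n)%N ->
  \sum_(1 <= i < n) mixn n i ^+ 2 / (i.+1%:R + t) <=
  (B + \sum_(l < K) w l ^+ 2) * Num.sqrt n%:R.
Proof.
move=> Kn n0.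
have r1 : 1 <= Num.sqrt n%:R :> R by rewrite -[leLHS]sqrtr1 ler_wsqrtr// ler1n.
apply: (@le_trans _ _ (\sum_(i < n) mixn n i ^+ 2 * i.+1%:R^-1)).
  case: n n0 Kn r1 => // n _ _ _.
  rewrite big_add1 big_mkord big_ord_recl/= -[leLHS]add0r.
  apply: lerD; first by rewrite mulr_ge0 ?sqr_ge0.
  apply: ler_sum => i _; rewrite ler_wpM2l ?sqr_ge0//.
  by rewrite lef_pV2 ?posrE ?(tS_gt0 st)// lerDl (t_ge0 st).
rewrite (sum_mix_recent x w (fun i u => u ^+ 2 * i.+1%:R^-1))// mulrDl; apply: lerD.
  apply: (le_trans (sum_sqr_over_le _)); rewrite mulrC ler_wpM2l//.
  by rewrite ler_wsqrtr// ler_nat leq_subr.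
apply: (@le_trans _ _ (\sum_(l < K) w l ^+ 2)); last by rewrite ler_peMr// sumr_ge0// => i _; exact: sqr_ge0.
by apply: ler_sum => l _; rewrite ler_piMr ?sqr_ge0// invf_le1// ler1n.
Qed.

(** [tail_mean] grows at most like n^{1/4} and is divided by n - 1; the cruder rate sqrt n is the
    one shared with [tail_const_cvg], where the mean is squared. *)
Lemma tail_shift_cvg : tail_shift s t (mixn n) n @[n --> \oo] --> 0.
Proof.
have ab0 : 0 <= abs_bound by rewrite !addr_ge0// ?sumr_ge0// divr_ge0.
apply: (@near0_le _ _ (fun n => ((1 + t) * abs_bound) * (Num.sqrt n%:R / n.-1%:R))); last first.
  by rewrite -(mulr0 ((1 + t) * abs_bound)); apply: cvgMr; exact: sqrt_over_pred_cvg.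
near=> n.
have Kn : (K <= n)%N by near: n; exact: nbhs_infty_ge.
have n0 : (0 < n)%N by near: n; exact: nbhs_infty_ge.
have t1 : 0 <= 1 + t by rewrite ltW// (tS_gt0 st 0).
rewrite /tail_shift normrM normfV (@ger0_norm _ n.-1%:R)// mulrA ler_wpM2r ?invr_ge0//.
rewrite normrM ger0_norm// -mulrA ler_wpM2l//.
apply: (le_trans (abs_tail_mean_mix Kn n0)); rewrite ler_wpM2l//.
have r1 : 1 <= Num.sqrt n%:R :> R by rewrite -[leLHS]sqrtr1 ler_wsqrtr// ler1n.
rewrite -[leRHS]ger0_norm// -sqrtr_sqr ler_wsqrtr// expr2 ler_peMr//.
Unshelve. all: by end_near.
Qed.

Lemma tail_const_cvg : tail_const s t (mixn n) n / n.-1%:R @[n --> \oo] --> 0.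
Proof.
pose c := ((1 + t) * abs_bound ^+ 2 * (1 + (1 + t)) + t * (s / t) ^+ 2 + (B + \sum_(l < K) w l ^+ 2)) / 2.
apply: (@near0_le _ _ (fun n => c * (Num.sqrt n%:R / n.-1%:R))); last first.
  by rewrite -(mulr0 c); apply: cvgMr; exact: sqrt_over_pred_cvg.
near=> n.
have Kn : (K <= n)%N by near: n; exact: nbhs_infty_ge.
have n2 : (1 < n)%N by near: n; exact: nbhs_infty_ge.
have n0 : (0 < n)%N by exact: ltnW.
have t1 : 0 <= 1 + t by rewrite ltW// (tS_gt0 st 0).
have k1 : 1 <= n.-1%:R :> R by rewrite ler1n ltn_predRL.
rewrite ger0_norm; last by rewrite divr_ge0// (tail_const_ge0 st).
rewrite mulrA ler_wpM2r ?invr_ge0// /tail_const /c [leRHS]mulrAC ler_wpM2r//.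
have r1 : 1 <= Num.sqrt n%:R :> R by rewrite -[leLHS]sqrtr1 ler_wsqrtr// ler1n.
rewrite [leRHS]mulrDl; apply: lerD; last exact: sum_sqr_mix.
rewrite [leRHS]mulrDl; apply: lerD; last first.
  by rewrite ler_peMr// mulr_ge0 ?sqr_ge0 ?(t_ge0 st).
have m2 : tail_mean s t (mixn n) n ^+ 2 <= abs_bound ^+ 2 * Num.sqrt n%:R.
  rewrite -(real_normK (num_real (tail_mean _ _ _ _))).
  apply: (@le_trans _ _ ((abs_bound * Num.sqrt (Num.sqrt n%:R)) ^+ 2)).
    by rewrite lerXn2r ?nnegrE// ?(le_trans (normr_ge0 _) (abs_tail_mean_mix Kn n0))// abs_tail_mean_mix.
  by rewrite exprMn sqr_sqrtr.
apply: (@le_trans _ _ ((1 + t) * (abs_bound ^+ 2 * Num.sqrt n%:R) * (1 + (1 + t)))); last first.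
  by rewrite le_eqVlt; apply/orP; left; apply/eqP; ring.
apply: ler_pM.
- by rewrite mulr_ge0// sqr_ge0.
- by rewrite addr_ge0// divr_ge0.
- exact: ler_wpM2l.
by rewrite lerD2l ler_piMr// invf_le1// (lt_le_trans ltr01).
Unshelve. all: by end_near.
Qed.

End deterministic_limit.

(** * Pathwise limit of the kernel *)

Section kern_limit.
Context (R : realType).
Local Notation sample_path := (sample_path R).
Variables (s t : R).
Hypothesis st : 0 < t \/ (s = 0 /\ t = 0).

Definition walk (y : R) (w : nat -> R) i : R := \sum_(l < i) (y * w l + y ^+ 2 / 2).

Definition walk_above K y w u : bool := all (fun i => u < walk y w i) (iota 1 K).

(** By evenness let 0 <= x and y = x + h. The difference is (1 - e^{-(h x + h^2/2)}) times the
    density f at x; for h <= 2 use 1 - e^{-v} <= v, x f <= 1 and f <= 1, for h > 2 the trivial bound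
    1. *)
Lemma normal_pdf_lipschitz (x y : R) :
  `|normal_pdf 0 1 x - normal_pdf 0 1 y| <= 2 * `|x - y|.
Proof.
wlog xy : x y / `|x| <= `|y|.
  move=> h; have [xy|/ltW xy] := leP `|x| `|y|; first exact: h.
  by rewrite distrC (distrC x); exact: h.
have nE z : normal_pdf 0 1 z = normal_pdf 0 1 `|z| :> R.
  by rewrite !normal_pdf01E real_normK// num_real.
rewrite nE (nE y).
apply: (@le_trans _ _ (2 * (`|y| - `|x|))); last first.
  by rewrite ler_pM2l// distrC lerB_dist.
move: xy (normr_ge0 x); move: `|x| `|y| => {nE x y} x y xy x0.
pose h := y - x.
have h0 : 0 <= h by rewrite subr_ge0.
have -> : y = x + h by rewrite /h; ring.
rewrite normal_pdf_shift -{1}(mul1r (normal_pdf 0 1 x)) -mulrBl.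
have e1 : expR (- (h * x + h ^+ 2 / 2)) <= 1.
  by rewrite -expR0 ler_expR oppr_le0 addr_ge0 ?mulr_ge0// divr_ge0// sqr_ge0.
have f0 := @normal_pdf_ge0 R 0 1 x.
rewrite ger0_norm; last by rewrite mulr_ge0// subr_ge0.
have f1 := normal_pdf_le1 x.
have xf : x * normal_pdf 0 1 x <= 1.
  rewrite normal_pdf01E mulrCA mulr_ile1 ?normal_peak_ge0 ?normal_peak1_le1 ?mulr_ge0 ?expR_ge0//.
  rewrite expRN ler_pdivrMr ?expR_gt0// mul1r.
  have := expR_ge1Dx (x ^+ 2 / 2); have := sqr_ge0 (x - 1).
  by move: (expR _) => e; nra.
have e2 := expR_ge1Dx (- (h * x + h ^+ 2 / 2)).
have e0 := expR_ge0 (- (h * x + h ^+ 2 / 2)).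
have -> : x + h - x = h by ring.
have [h2|h2] := leP (h / 2) 1; last first.
  by move: e0 f1 f0; move: (expR _) (normal_pdf _ _ _) => e f; nra.
by move: e2 e1 f1 f0 xf; move: (expR _) (normal_pdf _ _ _) => e f e2 e1 f1 f0 xf; nra.
Qed.

Variables (x w : sample_path) (B : R).
Hypothesis xB : forall n, \sum_(i < n) x i ^+ 2 * sum_weight R i <= B.
Variables (K : nat) (n_ : nat -> nat) (b_ : nat -> R) (y sg u : R).
Hypotheses (n_y : n_ j @[j --> \oo] --> \oo) (y0 : 0 < y)
  (by_ : 2 * b_ j / (n_ j).-1%:R @[j --> \oo] --> y ^+ 2)
  (u_walk : forall i, (0 < i)%N -> walk (sg * y) w i != u).
Local Notation z_ j := (mix (recent_split K (n_ j)) (x, w)).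

Let n_ge m : \forall j \near \oo, (m <= n_ j)%N.
Proof. by move/cvgnyPge : n_y; exact. Qed.

Lemma branch_mix_cvg : branch s t sg (z_ j) (n_ j) (b_ j) u @[j --> \oo] --> sg * y.
Proof.
have h1 := cvg_comp _ _ n_y (tail_shift_cvg st w xB K).
have h2 := cvg_comp _ _ n_y (tail_const_cvg st w xB K).
rewrite -[sg * y]subr0; apply: cvgB; last exact: h1.
apply: cvgMr.
rewrite -{1}(ger0_norm (ltW y0)) -sqrtr_sqr.
apply: continuous_cvg; first exact: sqrt_continuous.
have u0 : 2 * u / (n_ j).-1%:R @[j --> \oo] --> 0.
  rewrite -(mulr0 (2 * u)); apply: cvgMr.
  apply: cvg_trans (cvg_comp _ _ n_y (@cvgn_sub_inv R 1)); apply: near_eq_cvg; apply: nearW => j /=.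
  by rewrite subn1.
have -> : y ^+ 2 = 0 + (y ^+ 2 + 2 * 0) by rewrite mulr0 addr0 add0r.
have h3 : 2 * u / (n_ j).-1%:R + (2 * b_ j / (n_ j).-1%:R + 2 * (tail_const s t (z_ j) (n_ j) / (n_ j).-1%:R))
   @[j --> \oo] --> 0 + (y ^+ 2 + 2 * 0).
  by apply: cvgD => //; apply: cvgD => //; apply: cvgMr.
apply: cvg_trans h3; apply: near_eq_cvg; apply: nearW => j /=.
by ring.
Qed.

Lemma tail_mean_mix_cvg : tail_mean s t (z_ j) (n_ j) - old_mean s t x (n_ j - K) @[j --> \oo] --> 0.
Proof.
have h : \sum_(l < K) tail_coef t (n.-1 - l)%N * w l @[n --> \oo] --> \sum_(l < K) (0 : R).
  apply: (@cvg_sum_ord _ K (fun l n => tail_coef t (n.-1 - l)%N * w l) (fun=> 0)) => l lK.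
  rewrite -(mul0r (w l)); apply: cvgMl.
  apply: (@near0_le _ _ (fun n => ((n - l)%:R)^-1)); last exact: cvgn_sub_inv.
  near=> n.
  have n0 : (l < n)%N by near: n; exact: nbhs_infty_gt.
  rewrite ger0_norm ?(tail_coef_ge0 st)//; apply: (le_trans (tail_coef_le st _)).
  by rewrite (_ : (n.-1 - l).+1 = n - l)%N//; lia.
rewrite big1_eq in h.
apply: cvg_trans (cvg_comp _ _ n_y h); apply: near_eq_cvg; near=> j.
have Kn : (K <= n_ j)%N by near: j; exact: n_ge.
by rewrite (tail_mean_mix s t)// addrC addKr.
Unshelve. all: by end_near.
Qed.

Local Notation D j := (fun l => (n_ j - l)%:R + t).
Local Notation r j := (fun l => z_ j ((n_ j).-1 - l)%N).
Local Notation br j := (branch s t sg (z_ j) (n_ j) (b_ j) u).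

Lemma back_mean_cvg i : (i < K)%N -> back_mean (D j) (br j) (r j) i @[j --> \oo] --> sg * y.
Proof.
move=> iK; rewrite -[sg * y]subr0; apply: cvgB; first exact: branch_mix_cvg.
suff h : \sum_(l < i.+1) (r j l / D j l) @[j --> \oo] --> \sum_(l < i.+1) (0 : R) by rewrite big1_eq in h.
apply: (@cvg_sum_ord _ i.+1 (fun l j => r j l / D j l) (fun=> 0)) => l li.
have h : w l / ((n - l)%:R + t) @[n --> \oo] --> w l * 0.
  apply: cvgMr; apply: (@near0_le _ _ (fun n => ((n - l)%:R)^-1)); last exact: cvgn_sub_inv.
  near=> n.
  have n0 : (l < n)%N by near: n; exact: nbhs_infty_gt.
  have nl0 : 0 < (n - l)%:R :> R by rewrite ltr0n subn_gt0.
  have nlt : 0 < (n - l)%:R + t by rewrite ltr_wpDr// (t_ge0 st).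
  by rewrite ger0_norm ?invr_ge0 ?(ltW nlt)// lef_pV2 ?posrE// lerDl (t_ge0 st).
rewrite mulr0 in h.
apply: cvg_trans (cvg_comp _ _ n_y h); apply: near_eq_cvg; near=> j.
have Kn : (K <= n_ j)%N by near: j; exact: n_ge.
by rewrite /= mix_recent//; exact: leq_trans li iK.
Unshelve. all: by end_near.
Qed.

Lemma back_incr_cvg i : (i <= K)%N -> back_incr (D j) (br j) (r j) i @[j --> \oo] --> walk (sg * y) w i.
Proof.
move=> iK.
apply: (@cvg_sum_ord _ i (fun l j => back_mean (D j) (br j) (r j) l * r j l + back_mean (D j) (br j) (r j) l ^+ 2 / 2)
  (fun l => sg * y * w l + (sg * y) ^+ 2 / 2)) => l li.
have lK := leq_trans li iK.
have h := back_mean_cvg lK.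
apply: cvgD; last by apply: cvgMl; exact: cvgM.
apply: cvgM => //.
apply: cvg_near_cst; near=> j.
have Kn : (K <= n_ j)%N by near: j; exact: n_ge.
by rewrite mix_recent.
Unshelve. all: by end_near.
Qed.

Lemma near_all_seq (I : eqType) (l : seq I) (P Q : I -> nat -> bool) :
  (forall i, i \in l -> \forall j \near \oo, P i j = Q i j) ->
  \forall j \near \oo, all (P^~ j) l = all (Q^~ j) l.
Proof.
elim: l => [|i l IH] h; first by apply: nearW.
have h1 := h i (mem_head _ _).
have h2 : \forall j \near \oo, all (P^~ j) l = all (Q^~ j) l.
  by apply: IH => k kl; apply: h; rewrite inE kl orbT.
near=> j => /=; congr (_ && _); near: j; [exact: h1|exact: h2].
Unshelve. all: by end_near.
Qed.

(** [u_walk] excludes ties, so each of the finitely many strict inequalities of the limiting walk is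
    eventually decided in the same way by the reversed increments. *)
Lemma incr_ok_cvg : \forall j \near \oo,
  incr_ok (minn K (n_ j).-1) (D j) (br j) (r j) u = walk_above K (sg * y) w u.
Proof.
have h : \forall j \near \oo, incr_ok K (D j) (br j) (r j) u = walk_above K (sg * y) w u.
  apply: (@near_all_seq _ (iota 1 K) (fun i j => u < back_incr (D j) (br j) (r j) i) (fun i _ => u < walk (sg * y) w i)) => i.
  rewrite mem_iota add1n ltnS => /andP[i0 iK].
  have c := back_incr_cvg iK.
  have [lt|gt|ueq] := ltgtP u (walk (sg * y) w i).
  - have h : \forall j \near \oo, u < back_incr (D j) (br j) (r j) i by exact: (cvgr_gt _ c).
    by near=> j; apply/idP; near: j.
  - have h : \forall j \near \oo, back_incr (D j) (br j) (r j) i < u by exact: (cvgr_lt _ c).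
    by near=> j; apply/negbTE; rewrite -leNgt ltW//; near: j.
  - by have := u_walk i0; rewrite ueq eqxx.
near=> j.
have Kn : (K < n_ j)%N by near: j; exact: n_ge.
rewrite (minn_idPl _); last by lia.
near: j; exact: h.
Unshelve. all: by end_near.
Qed.

(** The comparison term still moves with j through [old_mean]; the older innovations are integrated
    out exactly afterwards. *)
Lemma kern_mix_cvg : kern s t K (z_ j) (n_ j) (b_ j) sg u -
  (1 + t) * normal_pdf 0 1 ((1 + t) * (sg * y - old_mean s t x (n_ j - K))) *
  (walk_above K (sg * y) w u)%:R @[j --> \oo] --> 0.
Proof.
have t1 : 0 <= 1 + t by rewrite ltW// (tS_gt0 st 0).
apply: (@near0_le _ _ (fun j => (1 + t) * (2 * ((1 + t) *
  (`|branch s t sg (z_ j) (n_ j) (b_ j) u - sg * y| +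
   `|tail_mean s t (z_ j) (n_ j) - old_mean s t x (n_ j - K)|))))); last first.
  rewrite -(mulr0 (1 + t)); apply: cvgMr; rewrite -(mulr0 2); apply: cvgMr.
  rewrite -(mulr0 (1 + t)); apply: cvgMr; rewrite -(addr0 0); apply: cvgD.
    rewrite -(normr0 R) -(subrr (sg * y)); apply: cvg_norm; apply: cvgB; last exact: cvg_cst.
    exact: branch_mix_cvg.
  by rewrite -(normr0 R); apply: cvg_norm; exact: tail_mean_mix_cvg.
near=> j.
have -> : kern s t K (z_ j) (n_ j) (b_ j) sg u =
  (1 + t) * normal_pdf 0 1 ((1 + t) * (branch s t sg (z_ j) (n_ j) (b_ j) u - tail_mean s t (z_ j) (n_ j))) *
  (walk_above K (sg * y) w u)%:R.
  rewrite /kern; congr (_ * (nat_of_bool _)%:R); near: j; exact: incr_ok_cvg.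
rewrite -mulrBl -mulrBr normrM normrM (ger0_norm t1) -mulrA ler_wpM2l//.
apply: (@le_trans _ _ (`|normal_pdf 0 1 ((1 + t) * (branch s t sg (z_ j) (n_ j) (b_ j) u - tail_mean s t (z_ j) (n_ j))) -
  normal_pdf 0 1 ((1 + t) * (sg * y - old_mean s t x (n_ j - K)))|)).
  by rewrite ler_piMr// normr_nat lern1 leq_b1.
apply: (le_trans (normal_pdf_lipschitz _ _)); rewrite ler_pM2l//.
rewrite -mulrBr normrM (ger0_norm t1) ler_wpM2l//.
rewrite opprB addrACA [- _ + _]addrC -(opprB (tail_mean _ _ _ _)).
by apply: le_trans (ler_normB _ _); rewrite le_eqVlt; apply/orP; left; apply/eqP; congr `|_|; ring.
Unshelve. all: by end_near.
Qed.

End kern_limit.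

(** * Asymptotics of Spitzer's recursion *)

Section exp_recursion.
Context (R : realType).
Variable p : nat -> R.
Hypothesis p0 : forall k, 0 <= p k.

(** The sequence [e] below has generating function exp(-2 sum_k p_k x^k / k). The polynomial [Q N]
    truncates the inner series, which keeps all manipulations finite. *)
Let q k := if k is k'.+1 then p k / k%:R else 0.
Let Q N : {poly R} := \poly_(k < N.+1) q k.

Let q_ge0 k : 0 <= q k. Proof. by case: k => //= k; rewrite divr_ge0. Qed.

Let coefQ_ge0 N k : 0 <= (Q N)`_k.
Proof. by rewrite coef_poly; case: ifP. Qed.

Let coefQX_ge0 N i k : 0 <= (Q N ^+ i)`_k.
Proof.
elim: i k => [|i IH] k; first by rewrite expr0 coef1 ler0n.
by rewrite exprS coefM; apply: sumr_ge0 => j _; rewrite mulr_ge0.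
Qed.

Let coefQX_lt N i k : (k < i)%N -> (Q N ^+ i)`_k = 0.
Proof.
elim: i k => // i IH k ki.
rewrite exprS coefM; apply: big1 => -[[|j] /= jk] _.
  by rewrite coef_poly/= mul0r.
by rewrite IH ?mulr0//; lia.
Qed.

Let coefQX_le N M i k : (M <= N)%N -> (Q M ^+ i)`_k <= (Q N ^+ i)`_k.
Proof.
move=> MN; elim: i k => [|i IH] k; first by rewrite !expr0.
rewrite !exprS !coefM; apply: ler_sum => j _; apply: ler_pM => //.
rewrite !coef_poly; case: ifPn => [jM|_]; last by case: ifP.
by rewrite (leq_trans jM).
Qed.

Let coefQX_deriv N i n : (n.+1)%:R * (Q N ^+ i.+1)`_n.+1 =
  i.+1%:R * \sum_(k < n.+1) (k.+1%:R * (Q N)`_k.+1) * (Q N ^+ i)`_(n - k).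
Proof.
have h := coef_deriv (Q N ^+ i.+1) n.
rewrite deriv_exp coefMn coefM in h.
rewrite [LHS]mulr_natl -h [RHS]mulr_natl; congr (_ *+ _).
by apply: eq_bigr => k _; rewrite coef_deriv mulr_natl.
Qed.

Variable e : nat -> R.
Hypothesis e0 : e 0%N = 1.
Hypothesis eS : forall n, n.+1%:R * e n.+1 = - 2 * \sum_(k < n.+1) p k.+1 * e (n - k)%N.

(** The recursion is the differential equation E' = -2 (sum_k p_k x^{k-1}) E read on coefficients.
    Since [Q N] has no constant term, powers above n contain no term of degree n and the exponential
    series can be cut. *)
Let eE N n : (n <= N)%N ->
  e n = \sum_(i < N.+1) (-2) ^+ i / i`!%:R * (Q N ^+ i)`_n.
Proof.
elim/ltn_ind: n => -[|n] IH nN.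
  rewrite big_ord_recl/= expr0 coef1 eqxx fact0 divr1 !mulr1 e0 big1 ?addr0//.
  by move=> i _; rewrite coefQX_lt ?mulr0.
have n0 : n.+1%:R != 0 :> R by rewrite pnatr_eq0.
apply: (mulfI n0); rewrite eS.
transitivity (- 2 * \sum_(k < n.+1) p k.+1 * (\sum_(i < N.+1) (-2) ^+ i / i`!%:R * (Q N ^+ i)`_(n - k))).
  congr (_ * _); apply: eq_bigr => k _; rewrite IH//; last by rewrite (leq_trans (leq_subr _ _))// ltnW.
  by rewrite ltnS leq_subr.
rewrite [in RHS]big_ord_recl/= coef1/= mulr0 add0r.
transitivity (\sum_(k < n.+1) \sum_(i < N.+1)
    - 2 * p k.+1 * ((-2) ^+ i / i`!%:R * (Q N ^+ i)`_(n - k))).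
  by rewrite mulr_sumr; apply: eq_bigr => k _; rewrite mulrA mulr_sumr.
rewrite exchange_big/= big_ord_recr/= [X in _ + X]big1 ?addr0; last first.
  move=> k _; rewrite coefQX_lt ?mulr0//.
  by rewrite (leq_ltn_trans (leq_subr _ _)).
rewrite [RHS]mulr_sumr; apply: eq_bigr => i _; rewrite /bump leq0n add1n.
rewrite [RHS]mulrCA.
rewrite coefQX_deriv [RHS]mulrA [RHS]mulr_sumr; apply: eq_bigr => k _.
have -> : k.+1%:R * (Q N)`_k.+1 = p k.+1.
  rewrite coef_poly ltnS (leq_trans (ltn_ord k))//.
  by rewrite /q mulrCA mulfV ?mulr1// pnatr_eq0.
rewrite factS natrM exprS [RHS]mulrA.
have i0 : i`!%:R != 0 :> R by rewrite pnatr_eq0 -lt0n fact_gt0.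
have i1 : i.+1%:R != 0 :> R by rewrite pnatr_eq0.
rewrite [LHS]mulrA; congr (_ * _).
move: (i`!%:R : R) i0 (i.+1%:R : R) i1 ((-2) ^+ i : R) (p k.+1) => F F0 I I0 M K.
by field; rewrite F0 I0.
Qed.

Let T N i := \sum_(n < N.+1) (Q N ^+ i)`_n.

Let sumE N : \sum_(n < N.+1) e n = \sum_(i < N.+1) (-2) ^+ i / i`!%:R * T N i.
Proof.
under eq_bigr => n _ do rewrite (@eE N)// -1?ltnS//.
rewrite exchange_big/=; apply: eq_bigr => i _.
by rewrite mulr_sumr.
Qed.

Let T_ge0 N i : 0 <= T N i. Proof. by apply: sumr_ge0 => k _. Qed.

Let hornerQX N i : (Q N ^+ i).[1] = \sum_(k < size (Q N ^+ i)) (Q N ^+ i)`_k.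
Proof. by rewrite horner_coef; apply: eq_bigr => k _; rewrite expr1n mulr1. Qed.

Let hornerQ N : (Q N).[1] = \sum_(k < N.+1) q k.
Proof.
by rewrite horner_poly; apply: eq_bigr => k _; rewrite expr1n mulr1.
Qed.

Variable sigma : R.
Hypothesis sigmaE : (\sum_(k < n.+1) q k) @[n --> \oo] --> sigma.

Let nd_sum : nondecreasing_seq (fun n => \sum_(k < n.+1) q k).
Proof.
apply/nondecreasing_seqP => n.
by rewrite [leRHS]big_ord_recr/= lerDl (q_ge0 n.+1).
Qed.

Let Q_le N : (Q N).[1] <= sigma.
Proof.
rewrite hornerQ -(cvg_lim _ sigmaE)//.
by apply: (nondecreasing_cvgn_le nd_sum); apply/cvg_ex; exists sigma.
Qed.

Let Q1_ge0 N : 0 <= (Q N).[1].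
Proof. by rewrite hornerQ; apply: sumr_ge0. Qed.

Let sum_ord_le (F : nat -> R) m n : (forall k, 0 <= F k) -> (m <= n)%N ->
  \sum_(k < m) F k <= \sum_(k < n) F k.
Proof.
move=> F0 mn; rewrite (big_ord_widen _ _ mn) big_mkcond/=.
by apply: ler_sum => k _; case: ifP.
Qed.

Let T_le N i : T N i <= sigma ^+ i.
Proof.
apply: (@le_trans _ _ ((Q N).[1] ^+ i)); last by apply: lerXn2r; rewrite ?nnegrE// (le_trans (Q1_ge0 N)).
rewrite -horner_exp hornerQX.
pose m := maxn N.+1 (size (Q N ^+ i)).
apply: (@le_trans _ _ (\sum_(k < m) (Q N ^+ i)`_k)).
  by apply: (sum_ord_le (fun k => coefQX_ge0 N i k)); rewrite leq_maxl.
rewrite [leLHS](bigID (fun k : 'I_m => (k < size (Q N ^+ i))%N))/= [X in _ + X]big1 ?addr0.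
  by rewrite -big_ord_widen// leq_maxr.
by move=> k; rewrite -leqNgt => sk; rewrite nth_default.
Qed.

Let T_ge N M i : (M * i <= N)%N -> (Q M).[1] ^+ i <= T N i.
Proof.
move=> MN; rewrite -horner_exp hornerQX.
have s : (size (Q M ^+ i) <= N.+1)%N.
  apply: (leq_trans (size_poly_exp_leq _ _)).
  rewrite ltnS; apply: leq_trans MN; rewrite leq_mul2r; apply/orP; right.
  have := size_poly N.+1 q; have := size_poly M.+1 q.
  by rewrite -/(Q M); case: (size _).
apply: (le_trans (sum_ord_le (fun k => coefQX_ge0 M i k) s)).
apply: ler_sum => k _; case: i MN {s} => [|i] MN; first by rewrite !expr0.
by apply: coefQX_le; apply: leq_trans MN; rewrite leq_pmulr.
Qed.

Let E x N : R := \sum_(i < N.+1) x ^+ i / i`!%:R.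

Let E_cvg x : E x N @[N --> \oo] --> expR x.
Proof.
have h : (fun N => series (exp_coeff x) N.+1) @ \oo --> expR x.
  rewrite (cvg_shiftS (series (exp_coeff x))); exact: is_cvg_series_exp_coeff.
apply: cvg_trans h; apply: near_eq_cvg; near=> N.
by rewrite /series/= big_mkord.
Unshelve. all: by end_near. Qed.

Let divn_cvg d : (N %/ d.+1)%N @[N --> \oo] --> \oo.
Proof.
apply/cvgnyPge => A; near=> n.
by rewrite leq_divRL//; near: n; exact: nbhs_infty_ge.
Unshelve. all: by end_near. Qed.

Let sigma_ge0 : 0 <= sigma. Proof. exact: le_trans (Q1_ge0 0) (Q_le 0). Qed.

(** With all signs positive the double sum is at most the exponential series, and it eventually
    exceeds every partial exponential sum up to a small error. *)
Let f_cvg : (\sum_(i < N.+1) 2 ^+ i / i`!%:R * T N i) @[N --> \oo] --> expR (2 * sigma).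
Proof.
have E_nd I J : (I <= J)%N -> E (2 * sigma) I <= E (2 * sigma) J.
  move=> IJ; apply: (@sum_ord_le (fun k => (2 * sigma) ^+ k / k`!%:R)) => // k.
  by rewrite divr_ge0// exprn_ge0// mulr_ge0.
have f_le N : \sum_(i < N.+1) 2 ^+ i / i`!%:R * T N i <= E (2 * sigma) N.
  apply: ler_sum => i _; rewrite exprMn mulrAC ler_wpM2r ?invr_ge0//.
  by rewrite ler_wpM2l// exprn_ge0.
have E_le N : E (2 * sigma) N <= expR (2 * sigma).
  rewrite -(cvg_lim _ (@E_cvg (2 * sigma)))//.
  apply: nondecreasing_cvgn_le; first by move=> ? ?; exact: E_nd.
  by apply/cvg_ex; exists (expR (2 * sigma)); exact: E_cvg.
apply/cvgrPdist_le => eps eps0.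
have e2 : 0 < eps / 2 by rewrite divr_gt0.
have /cvgrPdist_le/(_ _ e2)[I _ hI] := @E_cvg (2 * sigma).
have {}hI := hI I (leqnn I).
(* For i <= I the i-th power of [Q (N %/ I.+1)] has degree at most N, so all its coefficients are
   counted in [T N i]. *)
have hs : (\sum_(i < I.+1) 2 ^+ i / i`!%:R * (Q (N %/ I.+1)).[1] ^+ i) @[N --> \oo] --> E (2 * sigma) I.
  apply: cvg_big => [|i _]; first exact: add_continuous.
  rewrite exprMn mulrAC; apply: cvgMl_tmp.
  have hQ : (Q (N %/ I.+1)).[1] @[N --> \oo] --> sigma.
    apply: (cvg_comp (fun N => N %/ I.+1)%N (fun M => (Q M).[1]) (divn_cvg I)).
    by under eq_fun do rewrite hornerQ; exact: sigmaE.
  by apply: (cvg_comp _ (fun x => x ^+ i) hQ); exact: exprn_continuous.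
move/cvgrPdist_le/(_ _ e2) : hs => hs.
apply: filterS2 hs (nbhs_infty_ge I) => N.
set G := \sum_(i < I.+1) _ => hG IN.
have GF : G <= \sum_(i < N.+1) 2 ^+ i / i`!%:R * T N i.
  apply: (@le_trans _ _ (\sum_(i < I.+1) 2 ^+ i / i`!%:R * T N i)).
    apply: ler_sum => i _; rewrite ler_wpM2l ?divr_ge0 ?exprn_ge0//.
    apply: T_ge; rewrite (leq_trans _ (leq_trunc_div N I.+1))// leq_mul2l.
    by rewrite (ltnW (ltn_ord i)) orbT.
  apply: (@sum_ord_le (fun i => 2 ^+ i / i`!%:R * T N i)) => // k.
  by rewrite mulr_ge0// divr_ge0// exprn_ge0.
have := f_le N; have := E_le N; move: hI hG GF; rewrite !ler_norml.
set F := \sum_(i < N.+1) _ => /andP[h1 h2] /andP[h3 h4] h5 h6 h7.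
by apply/andP; split; lra.
Qed.

(** Evaluation of exp(-2 sum_k p_k x^k / k) at x = 1: term by term the signed error is dominated by
    the error with all signs positive, which tends to 0. *)
Lemma cvg_sum_exp_recursion : (\sum_(k < n.+1) e k) @[n --> \oo] --> expR (- 2 * sigma).
Proof.
have h : (E (2 * sigma) N - \sum_(i < N.+1) 2 ^+ i / i`!%:R * T N i) @[N --> \oo] --> (0 : R).
  have h0 := cvgB (@E_cvg (2 * sigma)) f_cvg.
  by rewrite subrr in h0; exact: h0.
have h' : (E (- 2 * sigma) N - \sum_(n < N.+1) e n) @[N --> \oo] --> (0 : R).
  apply/cvgr0Pnorm_le => eps eps0.
  move/cvgr0Pnorm_le/(_ _ eps0) : h; apply: filterS => N; apply: le_trans.
  rewrite sumE /E -!sumrB; apply: (le_trans (ler_norm_sum _ _ _)).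
  rewrite [leRHS]ger0_norm; last first.
    apply: sumr_ge0 => i _; rewrite exprMn subr_ge0 mulrAC ler_wpM2r ?invr_ge0//.
    by rewrite ler_wpM2l// exprn_ge0.
  apply: ler_sum => i _.
  have -> : (- 2 * sigma) ^+ i / i`!%:R - (-2) ^+ i / i`!%:R * T N i =
      (-1) ^+ i * ((2 * sigma) ^+ i / i`!%:R - 2 ^+ i / i`!%:R * T N i).
    have -> : -2 = -1 * 2 :> R by rewrite mulN1r.
    by rewrite !exprMn mulrBr !mulrA.
  rewrite normrM normrX normrN1 expr1n mul1r ger0_norm//.
  rewrite exprMn subr_ge0 mulrAC ler_wpM2r ?invr_ge0//.
  by rewrite ler_wpM2l// exprn_ge0.
rewrite -(subr0 (expR _)).
rewrite (_ : (fun n => _) = (fun N => E (- 2 * sigma) N - (E (- 2 * sigma) N - \sum_(n < N.+1) e n))).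
  by apply: cvgB; [exact: E_cvg|exact: h'].
by apply/funext => N; rewrite opprB addrCA subrr addr0.
Qed.

End exp_recursion.

(** * Differences of the Spitzer sequence *)

Section spitzer_sequence.
Context (R : realType).
Variables (p c : nat -> R) (sigma : R).
Hypothesis p0 : forall k, 0 <= p k.
Hypothesis c0 : c 0%N = 1.
Hypothesis cE : forall n, n.+1%:R * c n.+1 = \sum_(k < n.+1) (2 - 2 * p k.+1) * c (n - k)%N.
Hypothesis sigmaE : (\sum_(k < n) p k.+1 / k.+1%:R) @[n --> \oo] --> sigma.

Let diff (u : nat -> R) n := if n is m.+1 then u m.+1 - u m else u 0%N.

Let sum_diff u n : \sum_(k < n.+1) diff u k = u n.
Proof.
elim: n => [|n IH]; first by rewrite big_ord_recl big_ord0 addr0.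
by rewrite big_ord_recr/= IH subrKC.
Qed.

(** [diff] multiplies the generating function by 1 - x, whose logarithm is - sum_k x^k / k; every
    coefficient of the logarithmic derivative thus drops by 1. *)
Let diff_rec (d u : nat -> R) : u 0%N = 1 ->
  (forall n, n.+1%:R * u n.+1 = \sum_(k < n.+1) d k * u (n - k)%N) ->
  forall n, n.+1%:R * diff u n.+1 = \sum_(k < n.+1) (d k - 1) * diff u (n - k)%N.
Proof.
move=> u0 uE n.
have e1 : \sum_(k < n.+1) d k * diff u (n - k)%N = n.+1%:R * u n.+1 - n%:R * u n.
  rewrite uE; case: n => [|n].
    by rewrite mul0r subr0 !big_ord_recl !big_ord0 !addr0.
  rewrite uE big_ord_recr/= subnn [X in _ = X - _]big_ord_recr/= subnn/=.
  rewrite addrAC -sumrB; congr (_ + _); apply: eq_bigr => k _.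
  by rewrite subSn/= ?mulrBr// -ltnS.
have e2 : \sum_(k < n.+1) diff u (n - k)%N = u n.
  rewrite -[RHS]sum_diff (reindex_inj rev_ord_inj)/=; apply: eq_bigr => k _.
  by rewrite subSS subKn// -ltnS.
transitivity (\sum_(k < n.+1) d k * diff u (n - k)%N - \sum_(k < n.+1) diff u (n - k)%N).
  by rewrite e1 e2 /= -natr1; ring.
by rewrite -sumrB; apply: eq_bigr => k _; rewrite mulrBl mul1r.
Qed.

(* Taking differences lowers the coefficients 2 - 2 p_k by 1; after two differences the
   generating function is exp(-2 sum_k p_k x^k / k). *)
Lemma spitzer_sequence_cvg : (c n.+1 - c n) @[n --> \oo] --> expR (- 2 * sigma).
Proof.
have r1 := @diff_rec (fun k => 2 - 2 * p k.+1) c c0 cE.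
have d0 : diff c 0 = 1 by [].
have r2 := @diff_rec (fun k => 2 - 2 * p k.+1 - 1) (diff c) d0 r1.
have r3 n : n.+1%:R * diff (diff c) n.+1 = - 2 * \sum_(k < n.+1) p k.+1 * diff (diff c) (n - k)%N.
  rewrite r2 mulr_sumr; apply: eq_bigr => k _; rewrite mulrA; congr (_ * _).
  by ring.
have := @cvg_sum_exp_recursion R p p0 (diff (diff c)) d0 r3 sigma.
have sE : (\sum_(k < n.+1) (if (k : nat) is k'.+1 then p k / k%:R else 0)) @[n --> \oo] --> sigma.
  by under eq_fun => n do rewrite big_ord_recl/= add0r; exact: sigmaE.
move=> /(_ sE) h.
have : (\sum_(k < n.+2) diff (diff c) k) @[n --> \oo] --> expR (- 2 * sigma).
  by rewrite (cvg_shiftS (fun n => \sum_(k < n.+1) diff (diff c) k)).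
by under eq_fun => n do rewrite sum_diff/=.
Qed.

End spitzer_sequence.

(** * Averaging over the path *)

Section law_limit.
Context (R : realType).
Local Notation mu := (@lebesgue_measure R).
Local Notation N01 := (normal_prob 0 1 : probability (measurableTypeR R) R).
Local Notation sample_path := (sample_path R).
Local Open Scope ereal_scope.

Lemma ae_impl d (T : measurableType d) (P : probability T R) (A B : T -> Prop) :
  (forall x, A x -> B x) -> {ae P, forall x, A x} -> {ae P, forall x, B x}.
Proof. by move=> AB; apply: filterS. Qed.

Lemma bounded_cvg0 d (T : measurableType d) (P : probability T R) (f : nat -> T -> \bar R) (M : R) :
  (forall j, measurable_fun setT (f j)) -> (forall j x, 0 <= f j x) -> (forall j x, f j x <= M%:E) ->
  {ae P, forall x, f j x @[j --> \oo] --> 0} -> \int[P]_x f j x @[j --> \oo] --> 0.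
Proof.
move=> mf f0 fM fc.
have fc' : {ae P, forall x, setT x -> f ^~ x @ \oo --> cst 0 x} by apply: filterS fc => x + _.
have iM : P.-integrable setT (cst M%:E) by exact: finite_measure_integrable_cst.
have fM' : {ae P, forall x j, setT x -> `|f j x| <= cst M%:E x}.
  by apply: aeW => x j _; rewrite gee0_abs//=.
have [_ _] := dominated_convergence measurableT mf (measurable_cst _) fc' iM fM'.
by rewrite integral0.
Qed.

Variable LL : probability sample_path R.
Hypothesis iidLL : iid_map LL idfun.

(** The weighted sum of squares has finite expectation, hence is almost surely finite. *)
Lemma ae_weighted_sum :
  {ae LL, forall x : sample_path, exists B, forall n, (\sum_(i < n) x i ^+ 2 * sum_weight R i <= B)%R}.
Proof.
pose f i (x : sample_path) := (x i ^+ 2 * sum_weight R i)%:E.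
have w0 i : (0 <= sum_weight R i)%R by rewrite invr_ge0 mulr_ge0.
have f0 i x : 0 <= f i x by rewrite lee_fin mulr_ge0 ?sqr_ge0.
have mf i : measurable_fun setT (f i).
  by apply/measurable_EFinP; apply: measurable_funM => //; apply: measurable_funX; exact: measurable_coord.
have [M M0 hM] : exists2 M : R, (0 <= M)%R & forall i, \int[LL]_x f i x <= (M * sum_weight R i)%:E.
  (* z^2 <= 1 + z^4, and the fourth moment is at most 64. *)
  exists 65%R => // i.
  have m2 : measurable_fun setT (fun z : R => (z ^+ 2)%:E) by apply/measurable_EFinP; exact: measurable_funX.
  have m4 : measurable_fun setT (fun z : R => (z ^+ 4)%:E) by apply/measurable_EFinP; exact: measurable_funX.
  rewrite /f; under eq_integral do rewrite EFinM muleC.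
  rewrite ge0_integralZl//; last 3 first.
  - by apply/measurable_EFinP; apply: measurable_funX; exact: measurable_coord.
  - by move=> x _; rewrite lee_fin sqr_ge0.
  - by rewrite lee_fin.
  rewrite mulrC EFinM lee_wpmul2l ?lee_fin//.
  rewrite (@integral_coord _ LL iidLL i (fun z => (z ^+ 2)%:E))//; last by move=> x; rewrite lee_fin sqr_ge0.
  apply: (@le_trans _ _ (\int[N01]_z (1%:E + (z ^+ 4)%:E))).
    apply: ge0_le_integral => //.
    - by move=> x _; rewrite lee_fin sqr_ge0.
    - exact: emeasurable_funD.
    - move=> x _; rewrite -EFinD lee_fin (_ : (x ^+ 4 = (x ^+ 2) ^+ 2)%R); last by rewrite -exprM.
      by have := sqr_ge0 (x ^+ 2 - 1)%R; have := sqr_ge0 (x ^+ 2); nra.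
  rewrite ge0_integralD//; last by move=> x _; rewrite lee_fin exprn_even_ge0.
  rewrite (integral_prob_cst N01 1%:E); apply: le_trans (leeD (lexx _) (@normal_fourth_moment R)) _.
  by rewrite -EFinD lee_fin; lra.
have F0 x : 0 <= \sum_(i <oo) f i x by apply: nneseries_ge0.
have mF : measurable_fun setT (fun x => \sum_(i <oo) f i x).
  by apply: (@ge0_emeasurable_sum _ _ _ setT f xpredT) => // i x _ _.
have iF : LL.-integrable setT (fun x => \sum_(i <oo) f i x).
  apply/integrableP; split => //.
  under eq_integral do rewrite gee0_abs//.
  rewrite integral_nneseries//.
  apply: (@le_lt_trans _ _ (M * 3)%:E); last exact: ltry.
  apply: lime_le.
    by apply: is_cvg_nneseries => i _ _; apply: integral_ge0.
  apply: nearW => n.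
  apply: (@le_trans _ _ (\sum_(0 <= i < n) (M * sum_weight R i)%:E)).
    by apply: lee_sum => i _.
  by rewrite sumEFin lee_fin big_mkord -mulr_sumr ler_wpM2l// sum_weight_le.
apply: filterS (integrable_ae measurableT iF) => x /(_ I) xf.
exists (fine (\sum_(i <oo) f i x)) => n.
rewrite -lee_fin fineK//.
apply: le_trans (nneseries_lim_ge n _) => //.
by rewrite big_mkord sumEFin.
Qed.

Lemma N01_singleton (c : R) : N01 [set c] = 0.
Proof. by rewrite /= /normal_prob integral_set1. Qed.

Lemma walkE (y : R) (w : nat -> R) i : walk y w i = (\sum_(l < i) y * w l + i%:R * (y ^+ 2 / 2))%R.
Proof. by rewrite /walk big_split/= sumr_const card_ord mulr_natl. Qed.

Lemma measurable_walk (y : R) i : measurable_fun setT (fun w : sample_path => walk y w i).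
Proof.
apply: measurable_sum => l; apply: measurable_funD => //.
by apply: measurable_funM => //; exact: measurable_coord.
Qed.

(** For [y] nonzero and i > 0 the position of the walk is a nondegenerate normal variable, which has
    no atoms. *)
Lemma ae_walk_neq (y u : R) : y != 0%R ->
  {ae LL, forall w, forall i, (0 < i)%N -> walk y w i != u}.
Proof.
move=> y0; apply: ae_foralln => i.
case: (posnP i) => [->|i0]; first by apply: aeW.
exists [set w : sample_path | walk y w i = u]; split.
- rewrite (_ : [set w | _] = (fun w : sample_path => walk y w i) @^-1` [set u])//.
  by rewrite -[X in measurable X]setTI; exact: measurable_walk.
- pose c := (u - i%:R * (y ^+ 2 / 2))%R.
  have mc : measurable_fun setT (EFin \o \1_[set c] : R -> \bar R) by apply/measurable_EFinP; exact: measurable_indic.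
  have := @integral_gauss_sum R LL iidLL (fun=> y) i (EFin \o \1_[set c]) mc.
  rewrite (_ : \int[LL]_z _ = LL [set w : sample_path | walk y w i = u]); last first.
    rewrite -[X in _ = LL X]setIT -integral_indic//; last first.
      rewrite (_ : [set w | _] = (fun w : sample_path => walk y w i) @^-1` [set u])//.
      by rewrite -[X in measurable X]setTI; exact: measurable_walk.
    apply: eq_integral => w _; rewrite /= !indicE; congr (_%:R%:E); congr nat_of_bool.
    apply/idP/idP; rewrite !inE/= walkE /c.
      by move=> ->; rewrite subrK.
    by move=> <-; rewrite addrK.
  have c0 (x : R) : 0 <= ((\1_[set c] x : R)%:E) by rewrite lee_fin.
  move=> h; apply: (etrans (h c0)) => {h}.
  set sg := Num.sqrt _.
  have sg0 : (0 < sg)%R by rewrite sqrtr_gt0 sumr_const card_ord pmulrn_rgt0// exprn_even_gt0.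
  rewrite -(N01_singleton (c / sg)) -[X in _ = _ X]setIT -integral_indic//.
  apply: eq_integral => x _; rewrite /= !indicE; congr (_%:R%:E); congr nat_of_bool.
  apply/idP/idP; rewrite !inE/=.
    by move=> <-; rewrite mulrAC divff ?mul1r// gt_eqF.
  by move=> ->; rewrite mulrC divfK// gt_eqF.
- move=> w /= h; apply: contrapT => ne; apply: h => _; exact/eqP.
Qed.

Section density.
Variables (s t : R).
Hypothesis st : (0 < t \/ (s = 0 /\ t = 0))%R.

Definition mean_pdf (v y : R) : R := v^-1 * normal_pdf 0 1 (v^-1 * (y - s / t)).

(** For m >= 1, the standard deviation of [post_mean] after [m] steps; the last summand is the share
    of the first innovation. *)
Definition old_sd m : R := Num.sqrt (\sum_(i < m) tail_coef t i ^+ 2 + (1 + t)^-1 ^+ 2).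

Lemma measurable_old_mean m : measurable_fun setT (fun x : sample_path => old_mean s t x m).
Proof.
apply: measurable_funD => //; apply: measurable_sum => i.
by apply: measurable_funM => //; exact: measurable_coord.
Qed.

(** The density due to the first innovation is convolved with the normal law of the older ones,
    exactly at each [m]. *)
Lemma old_mean_density m y :
  \int[LL]_x ((1 + t) * normal_pdf 0 1 ((1 + t) * (y - old_mean s t x m)))%:E = (mean_pdf (old_sd m) y)%:E.
Proof.
have t1 : (0 < 1 + t)%R by exact: (tS_gt0 st 0).
have t1i : (0 < (1 + t)^-1)%R by rewrite invr_gt0.
pose F (c : R) : \bar R := ((1 + t) * normal_pdf 0 1 ((1 + t) * (y - s / t - c)))%:E.
have mF : measurable_fun setT F.
  apply/measurable_EFinP; apply: measurable_funM => //.
  apply: (measurableT_comp (@measurable_normal_pdf R 0 1)).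
  by apply: measurable_funM => //; exact: measurable_funB.
have F0 c : 0 <= F c by rewrite lee_fin mulr_ge0 ?normal_pdf_ge0// ltW.
transitivity (\int[LL]_x F (\sum_(i < m) tail_coef t i * x i)%R).
  by apply: eq_integral => x _; rewrite /F /old_mean opprD addrA.
rewrite (integral_gauss_sum iidLL)//.
have := @integral_N01_normal_pdf R (Num.sqrt (\sum_(i < m) tail_coef t i ^+ 2)) (1 + t)^-1 (y - s / t) t1i.
by rewrite /= invrK sqr_sqrtr ?sumr_ge0// => i _; exact: sqr_ge0.
Qed.

(** The partial sums [S] are nondecreasing and at most 2, so the series in [G_variance] has a
    genuine limit, and from index 1 on [old_sd] is their square root. *)
Lemma old_sd_cvg : (0 < G_variance t)%R /\ (old_sd m @[m --> \oo] --> Num.sqrt (G_variance t))%R.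
Proof.
have t1 : (0 < 1 + t)%R by exact: (tS_gt0 st 0).
pose S m := (\sum_(1 <= i < m.+1) ((i%:R + t) ^+ 2)^-1)%R.
have SE m : S m.+1 = (\sum_(i < m.+1) tail_coef t i ^+ 2 + (1 + t)^-1 ^+ 2)%R.
  rewrite /S big_add1/= big_mkord big_ord_recl [in RHS]big_ord_recl/= /tail_coef/= expr0n/= add0r addrC.
  by congr (_ + _)%R; [apply: eq_bigr => i _; rewrite exprVn|rewrite exprVn].
have Snd : nondecreasing_seq S.
  apply/nondecreasing_seqP => m; rewrite /S [leRHS]big_nat_recr//= lerDl invr_ge0 sqr_ge0//.
have Sub m : (S m.+1 <= 2)%R.
  rewrite SE; have := sum_tail_coef2_le1 st m.+1.
  have : ((1 + t)^-1 ^+ 2 <= 1)%R by rewrite exprVn invf_le1 ?exprn_gt0// exprn_ege1// lerDl (t_ge0 st).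
  by lra.
have Sc : S @ \oo --> limn S.
  apply: nondecreasing_is_cvgn => //; exists 2%R => _ [m _ <-].
  by apply: le_trans (Sub m); exact: Snd.
have GS : G_variance t = limn S.
  pose S' m := (\sum_(1 <= i < m) ((i%:R + t) ^+ 2)^-1)%R.
  have Sc' : S' @ \oo --> limn S by rewrite -(cvg_shiftS S').
  by rewrite /G_variance; exact: (cvg_lim _ Sc').
have G0 : (0 < G_variance t)%R.
  apply: (@lt_le_trans _ _ (S 1%N)); last by rewrite GS; apply: nondecreasing_cvgn_le => //; apply/cvg_ex; exists (limn S).
  by rewrite SE ltr_wpDl ?exprn_gt0 ?invr_gt0// sumr_ge0// => i _; exact: sqr_ge0.
split => //.
rewrite -(cvg_shiftS) GS.
have -> : (fun n => old_sd n.+1) = (fun n => Num.sqrt (S n.+1)) by apply/funext => n; rewrite /old_sd SE.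
apply: continuous_cvg; first exact: sqrt_continuous.
by have := Sc; rewrite -(cvg_shiftS S).
Qed.

Lemma mean_pdf_cvg (m_ : nat -> nat) y : (m_ j @[j --> \oo] --> \oo) ->
  (mean_pdf (old_sd (m_ j)) y @[j --> \oo] --> mean_pdf (Num.sqrt (G_variance t)) y)%R.
Proof.
move=> my; have [G0 c0] := old_sd_cvg.
have c := cvg_comp _ _ my c0.
have s0 : Num.sqrt (G_variance t) != 0%R by rewrite gt_eqF// sqrtr_gt0.
have ci : ((old_sd (m_ j))^-1 @[j --> \oo] --> (Num.sqrt (G_variance t))^-1)%R by apply: cvgV.
apply: cvgM => //.
apply: continuous_cvg; first by apply: continuous_normal_pdf; rewrite oner_eq0.
by apply: cvgMl.
Qed.

Lemma measurable_walk_above K y u : measurable [set w : sample_path | walk_above K y w u].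
Proof.
rewrite (_ : [set w | _] = \bigcap_(i in [set i | i \in iota 1 K]) [set w : sample_path | (u < walk y w i)%R]).
  apply: bigcap_measurableType => i _.
  rewrite (_ : [set w | _] = (fun w : sample_path => walk y w i) @^-1` `]u, +oo[%classic).
    by rewrite -[X in measurable X]setTI; exact: measurable_walk.
  by apply/seteqP; split => w /=; rewrite in_itv/= andbT.
by apply/seteqP; split => w /=; [move=> /allP h i /h|move=> h; apply/allP => i /h].
Qed.

Lemma integral_walk_above K y u (c : R) : (0 <= c)%R ->
  \int[LL]_w (c * (walk_above K y w u)%:R)%:E = c%:E * LL [set w | walk_above K y w u].
Proof.
move=> c0; have mW := measurable_walk_above K y u.
rewrite -[X in LL X]setIT -integral_indic// -ge0_integralZl//; last by apply/measurable_EFinP; exact: measurable_indic.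
apply: eq_integral => w _; rewrite -EFinM indicE; congr (_ * _%:R)%:E; congr nat_of_bool.
by apply/idP/idP; rewrite inE.
Qed.

Section mean_kern_cvg.
Variables (K : nat) (n_ : nat -> nat) (b_ : nat -> R) (y sg u : R).
Hypotheses (n_y : n_ j @[j --> \oo] --> \oo) (y0 : (0 < y)%R) (sg0 : sg != 0%R)
  (by_ : (2 * b_ j / (n_ j).-1%:R @[j --> \oo] --> y ^+ 2)%R).

(** Bounded convergence on the pair of old and recent paths replaces the kernel by [gx], in which
    the two paths separate: its double integral is exactly a normal density times a probability for
    the walk. *)
Lemma mean_kern_cvg : mean_kern s t LL K (n_ j) (b_ j) sg u @[j --> \oo] -->
  (mean_pdf (Num.sqrt (G_variance t)) (sg * y))%:E * LL [set w | walk_above K (sg * y) w u].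
Proof.
have t1 : (0 < 1 + t)%R by exact: (tS_gt0 st 0).
pose q := LL [set w | walk_above K (sg * y) w u].
pose kx j (x w : sample_path) : R := kern s t K (mix (recent_split K (n_ j)) (x, w)) (n_ j) (b_ j) sg u.
pose cx j (x : sample_path) : R := ((1 + t) * normal_pdf 0 1 ((1 + t) * (sg * y - old_mean s t x (n_ j - K))))%R.
pose gx j (x w : sample_path) : R := (cx j x * (walk_above K (sg * y) w u)%:R)%R.
pose dx j (x w : sample_path) : R := `|kx j x w - gx j x w|%R.
have f0 (c : R) : (0 <= (1 + t) * normal_pdf 0 1 c)%R by rewrite mulr_ge0 ?normal_pdf_ge0// ltW.
have f1 (c : R) : ((1 + t) * normal_pdf 0 1 c <= 1 + t)%R by rewrite ler_piMr ?normal_pdf_le1// ltW.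
have ind01 (c : R) (e : bool) : (0 <= c)%R -> (c <= 1 + t)%R -> (0 <= c * e%:R <= 1 + t)%R.
  by move=> c0 c1; case: e; rewrite ?mulr1 ?mulr0 ?c0 ?lexx// ltW.
have kx01 j x w : (0 <= kx j x w <= 1 + t)%R by apply: ind01.
have gx01 j x w : (0 <= gx j x w <= 1 + t)%R by apply: ind01; [exact: f0|exact: f1].
have dxle j x w : (0 <= dx j x w <= 1 + t)%R.
  rewrite normr_ge0/= ler_norml; have /andP[k0 k1] := kx01 j x w; have /andP[g0 g1] := gx01 j x w.
  by apply/andP; split; lra.
have mk j : measurable_fun setT (fun p : sample_path * sample_path => kx j p.1 p.2).
  rewrite (_ : (fun p => _) = (fun p => kern s t K (mix (recent_split K (n_ j)) p) (n_ j) (b_ j) sg u)); last first.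
    by apply/funext => -[].
  apply: (@measurable_kern _ _ _ _ _ (mix (recent_split K (n_ j))) (fun=> u)) => //.
  exact: measurable_mix.
have mc j : measurable_fun setT (cx j).
  apply: measurable_funM => //; apply: (measurableT_comp (@measurable_normal_pdf R 0 1)).
  by apply: measurable_funM => //; apply: measurable_funB => //; exact: measurable_old_mean.
have mg j : measurable_fun setT (fun p : sample_path * sample_path => gx j p.1 p.2).
  apply: measurable_funM; first by apply: (measurableT_comp (mc j)); exact: measurable_fst.
  rewrite (_ : (fun p => _) = (\1_[set w : sample_path | walk_above K (sg * y) w u] : sample_path -> R) \o snd); last first.
    apply/funext => p; rewrite /= indicE; congr (_%:R); congr nat_of_bool.
    by apply/idP/idP; rewrite inE.
  apply: measurableT_comp; last exact: measurable_snd.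
  by apply: measurable_indic; exact: measurable_walk_above.
have md j : measurable_fun setT (fun p : sample_path * sample_path => dx j p.1 p.2).
  by apply: measurableT_comp => //; exact: measurable_funB.
have iter (h : sample_path -> sample_path -> R) : measurable_fun setT (fun p : sample_path * sample_path => h p.1 p.2) ->
   (forall x w, 0 <= h x w)%R ->
   measurable_fun setT (fun x => \int[LL]_w (h x w)%:E) /\
   (forall x, measurable_fun setT (fun w => (h x w)%:E)).
  move=> mh h0; split.
    apply: (@measurable_fun_fubini_tonelli_F _ _ _ _ _ LL (fun p : sample_path * sample_path => (h p.1 p.2)%:E)).
      exact/measurable_EFinP.
    by move=> p; rewrite lee_fin.
  move=> x; apply/measurable_EFinP.
  have mp : measurable_fun setT (fun w : sample_path => (x, w)) by exact: measurable_pair1.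
  exact: (measurableT_comp mh mp).
have k0 j x w : (0 <= kx j x w)%R by case/andP: (kx01 j x w).
have g0 j x w : (0 <= gx j x w)%R by case/andP: (gx01 j x w).
have d0 j x w : (0 <= dx j x w)%R by exact: normr_ge0.
pose I h := \int[LL]_x \int[LL]_w (h x w : R)%:E.
have IE j : mean_kern s t LL K (n_ j) (b_ j) sg u = I (kx j).
  rewrite /mean_kern (integral_mix iidLL (@recent_split_inj K (n_ j)))//.
    by apply/measurable_EFinP; apply: (@measurable_kern _ _ _ _ _ (fun z : sample_path => z) (fun=> u)).
  by move=> z; rewrite lee_fin (kern_ge0 st).
have JE j : I (gx j) = (mean_pdf (old_sd (n_ j - K)) (sg * y))%:E * q.
  rewrite /I -old_mean_density -ge0_integralZr//; last 3 first.
  - by apply/measurable_EFinP; exact: mc.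
  - by move=> x _; rewrite lee_fin.
  - exact: measure_ge0.
  by apply: eq_integral => x _; apply: integral_walk_above; exact: f0.
have le_add (f g h : sample_path -> sample_path -> R) :
   measurable_fun setT (fun p : sample_path * sample_path => f p.1 p.2) ->
   measurable_fun setT (fun p : sample_path * sample_path => g p.1 p.2) ->
   measurable_fun setT (fun p : sample_path * sample_path => h p.1 p.2) ->
   (forall x w, 0 <= f x w)%R -> (forall x w, 0 <= g x w)%R -> (forall x w, 0 <= h x w)%R ->
   (forall x w, f x w <= g x w + h x w)%R -> I f <= I g + I h.
  move=> mf mg' mh f0' g0' h0' fgh.
  have [mf1 mf2] := iter _ mf f0'; have [mg1 mg2] := iter _ mg' g0'; have [mh1 mh2] := iter _ mh h0'.
  rewrite /I -ge0_integralD//; last 2 first.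
  - by move=> x _; apply: integral_ge0 => w _; rewrite lee_fin.
  - by move=> x _; apply: integral_ge0 => w _; rewrite lee_fin.
  apply: ge0_le_integral => //.
  - by move=> x _; apply: integral_ge0 => w _; rewrite lee_fin.
  - exact: emeasurable_funD.
  move=> x _; rewrite -ge0_integralD//; last 2 first.
  - by move=> w _; rewrite lee_fin.
  - by move=> w _; rewrite lee_fin.
  apply: ge0_le_integral => //.
  - by move=> w _; rewrite lee_fin.
  - exact: emeasurable_funD.
  - by move=> w _; rewrite -EFinD lee_fin.
have dI0 j x : 0 <= \int[LL]_w (dx j x w)%:E by apply: integral_ge0 => w _; rewrite lee_fin.
have dI1 j x : \int[LL]_w (dx j x w)%:E <= (1 + t)%:E.
  rewrite -(integral_prob_cst LL (1 + t)%:E); apply: ge0_le_integral => //.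
  - by move=> w _; rewrite lee_fin.
  - exact: (iter _ (md j) (d0 j)).2.
  - by move=> w _; rewrite lee_fin; case/andP: (dxle j x w).
have dI j : I (dx j) \is a fin_num.
  rewrite ge0_fin_numE; last by apply: integral_ge0.
  apply: (@le_lt_trans _ _ (1 + t)%:E); last exact: ltry.
  rewrite -[leRHS](integral_prob_cst LL); apply: ge0_le_integral => //.
  exact: (iter _ (md j) (d0 j)).1.
(* The differences are at most 1 + t. The exceptional sets are the old paths with unbounded weighted
   sums and the recent paths whose walk hits [u]. *)
have D0 : I (dx j) @[j --> \oo] --> 0.
  apply: (@bounded_cvg0 _ _ LL _ (1 + t)).
  - by move=> j; case: (iter _ (md j) (d0 j)).
  - by move=> j x; apply: integral_ge0 => w _; rewrite lee_fin.
  - by move=> j x; exact: dI1.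
  apply: filterS ae_weighted_sum => x [B xB].
  apply: (@bounded_cvg0 _ _ LL _ (1 + t)).
  - by move=> j; exact: (iter _ (md j) (d0 j)).2.
  - by move=> j w; rewrite lee_fin.
  - by move=> j w; rewrite lee_fin; case/andP: (dxle j x w).
  have sgy0 : (sg * y)%R != 0%R by rewrite mulf_neq0// gt_eqF.
  have aw := ae_walk_neq u sgy0.
  apply: ae_impl aw => w uw.
  have h := @kern_mix_cvg R s t st x w B xB K n_ b_ y sg u n_y y0 by_ uw.
  apply: cvg_EFin; first exact: nearW.
  by rewrite -(normr0 R); exact: (cvg_norm h).
have J0 : I (gx j) @[j --> \oo] --> (mean_pdf (Num.sqrt (G_variance t)) (sg * y))%:E * q.
  rewrite (_ : (fun j => I (gx j)) = (fun j => (mean_pdf (old_sd (n_ j - K)) (sg * y))%:E * q)); last exact/funext.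
  apply: cvgeMr; first by rewrite fin_num_measure//; exact: measurable_walk_above.
  apply: cvg_EFin; first exact: nearW.
  apply: mean_pdf_cvg; apply/cvgnyPge => A.
  move/cvgnyPge : n_y => /(_ (A + K)%N); apply: filterS => j; lia.
have lim0 : forall e : \bar R, e - 0 = e /\ e + 0 = e by move=> e; rewrite sube0 adde0.
have lf : (mean_pdf (Num.sqrt (G_variance t)) (sg * y))%:E * q \is a fin_num.
  by rewrite fin_numM// fin_num_measure//; exact: measurable_walk_above.
apply: (@squeeze_cvge _ _ _ _ (fun j => I (gx j) - I (dx j)) _ (fun j => I (gx j) + I (dx j))).
- apply: nearW => j; rewrite IE; apply/andP; split.
    rewrite leeBlDr; last exact: dI.
    apply: le_add => // x w; rewrite -lerBlDl; apply: le_trans (ler_norm _) _; by rewrite distrC.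
  apply: le_add => // x w; rewrite -lerBlDl; exact: ler_norm.
- by rewrite -[X in _ --> X](lim0 _).1; apply: cvgeB => //; rewrite fin_num_adde_defl.
- by rewrite -[X in _ --> X](lim0 _).2; apply: cvgeD => //; rewrite fin_num_adde_defl.
Qed.

End mean_kern_cvg.

End density.

End law_limit.

(** * Summation over the crossing times *)

Section grid.
Context (R : realType).
Local Notation mu := (@lebesgue_measure R).
Local Open Scope ereal_scope.

Lemma ge0_dominated_cvg d (T : measurableType d) (m : {measure set T -> \bar R}) (D : set T)
  (f_ : nat -> T -> \bar R) (f g : T -> \bar R) : measurable D ->
  (forall j, measurable_fun D (f_ j)) -> (forall j x, D x -> 0 <= f_ j x) ->
  (forall j x, D x -> f_ j x <= g x) -> m.-integrable D g ->
  (forall x, D x -> f_ j x @[j --> \oo] --> f x) ->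
  \int[m]_(x in D) f_ j x @[j --> \oo] --> \int[m]_(x in D) f x.
Proof.
move=> mD mf f0 fg ig fc.
have mfl : measurable_fun D f by exact: emeasurable_fun_cvg mf fc.
have fc' : {ae m, forall x, D x -> f_ ^~ x @ \oo --> f x} by apply: aeW.
have fg' : {ae m, forall x n, D x -> `|f_ n x| <= g x}.
  by apply: aeW => x n Dx; rewrite gee0_abs ?f0// fg.
by have [] := dominated_convergence mD mf mfl fc' ig fg'.
Qed.

Lemma measurable_truncn_comp (f : R -> R) (a : nat -> \bar R) :
  measurable_fun setT f -> measurable_fun setT (fun y => a (Num.truncn (f y))).
Proof.
move=> mf _ B mB; rewrite setTI.
rewrite (_ : _ @^-1` B = \bigcup_(k in [set k | B (a k)]) (f @^-1` [set x | Num.truncn x = k])).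
  apply: bigcup_measurable => k _.
  rewrite -[X in measurable X]setTI; apply: mf => //.
  case: k => [|k].
    rewrite (_ : [set x | _] = `]-oo, 1%R[%classic)//; apply/seteqP; split => x /=; rewrite in_itv/=.
      by move=> x0; rewrite ltNge; apply/negP => x1; move: x1; rewrite -truncn_gt0 x0.
    by move=> x1; apply/truncn0Pn; rewrite -ltNge.
  rewrite (_ : [set x | _] = `[k.+1%:R, k.+2%:R[%classic)//; apply/seteqP; split => x /=; rewrite in_itv/=.
    move=> xk; have x0 : (0 <= x)%R by apply: contraT => x0; move: xk; rewrite truncn_floor (negbTE x0).
    by rewrite -truncn_eq// xk.
  by move=> h; exact: truncn_def.
apply/seteqP; split => y /=; first by move=> By; exists (Num.truncn (f y)).
by move=> [k Bk fk]; rewrite fk.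
Qed.

Section fixed_b.
Variables (b dl : R).
Hypotheses (b0 : (0 < b)%R) (d0 : (0 < dl)%R).

(* A crossing at time [k] happens with a predictive mean close to [grid k] in absolute
   value, so that sums over [k] become integrals over [y]. *)
Definition grid k : R := Num.sqrt (2 * b / k%:R).
Definition grid_index (y : R) : nat := Num.truncn (2 * b / y ^+ 2).

Lemma measurable_grid_index (a : nat -> \bar R) : measurable_fun setT (fun y => a (grid_index y)).
Proof.
apply: measurable_truncn_comp; apply: measurable_funM => //.
apply: (@measurableT_comp _ _ _ _ _ _ (fun x : R => x^-1)%R); first exact: measurable_inv.
exact: measurable_funX.
Qed.

Lemma grid_index_eq k (y : R) : (0 < k)%N -> (grid k.+1 < y <= grid k)%R -> grid_index y = k.
Proof.
move=> k0 /andP[ky yk].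
have kp : (0 < k%:R :> R)%R by rewrite ltr0n.
have y0 : (0 < y)%R by apply: le_lt_trans ky; exact: sqrtr_ge0.
have y20 : (0 < y ^+ 2)%R by rewrite exprn_gt0.
apply: truncn_def; apply/andP; split.
  rewrite ler_pdivlMr// mulrC -ler_pdivlMr//.
  rewrite -(@sqr_sqrtr R (2 * b / k%:R)); last by rewrite divr_ge0// mulr_ge0// ltW.
  by rewrite lerXn2r ?nnegrE ?(ltW y0)// sqrtr_ge0.
rewrite ltr_pdivrMr// [X in (_ < X)%R]mulrC -ltr_pdivrMr ?ltr0n//.
rewrite -(@sqr_sqrtr R (2 * b / k.+1%:R)); last by rewrite divr_ge0// mulr_ge0// ltW.
by rewrite ltr_pXn2r ?nnegrE ?(ltW y0)// sqrtr_ge0.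
Qed.

(** The intervals ]grid (k+1), grid k] are disjoint, [grid_index] is k on each of them, and for k <=
    N they lie above [dl] because N + 1 <= 2 b / dl^2. *)
Lemma grid_sum_le N (a : nat -> \bar R) : (forall k, 0 <= a k) -> (N.+1%:R <= 2 * b / dl ^+ 2)%R ->
  \sum_(1 <= k < N.+1) (grid k - grid k.+1)%:E * a k <=
  \int[mu]_(y in `]dl, +oo[) a (grid_index y).
Proof.
move=> a0 Nb.
have gle k : (0 < k)%N -> (grid k.+1 <= grid k)%R.
  move=> k0; rewrite ler_wsqrtr// ler_wpM2l ?mulr_ge0 ?(ltW b0)//.
  by rewrite lef_pV2 ?posrE ?ltr0n// ler_nat.
have gdl k : (k < N.+1)%N -> (dl <= grid k.+1)%R.
  move=> kN; rewrite -[leLHS](ger0_norm (ltW d0)) -sqrtr_sqr ler_wsqrtr//.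
  rewrite ler_pdivlMr ?ltr0n// mulrC -ler_pdivlMr ?exprn_gt0//.
  by apply: le_trans Nb; rewrite ler_nat.
have -> : \sum_(1 <= k < N.+1) (grid k - grid k.+1)%:E * a k =
    \sum_(1 <= k < N.+1) \int[mu]_y ((\1_(`]grid k.+1, grid k]) y)%:E * a k).
  apply: eq_big_nat => k /andP[k0 kN].
  rewrite ge0_integralZr//; last by apply/measurable_EFinP; exact: measurable_indic.
  rewrite integral_indic//= setIT lebesgue_measure_itv/= lte_fin; case: ltP => // h.
  have -> : grid k = grid k.+1 by apply/eqP; rewrite eq_le h gle.
  by rewrite subrr.
rewrite -ge0_integral_sum//; last 2 first.
- move=> k; apply: emeasurable_funM => //.
  by apply/measurable_EFinP; exact: measurable_indic.
- by move=> k y _; rewrite mule_ge0// lee_fin.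
rewrite [leRHS]integral_mkcond; apply: ge0_le_integral => //.
- by move=> y _; apply: sume_ge0 => k _; rewrite mule_ge0// lee_fin.
- apply: emeasurable_sum => k; apply: emeasurable_funM => //.
  by apply/measurable_EFinP; exact: measurable_indic.
- by apply/(measurable_restrictT _ _).1 => //; apply: measurable_funTS; exact: measurable_grid_index.
move=> y _.
have -> : \sum_(1 <= k < N.+1) (\1_(`]grid k.+1, grid k]) y)%:E * a k =
    \sum_(1 <= k < N.+1 | k == grid_index y) (\1_(`]grid k.+1, grid k]) y)%:E * a k.
  rewrite [RHS]big_mkcond/=; apply: eq_big_nat => k /andP[k0 kN].
  case: ifPn => // /eqP kg; rewrite indicE memNset ?mul0e//= in_itv/= => h.
  by apply: kg; rewrite (grid_index_eq k0 h).
rewrite big_nat1_eq patchE; case: ifPn => [/andP[k0 kN]|_]; last first.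
  by case: ifPn.
rewrite indicE; have [yi|yi] := boolP (y \in (`]grid (grid_index y).+1, grid (grid_index y)]%classic : set R)); last first.
  by rewrite mul0e; case: ifPn.
rewrite mul1e; move: yi; rewrite mem_setE in_itv/= => /andP[ky yk].
by rewrite ifT// mem_setE in_itv/= andbT (le_lt_trans (gdl _ kN)).
Qed.

(** With p = sqrt k and q = sqrt(k+1) this is 1 = (q - p)(q + p) <= 2 q (q - p). Near y the factor
    (k+1)/b tends to 2/y^2. *)
Lemma inv_sqrt_le_grid k : (0 < k)%N ->
  ((Num.sqrt (2 * k%:R * b))^-1 <= (grid k - grid k.+1) * (k.+1%:R / b))%R.
Proof.
move=> k0; rewrite /grid.
set p := Num.sqrt (k%:R : R); set q := Num.sqrt (k.+1%:R : R); set B := Num.sqrt (2 * b).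
have p0 : (0 < p)%R by rewrite sqrtr_gt0 ltr0n.
have q0 : (0 < q)%R by rewrite sqrtr_gt0 ltr0n.
have B0 : (0 < B)%R by rewrite sqrtr_gt0 mulr_gt0.
have pq : (q ^+ 2 = p ^+ 2 + 1)%R by rewrite !sqr_sqrtr// natr1.
have B2 : (B ^+ 2 = 2 * b)%R by rewrite sqr_sqrtr// mulr_ge0// ltW.
have b2 : (0 <= 2 * b)%R by rewrite mulr_ge0// ltW.
have -> : Num.sqrt (2 * k%:R * b) = (B * p)%R by rewrite -sqrtrM//; congr Num.sqrt; ring.
rewrite (sqrtrM _ b2) (sqrtrM _ b2) !sqrtrV// -/B -/p -/q.
have -> : (k.+1%:R / b = 2 * q ^+ 2 / B ^+ 2)%R.
  by rewrite B2 sqr_sqrtr//; field; rewrite gt_eqF.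
rewrite -(ler_pM2r (_ : 0 < B * p)%R); last by rewrite mulr_gt0.
rewrite mulVf ?gt_eqF ?mulr_gt0//.
have -> : ((B / p - B / q) * (2 * q ^+ 2 / B ^+ 2) * (B * p) = 2 * q * (q - p))%R.
  by field; rewrite !gt_eqF.
by have := sqr_ge0 (q - p)%R; nra.
Qed.

End fixed_b.

End grid.

(** * From sums over crossing times to integrals over the mean *)

Section grid_limit.
Context (R : realType).
Local Notation mu := (@lebesgue_measure R).
Local Notation sample_path := (sample_path R).
Variables (s t : R).
Hypothesis st : (0 < t \/ (s = 0 /\ t = 0))%R.
Variable LL : probability sample_path R.
Hypothesis iidLL : iid_map LL idfun.
Local Open Scope ereal_scope.
Variables (K : nat) (g : R -> R) (dl : R).
Hypotheses (K0 : (0 < K)%N) (mg : measurable_fun setT g) (g01 : forall u, (0 <= g u <= 1)%R)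
  (d0 : (0 < dl)%R).

Let g0 u : (0 <= g u)%R. Proof. by case/andP: (g01 u). Qed.

(** Index [k] stands for a crossing at time k + 1, the quadratic at time n having coefficient n - 1.
    A crossing at time 1 is treated apart, hence the value 0 at k = 0. *)
Definition kern_term b k : \bar R := if k == 0%N then 0 else (k.+1%:R / b)%:E *
  \int[mu]_(u in `]0%R, +oo[) ((mean_kern s t LL K k.+1 b 1 u + mean_kern s t LL K k.+1 b (-1) u) * (g u)%:E).

Definition limit_pdf (y : R) : R := mean_pdf s t (Num.sqrt (G_variance t)) y.

Definition limit_term (y : R) : \bar R := (2 / y ^+ 2)%:E *
  \int[mu]_(u in `]0%R, +oo[)
    (((limit_pdf (1 * y))%:E * LL [set w | walk_above K (1 * y) w u] +
      (limit_pdf (-1 * y))%:E * LL [set w | walk_above K (-1 * y) w u]) * (g u)%:E).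

Lemma mean_pdf_ge0 v y : (0 <= v)%R -> (0 <= mean_pdf s t v y)%R.
Proof. by move=> v0; rewrite mulr_ge0 ?invr_ge0 ?normal_pdf_ge0. Qed.

Lemma limit_pdf_ge0 y : (0 <= limit_pdf y)%R.
Proof. by apply: mean_pdf_ge0; exact: sqrtr_ge0. Qed.

Lemma kern_term_ge0 b k : (0 < b)%R -> 0 <= kern_term b k.
Proof.
move=> b0; rewrite /kern_term; case: ifP => // _; rewrite mule_ge0//.
  by rewrite lee_fin divr_ge0// ltW.
by apply: integral_ge0 => u _; rewrite mule_ge0 ?lee_fin// adde_ge0// mean_kern_ge0.
Qed.

Lemma hit_sum_le b N : (0 < b)%R -> (N.+1%:R <= 2 * b / dl ^+ 2)%R ->
  \sum_(1 <= k < N.+1) hit_term s t LL b g k.+1 <=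
  \int[mu]_(y in `]dl, +oo[) kern_term b (grid_index b y).
Proof.
move=> b0 Nb.
apply: le_trans (grid_sum_le b0 d0 (fun k => kern_term_ge0 k b0) Nb).
rewrite big_nat [leRHS]big_nat; apply: lee_sum => k /andP[k0 kN].
apply: le_trans (hit_term_bound st iidLL K _ b0 mg g0) _; first by [].
rewrite /kern_term gtn_eqF//= muleA lee_wpmul2r//.
  by apply: integral_ge0 => u _; rewrite mule_ge0 ?lee_fin// adde_ge0// mean_kern_ge0.
by rewrite -EFinM lee_fin inv_sqrt_le_grid.
Qed.

Lemma integrable_oneDsqr (a c : R) : (0 <= a)%R -> (0 <= c)%R ->
  mu.-integrable `]a, +oo[ (fun u : R => (c * (1 + u ^+ 2)^-1)%:E).
Proof.
move=> a0 c0.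
have m1 : measurable_fun setT (fun u : R => (c * (1 + u ^+ 2)^-1)%:E).
  apply/measurable_EFinP; apply: measurable_funM => //.
  apply: (@measurableT_comp _ _ _ _ _ _ (fun x : R => x^-1)%R); first exact: measurable_inv.
  by apply: measurable_funD => //; exact: measurable_funX.
have p0 (u : R) : 0 <= (c * (1 + u ^+ 2)^-1)%:E by rewrite lee_fin mulr_ge0// invr_ge0 addr_ge0// sqr_ge0.
apply/integrableP; split; first exact: measurable_funTS.
under eq_integral do rewrite gee0_abs//.
apply: (@le_lt_trans _ _ (\int[mu]_(u in `[0%R, +oo[) (c * (1 + u ^+ 2)^-1)%:E)).
  apply: ge0_subset_integral => //; first exact: measurable_funTS.
  by apply: subset_itvr; rewrite bnd_simp.
under eq_integral do rewrite EFinM.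
rewrite ge0_integralZl//.
- by have := @integral0y_oneDsqr R; rewrite /oneDsqr => ->; rewrite -EFinM ltry.
- apply: measurable_funTS; apply/measurable_EFinP.
  apply: (@measurableT_comp _ _ _ _ _ _ (fun x : R => x^-1)%R); first exact: measurable_inv.
  by apply: measurable_funD => //; exact: measurable_funX.
- by move=> u _; rewrite lee_fin invr_ge0 addr_ge0// sqr_ge0.
Qed.

Section along_sequence.
Variable b_ : nat -> R.
Hypotheses (b_y : b_ j @[j --> \oo] --> +oo%R) (b0 : forall j, (0 < b_ j)%R).

Let C_ex := mean_kern_le st iidLL.

Lemma grid_index_cvg y : (0 < y)%R ->
  [/\ (grid_index (b_ j) y).+1 @[j --> \oo] --> \oo,
   (\forall j \near \oo, (0 < grid_index (b_ j) y)%N) ,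
   (2 * b_ j / (grid_index (b_ j) y)%:R @[j --> \oo] --> y ^+ 2)%R &
   ((grid_index (b_ j) y).+1%:R / b_ j @[j --> \oo] --> 2 / y ^+ 2)%R].
Proof.
move=> y0; have y20 : (0 < y ^+ 2)%R by rewrite exprn_gt0.
have bge (A : R) : \forall j \near \oo, (A <= b_ j)%R by move/cvgryPge : b_y; exact.
pose k j := grid_index (b_ j) y.
have kitv j : ((k j)%:R <= 2 * b_ j / y ^+ 2 < (k j).+1%:R)%R.
  by apply: truncn_itv; rewrite divr_ge0 ?(ltW y20)// mulr_ge0// ltW.
have kge m : \forall j \near \oo, (m <= k j)%N.
  apply: filterS (bge (y ^+ 2 * m%:R)%R) => j mb.
  rewrite truncn_ge_nat; last by rewrite divr_ge0 ?(ltW y20)// mulr_ge0// ltW.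
  rewrite ler_pdivlMr// mulrC (le_trans mb)//.
  by rewrite ler_peMl ?(ltW (b0 j))// ler1n.
have binv : ((b_ j)^-1 @[j --> \oo] --> 0)%R.
  by apply/gtr0_cvgV0; [exact: nearW|exact: b_y].
have ratio : ((k j).+1%:R / b_ j @[j --> \oo] --> 2 / y ^+ 2)%R.
  apply: (@squeeze_cvgr _ _ _ _ (fun=> 2 / y ^+ 2)%R (fun j => 2 / y ^+ 2 + (b_ j)^-1)%R).
  - apply: nearW => j; have /andP[k1 k2] := kitv j; have bj := b0 j.
    rewrite ler_pdivlMr// mulrAC (ltW k2)/= ler_pdivrMr// mulrDl mulVf ?gt_eqF//.
    by rewrite -natr1 lerD2r mulrAC.
  - exact: cvg_cst.
  - by rewrite -[X in _ --> X]addr0; apply: cvgD; [exact: cvg_cst|exact: binv].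
split.
- by apply/cvgnyPge => m; apply: filterS (kge m) => j; exact: leqW.
- exact: kge.
- have c1 : (2 * ((k j).+1%:R / b_ j)^-1 @[j --> \oo] --> 2 * (2 / y ^+ 2)^-1)%R.
    by apply: cvgMr; apply: cvgV => //; rewrite gt_eqF// divr_gt0.
  have c2 : (2 * b_ j / (k j)%:R @[j --> \oo] --> 2 * (2 / y ^+ 2 - 0)^-1)%R.
    have c3 : (2 * ((k j).+1%:R / b_ j - (b_ j)^-1)^-1 @[j --> \oo] --> 2 * (2 / y ^+ 2 - 0)^-1)%R.
      by apply: cvgMr; apply: cvgV; [rewrite subr0 gt_eqF// divr_gt0|exact: cvgB].
    apply: cvg_trans c3; apply: near_eq_cvg; apply: nearW => j.
    rewrite (_ : (k j).+1%:R / b_ j - (b_ j)^-1 = (k j)%:R / b_ j)%R; last by rewrite -natr1; ring.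
    by rewrite invfM invrK; ring.
  by move: c2; rewrite subr0 invfM invrK mulrA divff ?mul1r.
- exact: ratio.
Qed.

(** As [grid_index] is asymptotic to 2 b / y^2, the kernels converge at each u; [mean_kern_le]
    dominates them. *)
Lemma kern_term_cvg y : (0 < y)%R -> kern_term (b_ j) (grid_index (b_ j) y) @[j --> \oo] --> limit_term y.
Proof.
move=> y0; have [ny kpos by_ ratio] := grid_index_cvg y0.
have [C C0 hC] := C_ex.
have mJ : measurable (`]0%R, +oo[%classic : set R) by [].
pose f j u : \bar R := if grid_index (b_ j) y == 0%N then 0 else
  (mean_kern s t LL K (grid_index (b_ j) y).+1 (b_ j) 1 u +
   mean_kern s t LL K (grid_index (b_ j) y).+1 (b_ j) (-1) u) * (g u)%:E.
have C20 : (0 <= C + C)%R by rewrite addr_ge0.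
have fle j u : (0 < u)%R -> f j u <= ((C + C) * (1 + u ^+ 2)^-1)%:E.
  move=> u0; rewrite /f; case: ifPn => [_|kj].
    by rewrite lee_fin mulr_ge0// invr_ge0 addr_ge0// sqr_ge0.
  have hm sg : mean_kern s t LL K (grid_index (b_ j) y).+1 (b_ j) sg u <= (C * (1 + u ^+ 2)^-1)%:E.
    by apply: hC => //; rewrite ltnS lt0n.
  rewrite mulrDl EFinD; apply: (@le_trans _ _ ((mean_kern s t LL K (grid_index (b_ j) y).+1 (b_ j) 1 u +
   mean_kern s t LL K (grid_index (b_ j) y).+1 (b_ j) (-1) u) * 1)).
    apply: lee_wpmul2l; first by rewrite adde_ge0// mean_kern_ge0.
    by rewrite lee_fin; case/andP: (g01 u).
  by rewrite mule1; apply: leeD.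
have f0 j u : 0 <= f j u.
  rewrite /f; case: ifP => // _.
  by rewrite mule_ge0 ?lee_fin// adde_ge0// mean_kern_ge0.
have fc : \int[mu]_(u in `]0%R, +oo[) f j u @[j --> \oo] --> \int[mu]_(u in `]0%R, +oo[)
    (((limit_pdf (1 * y))%:E * LL [set w | walk_above K (1 * y) w u] +
      (limit_pdf (-1 * y))%:E * LL [set w | walk_above K (-1 * y) w u]) * (g u)%:E).
  apply: (@ge0_dominated_cvg R _ _ mu _ f _ (fun u => ((C + C) * (1 + u ^+ 2)^-1)%:E) mJ).
  - move=> j; apply: measurable_funTS; rewrite /f; have [e|e] := boolP (grid_index (b_ j) y == 0%N); first by [].
    apply: emeasurable_funM; last exact/measurable_EFinP.
    by apply: emeasurable_funD; exact: measurable_mean_kern.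
  - by move=> j u _.
  - by move=> j u; rewrite /= in_itv/= andbT; exact: fle.
  - exact: integrable_oneDsqr.
  - move=> u _.
    have n1 : (1 != 0 :> R)%R by rewrite oner_eq0.
    have m1 : (-1 != 0 :> R)%R by rewrite oppr_eq0 oner_eq0.
    have c1 := @mean_kern_cvg _ LL iidLL s t st K _ _ y 1 u ny y0 n1 by_.
    have c2 := @mean_kern_cvg _ LL iidLL s t st K _ _ y (-1) u ny y0 m1 by_.
    have mW sg : LL [set w | walk_above K (sg * y) w u] \is a fin_num.
      by rewrite fin_num_measure//; exact: measurable_walk_above.
    have c3 : (mean_kern s t LL K (grid_index (b_ j) y).+1 (b_ j) 1 u +
     mean_kern s t LL K (grid_index (b_ j) y).+1 (b_ j) (-1) u) * (g u)%:E @[j --> \oo] -->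
     ((limit_pdf (1 * y))%:E * LL [set w | walk_above K (1 * y) w u] +
      (limit_pdf (-1 * y))%:E * LL [set w | walk_above K (-1 * y) w u]) * (g u)%:E.
      apply: cvgeZr => //; apply: cvgeD => //; rewrite fin_num_adde_defl//.
      by rewrite fin_numM.
    apply: cvg_trans c3; apply: near_eq_cvg; near=> j.
    have kj : (0 < grid_index (b_ j) y)%N by near: j.
    by rewrite /f gtn_eqF.
rewrite /limit_term.
have c4 : ((grid_index (b_ j) y).+1%:R / b_ j)%:E * \int[mu]_(u in `]0%R, +oo[) f j u @[j --> \oo] -->
   (2 / y ^+ 2)%:E * \int[mu]_(u in `]0%R, +oo[)
    (((limit_pdf (1 * y))%:E * LL [set w | walk_above K (1 * y) w u] +
      (limit_pdf (-1 * y))%:E * LL [set w | walk_above K (-1 * y) w u]) * (g u)%:E).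
  have rE : ((grid_index (b_ j) y).+1%:R / b_ j)%:E @[j --> \oo] --> (2 / y ^+ 2)%:E.
    by apply: cvg_EFin; [exact: nearW|exact: ratio].
  have fin : \int[mu]_(u in `]0%R, +oo[)
    (((limit_pdf (1 * y))%:E * LL [set w | walk_above K (1 * y) w u] +
      (limit_pdf (-1 * y))%:E * LL [set w | walk_above K (-1 * y) w u]) * (g u)%:E) \is a fin_num.
    rewrite ge0_fin_numE; last by apply: integral_ge0 => u _; rewrite !mule_ge0 ?adde_ge0 ?mule_ge0 ?lee_fin ?measure_ge0 ?limit_pdf_ge0.
    apply: (@le_lt_trans _ _ (\int[mu]_(u in `]0%R, +oo[) ((C + C) * (1 + u ^+ 2)^-1)%:E)).
      rewrite -(cvg_lim _ fc)//; apply: lime_le; first by apply/cvg_ex; eexists; exact: fc.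
      apply: nearW => j; apply: ge0_le_integral => //.
      - rewrite /f; apply: measurable_funTS; have [e|e] := boolP (grid_index (b_ j) y == 0%N); first by [].
        apply: emeasurable_funM; last exact/measurable_EFinP.
        by apply: emeasurable_funD; exact: measurable_mean_kern.
      - by case/integrableP: (integrable_oneDsqr (lexx 0%R) C20).
      - by move=> u; rewrite /= in_itv/= andbT; exact: fle.
    by rewrite -ge0_fin_numE ?(integrable_fin_num _ (integrable_oneDsqr (lexx 0%R) C20))//; apply: integral_ge0 => u _; rewrite lee_fin mulr_ge0 ?invr_ge0 ?addr_ge0 ?sqr_ge0.
  by apply: cvgeM => //; rewrite mule_def_fin.
apply: cvg_trans c4; apply: near_eq_cvg; near=> j.
rewrite /kern_term /f; have kj : (0 < grid_index (b_ j) y)%N by near: j.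
by rewrite gtn_eqF.
Unshelve. all: by end_near.
Qed.

(** For k >= 1 one has k + 1 <= 2 k <= 4 b / y^2, and y > dl gives 1/y^2 <= (1 + 1/dl^2)/(1 + y^2);
    the integral over u is bounded through [mean_kern_le]. *)
Lemma kern_term_le : exists2 C : R, (0 <= C)%R & forall j y, (dl < y)%R ->
  kern_term (b_ j) (grid_index (b_ j) y) <= (C * (1 + y ^+ 2)^-1)%:E.
Proof.
have [C C0 hC] := C_ex.
have Iint := integrable_oneDsqr (lexx 0%R) (addr_ge0 C0 C0).
pose I := \int[mu]_(u in `]0%R, +oo[) ((C + C) * (1 + u ^+ 2)^-1)%:E.
have I0 : 0 <= I.
  by apply: integral_ge0 => u _; rewrite lee_fin mulr_ge0 ?addr_ge0// invr_ge0 addr_ge0// sqr_ge0.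
have Ifin : I \is a fin_num by apply: integrable_fin_num.
exists (4 * (1 + (dl ^+ 2)^-1) * fine I)%R.
  by rewrite !mulr_ge0 ?addr_ge0 ?invr_ge0 ?sqr_ge0 ?fine_ge0.
move=> j y dy; have y0 : (0 < y)%R by exact: lt_trans dy.
rewrite /kern_term; case: ifPn => [_|k0].
  by rewrite lee_fin !mulr_ge0 ?addr_ge0 ?invr_ge0 ?addr_ge0 ?sqr_ge0 ?fine_ge0.
have y20 : (0 < y ^+ 2)%R by rewrite exprn_gt0.
have dl2 : (0 < dl ^+ 2)%R by rewrite exprn_gt0.
have -> : (4 * (1 + (dl ^+ 2)^-1) * fine I / (1 + y ^+ 2))%:E = (4 * (1 + (dl ^+ 2)^-1) * (1 + y ^+ 2)^-1)%:E * I.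
  by rewrite -[X in _ * X](fineK Ifin) -EFinM; congr _%:E; ring.
apply: lee_pmul.
- by rewrite lee_fin divr_ge0// ltW.
- by apply: integral_ge0 => u _; rewrite mule_ge0 ?lee_fin// adde_ge0// mean_kern_ge0.
- rewrite lee_fin.
  have k1 : ((grid_index (b_ j) y)%:R <= 2 * b_ j / y ^+ 2)%R.
    by have /andP[] : ((grid_index (b_ j) y)%:R <= 2 * b_ j / y ^+ 2 < (grid_index (b_ j) y).+1%:R)%R
      by apply: truncn_itv; rewrite divr_ge0 ?(ltW y20)// mulr_ge0// ltW.
  have k2 : ((grid_index (b_ j) y).+1%:R <= 2 * (2 * b_ j / y ^+ 2))%R.
    rewrite -lt0n in k0; apply: (@le_trans _ _ (2 * (grid_index (b_ j) y)%:R)%R); last by rewrite ler_wpM2l.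
    by rewrite -natrM ler_nat mulSn mul1n -[X in (X <= _)%N]addn1 leq_add2l.
  rewrite ler_pdivrMr//; apply: (le_trans k2).
  have dy2 : (dl ^+ 2 <= y ^+ 2)%R by rewrite lerXn2r ?nnegrE ?(ltW y0) ?(ltW d0) ?(ltW dy).
  have y21 : (0 < 1 + y ^+ 2)%R by rewrite addr_gt0.
  rewrite (_ : 2 * (2 * b_ j / y ^+ 2) = 4 * b_ j * (y ^+ 2)^-1)%R; last by ring.
  rewrite (_ : 4 * (1 + (dl ^+ 2)^-1) / (1 + y ^+ 2) * b_ j = 4 * b_ j * ((1 + (dl ^+ 2)^-1) / (1 + y ^+ 2)))%R; last by ring.
  rewrite ler_wpM2l ?mulr_ge0 ?(ltW (b0 j))// ler_pdivlMr// mulrDr mulr1 mulVf ?gt_eqF// addrC lerD2l.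
  by rewrite lef_pV2 ?posrE.
apply: ge0_le_integral => //.
- by move=> u _; rewrite mule_ge0 ?lee_fin// adde_ge0// mean_kern_ge0.
- apply: measurable_funTS; apply: emeasurable_funM; last exact/measurable_EFinP.
  by apply: emeasurable_funD; exact: measurable_mean_kern.
- by case/integrableP: Iint.
move=> u; rewrite /= in_itv/= andbT => u0.
have hm sg : mean_kern s t LL K (grid_index (b_ j) y).+1 (b_ j) sg u <= (C * (1 + u ^+ 2)^-1)%:E.
  by apply: hC => //; rewrite ltnS lt0n.
rewrite mulrDl EFinD; apply: (@le_trans _ _ ((mean_kern s t LL K (grid_index (b_ j) y).+1 (b_ j) 1 u +
   mean_kern s t LL K (grid_index (b_ j) y).+1 (b_ j) (-1) u) * 1)).
  apply: lee_wpmul2l; first by rewrite adde_ge0// mean_kern_ge0.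
  by rewrite lee_fin; case/andP: (g01 u).
by rewrite mule1; apply: leeD.
Qed.

Lemma kern_integral_cvg :
  \int[mu]_(y in `]dl, +oo[) kern_term (b_ j) (grid_index (b_ j) y) @[j --> \oo] -->
  \int[mu]_(y in `]dl, +oo[) limit_term y.
Proof.
have [C C0 hC] := kern_term_le.
have mD : measurable (`]dl, +oo[%classic : set R) by [].
apply: (@ge0_dominated_cvg R _ _ mu `]dl, +oo[%classic (fun j y => kern_term (b_ j) (grid_index (b_ j) y)) limit_term (fun y => (C * (1 + y ^+ 2)^-1)%:E) mD).
- by move=> j; apply: measurable_funTS; exact: measurable_grid_index.
- by move=> j y _; exact: kern_term_ge0.
- by move=> j y; rewrite /= in_itv/= andbT => /hC.
- by apply: integrable_oneDsqr => //; exact: ltW.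
- by move=> y; rewrite /= in_itv/= andbT => /(lt_trans d0); exact: kern_term_cvg.
Qed.

End along_sequence.

End grid_limit.

(** * Spitzer's identity and ladder variables *)

Section cons_path.
Context (R : realType).
Local Notation N01 := (normal_prob 0 1 : probability (measurableTypeR R) R).
Local Notation sample_path := (sample_path R).
Variable LL : probability sample_path R.
Hypothesis iidLL : iid_map LL idfun.
Local Open Scope ereal_scope.

Definition cons_path (z : R) (x : sample_path) : sample_path := fun i => if i is i'.+1 then x i' else z.

Definition tail_path (x : sample_path) : sample_path := fun i => x i.+1.

Lemma measurable_tail_path : measurable_fun setT tail_path.
Proof. by apply: measurable_path => i; exact: measurable_coord. Qed.

Lemma measurable_cons_path : measurable_fun setT (fun p : R * sample_path => cons_path p.1 p.2).
Proof.
apply: measurable_path => -[|i]; first exact: measurable_fst.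
by apply: (measurableT_comp (measurable_coord i)); exact: measurable_snd.
Qed.

Lemma integral_cons (F : sample_path -> \bar R) :
  measurable_fun setT F -> (forall x, 0 <= F x) ->
  \int[LL]_x F x = \int[N01]_z \int[LL]_x F (cons_path z x).
Proof.
move=> mF F0.
pose s (i : nat) : nat + nat := if i is i'.+1 then inl i' else inr 0%N.
have sI : injective s by case=> [|i] [|j] //= [->].
have mFc : measurable_fun setT (fun p : R * sample_path => F (cons_path p.1 p.2)).
  exact: (measurableT_comp mF measurable_cons_path).
rewrite (integral_mix iidLL sI)//.
rewrite (@fubini_tonelli _ _ _ _ _ N01 LL (fun p => F (cons_path p.1 p.2)))//=.
apply: eq_integral => x _.
have mz : measurable_fun setT (fun z : R => F (cons_path z x)).
  have mp : measurable_fun setT (fun z : R => (z, x)) by exact: measurable_pair2.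
  exact: (measurableT_comp mFc mp).
rewrite -(@integral_coord _ LL iidLL 0 (fun z => F (cons_path z x)))//.
apply: eq_integral => y _; congr F; apply/funext => i.
by rewrite /mix /s; case: i.
Qed.

Lemma integral_swap01 (F : sample_path -> \bar R) :
  measurable_fun setT F -> (forall x, 0 <= F x) ->
  \int[LL]_x F x = \int[LL]_x F (cons_path (x 1%N) (cons_path (x 0%N) (tail_path (tail_path x)))).
Proof.
move=> mF F0.
pose s (i : nat) : nat := match i with 0 => 1 | 1 => 0 | j => j end%N.
have sI : injective s by case=> [|[|i]] [|[|j]].
rewrite (integral_perm iidLL sI)//; apply: eq_integral => x _; congr F.
by apply/funext => -[|[|i]].
Qed.

(** Two normal coordinates are merged into one and the path is renumbered; this is how one more
    increment is added to S_k below. *)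
Lemma integral_merge01 (al be : R) (F : R -> sample_path -> \bar R) :
  measurable_fun setT (fun p : R * sample_path => F p.1 p.2) -> (forall v x, 0 <= F v x) ->
  \int[LL]_x F (al * x 0%N + be * x 1%N)%R (tail_path (tail_path x)) =
  \int[LL]_x F (Num.sqrt (al ^+ 2 + be ^+ 2) * x 0%N)%R (tail_path x).
Proof.
move=> mF F0.
have mT d (T : measurableType d) (f : T -> R) (h : T -> sample_path) :
    measurable_fun setT f -> measurable_fun setT h -> measurable_fun setT (fun x => F (f x) (h x)).
  move=> mf mh; have mp : measurable_fun setT (fun x => (f x, h x)) by exact: measurable_fun_pair.
  exact: (measurableT_comp mF mp).
have mt := measurable_tail_path; have mc i := @measurable_coord R i.
have mtt : measurable_fun setT (fun x => tail_path (tail_path x)) by exact: measurableT_comp.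
rewrite integral_cons; last 2 first.
- apply: mT => //; apply: measurable_funD; exact: measurable_funM.
- by [].
rewrite [RHS]integral_cons; last 2 first.
- by apply: mT => //; exact: measurable_funM.
- by [].
rewrite /=.
have m1 : measurable_fun setT (fun v : R => \int[LL]_x F v x).
  by apply: (@measurable_fun_fubini_tonelli_F _ _ _ _ _ LL (fun p : R * sample_path => F p.1 p.2)).
have i0 v : 0 <= \int[LL]_x F v x by apply: integral_ge0.
rewrite -(integral_N01_add al be m1 i0).
apply: eq_integral => z _.
rewrite integral_cons; last 2 first.
- apply: mT => //; apply: measurable_funD => //; exact: measurable_funM.
- by [].
by [].
Qed.

End cons_path.

(** * Spitzer's identity *)

Section spitzer.
Context (R : realType).
Local Notation N01 := (normal_prob 0 1 : probability (measurableTypeR R) R).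
Local Notation sample_path := (sample_path R).
Variable LL : probability sample_path R.
Hypothesis iidLL : iid_map LL idfun.
Variable y : R.
Local Open Scope ereal_scope.

Definition step (z : R) : R := (y * z + y ^+ 2 / 2)%R.

(* min_{0 <= k <= n} S_k for the walk S with increments [step]. *)
Fixpoint run_min n (w : sample_path) : R :=
  (if n is n'.+1 then Num.min 0 (step (w 0%N) + run_min n' (tail_path w)) else 0)%R.

Lemma measurable_step : measurable_fun setT step.
Proof. by apply: measurable_funD => //; exact: measurable_funM. Qed.

Lemma measurable_run_min n : measurable_fun setT (run_min n).
Proof.
elim: n => [|n IH] /=; first exact: measurable_cst.
apply: measurable_minr => //; apply: measurable_funD.
  exact: (measurableT_comp measurable_step (@measurable_coord R 0)).
exact: (measurableT_comp IH (@measurable_tail_path R)).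
Qed.

(* S_k in terms of a single standard normal variable. *)
Definition walk_law k (z : R) : R := (Num.sqrt (k%:R * y ^+ 2) * z + k%:R * (y ^+ 2 / 2))%R.

Lemma measurable_walk_law k : measurable_fun setT (walk_law k).
Proof. by apply: measurable_funD => //; exact: measurable_funM. Qed.

(** A term of Spitzer's sum: E h(min(0, S_k) + M), with M the running minimum over [m] steps of an
    independent walk. *)
Definition split_min k m (h : R -> R) : \bar R :=
  \int[LL]_x (h (Num.min 0 (walk_law k (x 0%N)) + run_min m (tail_path x)))%R%:E.

Let mid k m (h : R -> R) : \bar R :=
  \int[LL]_x (h (Num.min 0 (walk_law k (x 0%N) + run_min m (tail_path x))))%R%:E.

Let P0 (a : R) : R := Num.min 0%R a.

(* Summed over exchanges of increments, this identity telescopes into Spitzer's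
   identity. *)
Lemma rota_baxter (h : R -> R) (a b : R) :
  (h (P0 a + P0 b) + h (P0 (a + b)) = h (P0 (a + P0 b)) + h (P0 (b + P0 a)))%R.
Proof.
rewrite /P0; have [a0|a0] := leP 0%R a; have [b0|b0] := leP 0%R b; rewrite ?addr0 ?add0r.
- by rewrite !min_l ?addr_ge0.
- by rewrite (min_r (ltW b0)) [RHS]addrC.
- by rewrite (min_r (ltW a0)) [(b + a)%R]addrC.
- by rewrite [(b + a)%R]addrC min_r// ltW// -(addr0 0%R) ltrD.
Qed.

(** Induction on [n] for all [h] at once: fixing one increment z turns [h] into [hz z], to which the
    hypothesis applies. When [rota_baxter] is summed with a = S_k and b the next increment plus a
    later minimum, the terms [mid] telescope; the remaining [mid 1 n] is the expectation of the left
    side once more and raises the factor n to n + 1. *)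
Lemma spitzer_identity n (h : R -> R) : measurable_fun setT h -> (forall x, 0 <= h x)%R ->
  n%:R%:E * \int[LL]_w (h (run_min n w))%:E = \sum_(k < n) split_min k.+1 (n - k.+1) h.
Proof.
elim: n h => [|n IH] h mh h0; first by rewrite mul0e big_ord0.
have mc i := @measurable_coord R i; have mt := @measurable_tail_path R.
have mtt : measurable_fun setT (fun x : sample_path => tail_path (tail_path x)) by exact: measurableT_comp.
have mrt m : measurable_fun setT (fun x : sample_path => run_min m (tail_path x)).
  by apply: (measurableT_comp (measurable_run_min m)).
have mrtt m : measurable_fun setT (fun x : sample_path => run_min m (tail_path (tail_path x))).
  by apply: (measurableT_comp (measurable_run_min m)).
have mw k i : measurable_fun setT (fun x : sample_path => walk_law k (x i)).
  exact: (measurableT_comp (measurable_walk_law k)).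
have msx i : measurable_fun setT (fun x : sample_path => step (x i)).
  exact: (measurableT_comp measurable_step).
have mP0 d (T : measurableType d) (f : T -> R) : measurable_fun setT f -> measurable_fun setT (fun x => P0 (f x)).
  by move=> mf; apply: measurable_minr.
have mhE d (T : measurableType d) (f : T -> R) : measurable_fun setT f -> measurable_fun setT (fun x => (h (f x))%:E).
  by move=> mf; apply/measurable_EFinP; exact: measurableT_comp.
have hE0 x : 0 <= (h x)%:E by rewrite lee_fin.
pose rm m (x : sample_path) := run_min m (tail_path (tail_path x)).
have mrm m : measurable_fun setT (rm m) := mrtt m.
pose X k m := \int[LL]_x (h (P0 (step (x 1%N) + rm m x + P0 (walk_law k (x 0%N)))))%R%:E.
(* S_{k+1} is resolved into S_k and one separate increment. *)
have midS k m : mid k.+1 m h = \int[LL]_x (h (P0 (walk_law k (x 0%N) + (step (x 1%N) + rm m x))))%R%:E.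
  pose F (v : R) x := (h (P0 (v + k.+1%:R * (y ^+ 2 / 2) + run_min m x)))%R%:E.
  have mF : measurable_fun setT (fun p : R * sample_path => F p.1 p.2).
    apply: mhE; apply: (mP0 _ _ _); apply: measurable_funD; last exact: (measurableT_comp (measurable_run_min m)).
    by apply: measurable_funD => //; exact: measurable_fst.
  have F0 v x : 0 <= F v x by exact: hE0.
  transitivity (\int[LL]_x F (Num.sqrt (k%:R * y ^+ 2) * x 0%N + y * x 1%N)%R (tail_path (tail_path x))).
    rewrite (integral_merge01 iidLL _ _ mF F0); apply: eq_integral => x _.
    rewrite /F /walk_law sqr_sqrtr; last by rewrite mulr_ge0// sqr_ge0.
    by have -> : (k%:R * y ^+ 2 + y ^+ 2 = k.+1%:R * y ^+ 2)%R by rewrite -natr1 mulrDl mul1r.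
  apply: eq_integral => x _; rewrite /F /walk_law /step -natr1; congr (h (P0 _))%:E; rewrite /rm; ring.
have rb k m : split_min k m.+1 h + mid k.+1 m h = mid k m.+1 h + X k m.
  rewrite midS /split_min /mid /X -!ge0_integralD//; last 4 first.
  - apply: mhE; apply: (mP0 _ _ _); apply: measurable_funD => //; exact: (mrt m.+1).
  - apply: mhE; apply: (mP0 _ _ _); apply: measurable_funD; last exact: mP0.
    by apply: measurable_funD.
  - apply: mhE; apply: measurable_funD; [exact: mP0|exact: (mrt m.+1)].
  - apply: mhE; apply: (mP0 _ _ _); apply: measurable_funD => //; exact: measurable_funD.
  apply: eq_integral => x _; rewrite -!EFinD; congr _%:E.
  exact: (rota_baxter h (walk_law k (x 0%N)) (step (x 1%N) + rm m x)%R).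
pose hz (z v : R) : R := h (P0 (step z + v)).
have mhz z : measurable_fun setT (hz z).
  by apply: measurableT_comp => //; apply: (mP0 _ _ _); exact: measurable_funD.
(* The first two coordinates are exchanged, so that the increment comes first and can be fixed. *)
have XE k m : X k m = \int[N01]_z split_min k m (hz z).
  rewrite /X (integral_swap01 iidLL)//; last first.
    apply: mhE; apply: (mP0 _ _ _); apply: measurable_funD; last exact: mP0.
    by apply: measurable_funD.
  pose F (x : sample_path) := (h (P0 (step (x 0%N) + rm m x + P0 (walk_law k (x 1%N)))))%R%:E.
  have mF : measurable_fun setT F.
    apply: mhE; apply: (mP0 _ _ _); apply: measurable_funD; last exact: mP0.
    by apply: measurable_funD.
  have F0 x : 0 <= F x by exact: hE0.
  transitivity (\int[LL]_x F x); first by apply: eq_integral.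
  rewrite (integral_cons iidLL mF F0).
  apply: eq_integral => z _; apply: eq_integral => x _; rewrite /F /hz /rm /=.
  by congr (h (P0 _))%:E; rewrite -addrA [(_ + P0 _)%R]addrC.
have USE : \int[LL]_w (h (run_min n.+1 w))%:E = \int[N01]_z \int[LL]_w (hz z (run_min n w))%:E.
  rewrite (integral_cons iidLL)//.
  by apply: mhE; exact: measurable_run_min.
have nU : n%:R%:E * \int[LL]_w (h (run_min n.+1 w))%:E = \sum_(k < n) X k.+1 (n - k.+1)%N.
  rewrite USE -ge0_integralZl//; last 2 first.
  - apply: (@measurable_fun_fubini_tonelli_F _ _ _ _ _ LL (fun p : R * sample_path => (hz p.1 (run_min n p.2))%:E)).
      apply: mhE; apply: (mP0 _ _ _); apply: measurable_funD; first exact: (measurableT_comp measurable_step).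
      exact: (measurableT_comp (measurable_run_min n)).
    by move=> p; rewrite lee_fin h0.
  - by move=> z _; apply: integral_ge0 => w _; rewrite lee_fin h0.
  transitivity (\int[N01]_z \sum_(k < n) split_min k.+1 (n - k.+1) (hz z)).
    by apply: eq_integral => z _; rewrite IH// => v; rewrite h0.
  rewrite ge0_integral_sum//; last 2 first.
  - move=> k.
    apply: (@measurable_fun_fubini_tonelli_F _ _ _ _ _ LL (fun p : R * sample_path => (hz p.1 (P0 (walk_law k.+1 (p.2 0%N)) + run_min (n - k.+1) (tail_path p.2))%R)%:E)).
      apply: mhE; apply: (mP0 _ _ _); apply: measurable_funD; first exact: (measurableT_comp measurable_step).
      apply: measurable_funD; last by apply: (measurableT_comp (mrt (n - k.+1)%N)); exact: measurable_snd.
      apply: (mP0 _ _ _); apply: (measurableT_comp (mw k.+1 0%N)); exact: measurable_snd.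
    by move=> p; rewrite lee_fin h0.
  - by move=> k z _; apply: integral_ge0 => w _; rewrite lee_fin h0.
  by apply: eq_bigr => k _; exact/esym/XE.
have tel j : (j <= n)%N -> \sum_(k < j) split_min k.+1 (n.+1 - k.+1) h + mid j.+1 (n - j) h =
    \sum_(k < j) X k.+1 (n - k.+1)%N + mid 1 n h.
  elim: j => [|j IHj] jn; first by rewrite !big_ord0 !add0e subn0.
  rewrite !big_ord_recr/= -addeA subSS.
  have e : (n - j = (n - j.+1).+1)%N by lia.
  rewrite [in split_min _ _ _]e rb -e addeA IHj; last exact: ltnW.
  by rewrite addeAC.
have mid1 : mid 1 n h = \int[LL]_w (h (run_min n.+1 w))%:E.
  pose F (x : sample_path) := (h (P0 (walk_law 0 (x 0%N) + (step (x 1%N) + rm n x))))%R%:E.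
  have mF : measurable_fun setT F.
    by apply: mhE; apply: (mP0 _ _ _); apply: measurable_funD => //; exact: measurable_funD.
  have F0 x : 0 <= F x by exact: hE0.
  rewrite midS; transitivity (\int[LL]_x F x); first by [].
  rewrite (integral_cons iidLL mF F0).
  rewrite -[RHS](integral_prob_cst N01); apply: eq_integral => z _; apply: eq_integral => x _.
  by rewrite /F /= /walk_law /rm !mul0r sqrtr0 mul0r !add0r.
have := tel n (leqnn n); rewrite subnn -nU mid1.
have -> : mid n.+1 0 h = split_min n.+1 (n.+1 - n.+1) h.
  by rewrite subnn /mid /split_min; apply: eq_integral => x _; rewrite /= !addr0.
rewrite big_ord_recr/= => ->.
by rewrite -natr1 EFinD ge0_muleDl ?lee_fin// mul1e.
Qed.

End spitzer.

(** * The minimum of the drifting walk *)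

Section ladder.
Context (R : realType).
Local Notation N01 := (normal_prob 0 1 : probability (measurableTypeR R) R).
Local Notation sample_path := (sample_path R).
Variable LL : probability sample_path R.
Hypothesis iidLL : iid_map LL idfun.
Variable y : R.
Hypothesis y0 : y != 0%R.
Local Open Scope ereal_scope.
Local Notation step := (step y).
Local Notation run_min := (run_min y).
Local Notation walk_law := (walk_law y).

Let mE (f : R -> R) : measurable_fun setT f -> measurable_fun setT (fun z => (expR (f z))%:E).
Proof. by move=> mf; apply/measurable_EFinP; exact: measurableT_comp. Qed.

Lemma N01_exp_mart (m : R) : \int[N01]_z (expR (- (m * z + m ^+ 2 / 2)))%:E = 1.
Proof.
have := @N01_shift R m (cst 1) (@measurable_cst _ _ _ _ _ _) (fun=> @lee01 R).
rewrite integral_prob_cst => ->; apply: eq_integral => z _.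
by rewrite mul1e.
Qed.

Lemma N01_exp_half_mart (m : R) :
  \int[N01]_z (expR (- ((m * z + m ^+ 2 / 2) / 2)))%:E = (expR (- (m ^+ 2 / 8)))%:E.
Proof.
transitivity (\int[N01]_z ((expR (- (m ^+ 2 / 8)))%:E * (expR (- (m / 2 * z + (m / 2) ^+ 2 / 2)))%:E)).
  by apply: eq_integral => z _; rewrite -EFinM -expRD; congr (expR _)%:E; field.
rewrite ge0_integralZl//; first by rewrite N01_exp_mart mule1.
- apply: (mE (f := fun z => (- (m / 2 * z + (m / 2) ^+ 2 / 2))%R)).
  by apply: measurableT_comp => //; apply: measurable_funD => //; exact: measurable_funM.
Qed.

Lemma integral_cons_prod (f : R -> R) (h : sample_path -> R) :
  measurable_fun setT f -> (forall z, 0 <= f z)%R ->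
  measurable_fun setT h -> (forall w, 0 <= h w)%R ->
  \int[LL]_w (f (w 0%N) * h (tail_path w))%R%:E = (\int[N01]_z (f z)%:E) * (\int[LL]_w (h w)%:E).
Proof.
move=> mf f0 mh h0.
have mfh : measurable_fun setT (fun w : sample_path => (f (w 0%N) * h (tail_path w))%R%:E).
  apply/measurable_EFinP; apply: measurable_funM.
    exact: (measurableT_comp mf (@measurable_coord R 0)).
  exact: (measurableT_comp mh (@measurable_tail_path R)).
have I0 : 0 <= \int[LL]_w (h w)%:E by apply: integral_ge0 => w _; rewrite lee_fin.
rewrite (integral_cons iidLL mfh); last by move=> w; rewrite lee_fin mulr_ge0.
rewrite -ge0_integralZr//; last 2 first.
- exact/measurable_EFinP.
- by move=> z _; rewrite lee_fin.
apply: eq_integral => z _; rewrite -ge0_integralZl//.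
- exact/measurable_EFinP.
- by move=> w _; rewrite lee_fin.
- by rewrite lee_fin.
Qed.

Definition exp_run_min n : \bar R := \int[LL]_w (expR (- run_min n w))%:E.

Let mrm n : measurable_fun setT (run_min n). Proof. exact: measurable_run_min. Qed.

Lemma run_min_le0 n w : (run_min n w <= 0)%R.
Proof. by case: n => [|n] /=; rewrite ?ge_min lexx. Qed.

Lemma run_min_nincr n w : (run_min n.+1 w <= run_min n w)%R.
Proof.
elim: n w => [|n IH] w; first exact: run_min_le0.
rewrite [leLHS]/= [leRHS]/= le_min ge_min lexx/= ge_min lerD2l.
by have := IH (tail_path w); rewrite /= => ->; rewrite orbT.
Qed.

(** The minimum of S_1, ..., S_{n+1}; its minimum with 0 is [run_min n.+1], and it alone decides
    [walk_above n.+1]. *)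
Definition ladder n (w : sample_path) : R := step (w 0%N) + run_min n (tail_path w).

Lemma measurable_ladder n : measurable_fun setT (ladder n).
Proof.
apply: measurable_funD; first exact: (measurableT_comp (@measurable_step R y) (@measurable_coord R 0)).
exact: (measurableT_comp (mrm n) (@measurable_tail_path R)).
Qed.

Lemma walkS w i : walk y w i.+1 = (step (w 0%N) + walk y (tail_path w) i)%R.
Proof. by rewrite /walk big_ord_recl. Qed.

Lemma walk_aboveS n w u : walk_above n.+1 y w u =
  (u < step (w 0%N))%R && walk_above n y (tail_path w) (u - step (w 0%N))%R.
Proof.
rewrite /walk_above/=; congr (_ && _).
  by rewrite walkS /walk big_ord0 addr0.
rewrite (iotaDl 1 1 n) all_map; apply: eq_in_all => i _ /=.
by rewrite add1n walkS ltrBlDl.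
Qed.

Lemma run_min_walk n w u : (u < 0)%R && walk_above n y w u = (u < run_min n w)%R.
Proof.
elim: n w u => [|n IH] w u; first by rewrite andbT.
rewrite walk_aboveS /= lt_min; congr (_ && _).
by rewrite -[RHS]ltrBlDl -IH subr_lt0.
Qed.

Lemma walk_above_ladder n w u : walk_above n.+1 y w u = (u < ladder n w)%R.
Proof. by rewrite walk_aboveS /ladder -[RHS]ltrBlDl -run_min_walk subr_lt0. Qed.

(** The first increment is independent of the tail, and E e^{-S_1} = 1. *)
Lemma exp_ladder n : \int[LL]_w (expR (- ladder n w))%:E = exp_run_min n.
Proof.
transitivity (\int[LL]_w (expR (- step (w 0%N)) * expR (- run_min n (tail_path w)))%R%:E).
  by apply: eq_integral => w _; rewrite -expRD /ladder opprD.
rewrite (@integral_cons_prod (fun z => expR (- step z)) (fun w => expR (- run_min n w))).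
- by rewrite N01_exp_mart mul1e.
- by apply: measurableT_comp => //; apply: measurableT_comp => //; exact: measurable_step.
- by move=> z; exact: expR_ge0.
- by apply: measurableT_comp => //; exact: measurableT_comp.
- by move=> z; exact: expR_ge0.
Qed.

Let mexp (f : sample_path -> R) : measurable_fun setT f -> measurable_fun setT (fun w => (expR (f w))%:E).
Proof. by move=> mf; apply/measurable_EFinP; exact: measurableT_comp. Qed.

(** From exp(- min(0, L)) <= 1 + e^{-L} with L = [ladder n], whose exponential moment is that of the
    previous minimum. *)
Lemma exp_run_min_le n : exp_run_min n <= n.+1%:R%:E.
Proof.
elim: n => [|n IH].
  rewrite /exp_run_min -(integral_prob_cst LL 1%:E) le_eqVlt; apply/orP; left; apply/eqP.
  by apply: eq_integral => w _; rewrite /= oppr0 expR0.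
apply: (@le_trans _ _ (\int[LL]_w (1 + (expR (- ladder n w))%:E))).
  apply: ge0_le_integral => //.
  - by apply: mexp; exact: measurableT_comp.
  - apply: emeasurable_funD => //; apply: mexp; apply: measurableT_comp => //; exact: measurable_ladder.
  - move=> w _; rewrite -EFinD lee_fin /= -/(ladder n w).
    have [h|h] := leP 0%R (ladder n w); first by rewrite oppr0 expR0 lerDl expR_ge0.
    by rewrite lerDr.
rewrite ge0_integralD//; last by apply: mexp; apply: measurableT_comp => //; exact: measurable_ladder.
rewrite exp_ladder (integral_prob_cst LL 1%:E) -natr1 addeC EFinD.
exact: leeD.
Qed.

Lemma exp_run_min_fin n : exp_run_min n \is a fin_num.
Proof.
rewrite ge0_fin_numE; last by apply: integral_ge0 => w _; rewrite lee_fin expR_ge0.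
by apply: le_lt_trans (exp_run_min_le n) _; exact: ltry.
Qed.

(** For [y] nonzero and k >= 1, the probability that S_k <= 0. *)
Definition neg_cdf k : R := std_normal_cdf (- (2^-1 * `|y| * Num.sqrt k%:R)).

Lemma sqrt_mulr_sqr k : Num.sqrt (k%:R * y ^+ 2) = (`|y| * Num.sqrt k%:R)%R.
Proof. by rewrite sqrtrM// sqrtr_sqr mulrC. Qed.

Lemma N01_le_exp (c : R) : (0 <= c)%R -> N01 `]-oo, (- c)%R]%classic <= (expR (- (c ^+ 2 / 2)))%:E.
Proof.
move=> c0.
have -> : N01 `]-oo, (- c)%R]%classic = \int[N01]_z (\1_(`]-oo, (- c)%R]) z)%:E by rewrite integral_indic// setIT.
have mz : measurable_fun setT (fun z : R => (expR (- (c * z + c ^+ 2 / 2)))%:E).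
  by apply: mE; apply: measurableT_comp => //; apply: measurable_funD => //; exact: measurable_funM.
rewrite -[leRHS]mule1 -(N01_exp_mart c) -ge0_integralZl//.
apply: ge0_le_integral => //.
- by apply/measurable_EFinP; exact: measurable_indic.
- exact: measurable_funeM.
move=> z _; rewrite -EFinM lee_fin -expRD indicE mem_setE in_itv/=.
have [zc|_] := leP z (- c)%R; last exact: expR_ge0.
rewrite -[leLHS]expR0 ler_expR.
have -> : (- (c ^+ 2 / 2) + - (c * z + c ^+ 2 / 2) = c * (- c - z))%R by field.
by rewrite mulr_ge0// subr_ge0.
Qed.

Lemma N01_half_line (c : R) : N01 `[(- c)%R, +oo[%classic = (1 - fine (N01 `]-oo, (- c)%R]%classic))%:E /\
  N01 `]-oo, c[%classic = (1 - fine (N01 `]-oo, (- c)%R]%classic))%:E.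
Proof.
have e1 : N01 `](- c)%R, +oo[%classic = (1 - fine (N01 `]-oo, (- c)%R]%classic))%:E.
  rewrite -setCitvl probability_setC// EFinB fineK//; exact: fin_num_measure.
split.
  rewrite -e1 /= /normal_prob -integral_itv_obnd_cbnd//.
  by apply/measurable_EFinP; apply: measurable_funTS; exact: measurable_normal_pdf.
rewrite -e1; transitivity (\int[N01]_z (\1_(`]-oo, c[) z)%:E); first by rewrite integral_indic// setIT.
transitivity (\int[N01]_z (\1_(`](- c)%R, +oo[) z)%:E); last by rewrite integral_indic// setIT.
have mi : measurable_fun setT (fun x : R => (\1_(`]-oo, c[) x : R)%:E).
  by apply/measurable_EFinP; exact: measurable_indic.
rewrite (N01_sym mi); last by move=> x; rewrite lee_fin.
apply: eq_integral => z _; rewrite !indicE !mem_setE !in_itv/= andbT.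
by rewrite ltrNl.
Qed.

Lemma neg_cdf_ge0 k : (0 <= neg_cdf k)%R.
Proof. by apply: fine_ge0; exact: measure_ge0. Qed.

(** The event S_k >= 0 contributes 1 - [neg_cdf k]. On S_k < 0 the factor e^{-S_k} is a
    Cameron--Martin density, and the shift gives the same value. *)
Lemma exp_walk_law k : \int[N01]_z (expR (- Num.min 0 (walk_law k z)))%R%:E = (2 - 2 * neg_cdf k)%:E.
Proof.
set sg := Num.sqrt (k%:R * y ^+ 2).
have sg0 : (0 <= sg)%R by exact: sqrtr_ge0.
have sg2 : (sg ^+ 2 = k%:R * y ^+ 2)%R by rewrite sqr_sqrtr// mulr_ge0// sqr_ge0.
pose c := (sg / 2)%R.
have cE : neg_cdf k = fine (N01 `]-oo, (- c)%R]%classic).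
  by rewrite /neg_cdf /std_normal_cdf /c /sg sqrt_mulr_sqr -mulrA mulrC.
have wE z : walk_law k z = (sg * (z + c))%R.
  by rewrite /walk_law -/sg /c mulrA -sg2; field.
have [h1 h2] := N01_half_line c.
have m1 : measurable_fun setT (fun z : R => (\1_(`[(- c)%R, +oo[) z : R)%:E).
  by apply/measurable_EFinP; exact: measurable_indic.
have m2 : measurable_fun setT (fun z : R => (\1_(`]-oo, c[) z : R)%:E).
  by apply/measurable_EFinP; exact: measurable_indic.
have m3 : measurable_fun setT (fun z : R => (\1_(`]-oo, c[) (z + sg) : R)%:E * (expR (- (sg * z + sg ^+ 2 / 2)))%:E).
  apply: emeasurable_funM.
    have ms : measurable_fun setT (fun z : R => (z + sg)%R) by exact: measurable_funD.
    exact: (measurableT_comp m2 ms).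
  by apply: mE; apply: measurableT_comp => //; apply: measurable_funD => //; exact: measurable_funM.
transitivity (\int[N01]_z ((\1_(`[(- c)%R, +oo[) z : R)%:E +
   (\1_(`]-oo, c[) (z + sg) : R)%:E * (expR (- (sg * z + sg ^+ 2 / 2)))%:E)).
  apply: eq_integral => z _; rewrite wE !indicE !mem_setE !in_itv/= andbT.
  have -> : (z + sg < c)%R = (z < - c)%R.
    by rewrite -ltrBrDr; congr (_ < _)%R; rewrite /c; field.
  have [zc|zc] := leP (- c)%R z.
    rewrite mul0e adde0 min_l ?oppr0 ?expR0// mulr_ge0//.
    by rewrite -lerBlDr sub0r.
  rewrite mul1e add0e min_r; first by congr (expR (- _))%:E; rewrite /c; field.
  by rewrite mulr_ge0_le0// -lerBrDr sub0r ltW.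
rewrite ge0_integralD//.
rewrite -(N01_shift sg m2); last by move=> z; rewrite lee_fin.
rewrite !integral_indic// !setIT.
apply: etrans (congr2 (fun a b => a + b) h1 h2) _.
by rewrite -EFinD cE; congr _%:E; ring.
Qed.

(** Spitzer's identity for h(x) = e^{-x}, where each term factors by independence. *)
Lemma ladder_recursion n : (n.+1%:R * fine (exp_run_min n.+1) =
  \sum_(k < n.+1) (2 - 2 * neg_cdf k.+1) * fine (exp_run_min (n - k)))%R.
Proof.
have me : measurable_fun setT (fun x : R => expR (- x)) by exact: measurableT_comp.
have := @spitzer_identity R LL iidLL y n.+1 (fun x => expR (- x)) me (fun x => expR_ge0 _).
rewrite -/(exp_run_min n.+1) -[X in _ * X](fineK (exp_run_min_fin n.+1)) -EFinM.
have sp k m : split_min LL y k m (fun x => expR (- x)) = ((2 - 2 * neg_cdf k) * fine (exp_run_min m))%R%:E.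
  rewrite EFinM fineK; last exact: exp_run_min_fin.
  rewrite -exp_walk_law /exp_run_min.
  rewrite -(@integral_cons_prod (fun z => expR (- Num.min 0 (walk_law k z)))%R (fun w => expR (- run_min m w))).
  - by apply: eq_integral => w _; rewrite -expRD opprD.
  - apply: measurableT_comp => //; apply: measurableT_comp => //; apply: measurable_minr => //.
    exact: measurable_walk_law.
  - by move=> z; exact: expR_ge0.
  - by apply: measurableT_comp => //; exact: measurableT_comp.
  - by move=> z; exact: expR_ge0.
under eq_bigr do rewrite sp subSS.
by rewrite sumEFin => -[].
Qed.

End ladder.

Section half_line_integrals.
Context (R : realType).
Local Notation mu := (@lebesgue_measure R).
Local Open Scope ereal_scope.

Lemma integral_exp_below (M : R) : 
  \int[mu]_(u in `]0%R, +oo[) (((u < M)%R)%:R * expR (- u))%:E = (1 - expR (- Num.max 0%R M))%:E.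
Proof.
have me : measurable_fun setT (fun u : R => (expR (- u))%:E).
  by apply/measurable_EFinP; exact: measurableT_comp.
have -> : \int[mu]_(u in `]0%R, +oo[) (((u < M)%R)%:R * expR (- u))%:E = \int[mu]_(u in `]0%R, M[) (expR (- u))%:E.
  rewrite integral_mkcond [RHS]integral_mkcond; apply: eq_integral => u _; rewrite !patchE !mem_setE !in_itv/= andbT.
  by case: ifPn => //= u0; case: ifPn => _; rewrite ?mul1r ?mul0r.
have [M0|M0] := ltP 0%R M; last first.
  by rewrite set_itv_ge ?integral_set0 ?oppr0 ?expR0 ?subrr// bnd_simp -leNgt.
rewrite integral_itv_bndo_bndc; last exact: measurable_funTS.
rewrite integral_itv_obnd_cbnd; last exact: measurable_funTS.
have der (u : R) : is_derive u 1%R (fun x : R => - expR (- x))%R (expR (- u)).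
  have h1 : is_derive u 1%R (fun x : R => - x)%R (-1)%R by exact: is_deriveN.
  have h2 := @is_derive1_comp R expR (fun x : R => - x)%R u _ _ (is_derive_expR _) h1.
  have h3 := is_deriveN h2.
  by apply: (is_derive_eq h3); rewrite mulrN1 opprK.
have cF : continuous (fun x : R => - expR (- x))%R.
  move=> x; apply: differentiable_continuous; apply/derivable1_diffP.
  by have [] := der x.
rewrite (@continuous_FTC2 _ _ (fun x : R => - expR (- x))%R)//.
- by rewrite -EFinB oppr0 expR0; congr _%:E; ring.
- apply: continuous_in_subspaceT => x _.
  by apply: continuous_comp; [exact: continuousN|exact: continuous_expR].
- split.
  + by move=> x _; have [] := der x.
  + by apply: cvg_at_right_filter; exact: cF.
  + by apply: cvg_at_left_filter; exact: cF.
- by move=> x _; rewrite derive1E; have [_ ->] := der x.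
Qed.

Lemma integral_below (M : R) :
  \int[mu]_(u in `]0%R, +oo[) (((u < M)%R)%:R : R)%:E = (Num.max 0%R M)%:E.
Proof.
transitivity (\int[mu]_(u in `]0%R, M[) (1 : R)%:E).
  rewrite integral_mkcond [RHS]integral_mkcond; apply: eq_integral => u _; rewrite !patchE !mem_setE !in_itv/= andbT.
  by case: ifPn => //= u0; case: ifPn.
rewrite integral_cst//= mul1e lebesgue_measure_itv/= lte_fin.
by have [M0|M0] := ltP 0%R M; rewrite ?oppr0 ?adde0// sub0e.
Qed.

End half_line_integrals.

(** * Limits of the integrals over the overshoot *)

Section ladder_limits.
Context (R : realType).
Local Notation mu := (@lebesgue_measure R).
Local Notation N01 := (normal_prob 0 1 : probability (measurableTypeR R) R).
Local Notation sample_path := (sample_path R).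
Variable LL : probability sample_path R.
Hypothesis iidLL : iid_map LL idfun.
Variable y : R.
Hypothesis y0 : y != 0%R.
Local Open Scope ereal_scope.
Local Notation ladder := (ladder y).
Local Notation run_min := (run_min y).
Local Notation step := (step y).

(* Overshoots are nonnegative; the truncation gives a weight in [0,1] on the whole
   line. *)
Definition exp_weight (u : R) : R := expR (- Num.max 0%R u).

Definition ladder_int n (g : R -> R) : \bar R :=
  \int[mu]_(u in `]0%R, +oo[) (LL [set w | walk_above n.+1 y w u] * (g u)%:E).

Let ml n : measurable_fun setT (ladder n). Proof. exact: measurable_ladder. Qed.

Lemma measurable_exp_weight : measurable_fun setT exp_weight.
Proof.
by apply: measurableT_comp => //; apply: measurableT_comp => //; exact: measurable_maxr.
Qed.

Lemma exp_weight01 u : (0 <= exp_weight u <= 1)%R.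
Proof. by rewrite expR_ge0 -expR0 ler_expR oppr_le0 le_max lexx. Qed.

Let measurable_ladder_pair n (g : R -> R) : measurable_fun setT g ->
  measurable_fun setT (fun p : sample_path * R => (((p.2 < ladder n p.1)%R)%:R * g p.2)%:E).
Proof.
move=> mg.
apply/measurable_EFinP; apply: measurable_funM; last exact: (measurableT_comp mg (@measurable_snd _ _ _ _)).
rewrite (_ : (fun p => _) = (fun p : sample_path * R => if (p.2 < ladder n p.1)%R then 1%R else 0%R)); last first.
  by apply/funext => p; case: ifP.
apply: measurable_fun_ifT => //; apply: measurable_fun_ltr; first exact: measurable_snd.
exact: (measurableT_comp (ml n) (@measurable_fst _ _ _ _)).
Qed.

Let measurable_ladder_row n w (g : R -> R) : measurable_fun setT g ->
  measurable_fun setT (fun u : R => (((u < ladder n w)%R)%:R * g u)%:E).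
Proof.
move=> mg; have mp : measurable_fun setT (fun u : R => (w, u) : sample_path * R) by exact: measurable_pair1.
exact: (measurableT_comp (measurable_ladder_pair n mg) mp).
Qed.

Let measurable_ladder_inner n (g : R -> R) : measurable_fun setT g -> (forall u, 0 <= g u <= 1)%R ->
  measurable_fun setT (fun w => \int[mu]_(u in `]0%R, +oo[) (((u < ladder n w)%R)%:R * g u)%:E).
Proof.
move=> mg g01.
have g0 (w : sample_path) u : 0 <= (((u < ladder n w)%R)%:R * g u)%:E by rewrite lee_fin mulr_ge0//; case/andP: (g01 u).
by apply: (measurable_restricted_integral _ (measurable_ladder_pair n mg)).
Qed.

Lemma ladder_intE n (g : R -> R) : measurable_fun setT g -> (forall u, (0 <= g u)%R) ->
  ladder_int n g = \int[LL]_w \int[mu]_(u in `]0%R, +oo[) (((u < ladder n w)%R)%:R * g u)%:E.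
Proof.
move=> mg g0.
rewrite (restricted_tonelli LL _ (measurable_ladder_pair n mg))//; last by move=> x u; rewrite lee_fin mulr_ge0.
apply: eq_integral => u _.
rewrite muleC -(integral_walk_above LL n.+1 y u (g0 u)) /=.
by apply: eq_integral => w _; rewrite walk_above_ladder// mulrC.
Qed.

(** Pointwise (1 - e^{-max(0, L)}) + e^{-L} = e^{-min(0, L)} for L = [ladder n]. The integral is
    therefore a difference of consecutive terms of the Spitzer sequence. *)
Lemma ladder_exp_recursion n :
  ladder_int n exp_weight + exp_run_min LL y n = exp_run_min LL y n.+1.
Proof.
rewrite ladder_intE; [|exact: measurable_exp_weight|by move=> u; exact: expR_ge0].
have -> : \int[LL]_w \int[mu]_(u in `]0%R, +oo[) (((u < ladder n w)%R)%:R * exp_weight u)%:E =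
  \int[LL]_w (1 - expR (- Num.max 0%R (ladder n w)))%:E.
  apply: eq_integral => w _; rewrite -integral_exp_below; apply: eq_integral => u.
  by rewrite inE/= in_itv/= andbT => u0; rewrite /exp_weight max_r// ltW.
rewrite -(exp_ladder iidLL) -ge0_integralD//; last 3 first.
- by move=> w _; rewrite lee_fin subr_ge0 -expR0 ler_expR oppr_le0 le_max lexx.
- apply/measurable_EFinP; apply: measurable_funB => //; apply: measurableT_comp => //; apply: measurableT_comp => //.
  exact: measurable_maxr.
- by apply/measurable_EFinP; apply: measurableT_comp => //; exact: measurableT_comp.
apply: eq_integral => w _; rewrite -EFinD /= -/(ladder n w); congr _%:E.
have [h|h] := leP 0%R (ladder n w); first by rewrite subrK oppr0 expR0.
by rewrite oppr0 expR0 subrr add0r.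
Qed.

Lemma neg_cdf_le k : (neg_cdf y k <= expR (- (y ^+ 2 / 8)) ^+ k)%R.
Proof.
rewrite /neg_cdf /std_normal_cdf -lee_fin fineK; last exact: fin_num_measure.
have c0 : (0 <= 2^-1 * `|y| * Num.sqrt k%:R)%R by rewrite !mulr_ge0.
apply: le_trans (N01_le_exp c0) _.
rewrite lee_fin -expRM_natl ler_expR !exprMn sqr_sqrtr// real_normK ?num_real//.
by rewrite le_eqVlt; apply/orP; left; apply/eqP; field.
Qed.

(** Chernoff's bound is geometric in k with ratio e^{-y^2/8} < 1, so the series in the definition of
    [nu] has a genuine limit. *)
Lemma neg_cdf_series_cvg :
  (\sum_(k < n) neg_cdf y k.+1 / k.+1%:R @[n --> \oo] --> 
   \big[+%R/0]_(1 <= n <oo) (n%:R^-1 * std_normal_cdf (- (2^-1 * `|y| * Num.sqrt n%:R))))%R.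
Proof.
set r := expR (- (y ^+ 2 / 8)).
have r0 : (0 < r)%R by exact: expR_gt0.
have r1 : (r < 1)%R by rewrite -expR0 ltr_expR oppr_lt0 divr_gt0// exprn_even_gt0.
have geo n : (\sum_(i < n) r ^+ i.+1 <= (1 - r)^-1)%R.
  rewrite -[leRHS]mul1r ler_pdivlMr ?subr_gt0//.
  have -> : ((\sum_(i < n) r ^+ i.+1) * (1 - r) = r - r ^+ n.+1)%R.
    elim: n => [|n IH]; first by rewrite big_ord0 mul0r expr1 subrr.
    by rewrite big_ord_recr/= mulrDl IH [(r ^+ n.+2)%R]exprS; ring.
  by rewrite lerBlDr (le_trans (ltW r1))// lerDl exprn_ge0// ltW.
pose S (n : nat) := (\sum_(k < n) neg_cdf y k.+1 / k.+1%:R)%R.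
have Sc : S @ \oo --> limn S.
  apply: nondecreasing_is_cvgn.
    apply/nondecreasing_seqP => n; rewrite /S big_ord_recr/= lerDl divr_ge0// neg_cdf_ge0//.
  exists (1 - r)^-1%R => _ [n _ <-]; apply: le_trans (geo n); apply: ler_sum => i _.
  by apply: le_trans (neg_cdf_le i.+1); rewrite ler_piMr ?neg_cdf_ge0// invf_le1// ler1n.
rewrite [X in _ --> X](_ : _ = limn S)//.
apply: cvg_lim => //.
rewrite -(cvg_shiftS (fun n => \sum_(1 <= i < n) _)%R).
apply: cvg_trans Sc; apply: near_eq_cvg; apply: nearW => n.
by rewrite /= /S big_add1 big_mkord; apply: eq_bigr => i _; rewrite mulrC.
Qed.

Lemma ladder_exp_cvg : ladder_int n exp_weight @[n --> \oo] --> (y ^+ 2 / 2 * nu y)%:E.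
Proof.
have -> : (y ^+ 2 / 2 * nu y)%R = expR (- 2 * \big[+%R/0]_(1 <= n <oo)
   (n%:R^-1 * std_normal_cdf (- (2^-1 * `|y| * Num.sqrt n%:R))))%R.
  by rewrite /nu; set e := expR _; field; rewrite y0.
have c0 : fine (exp_run_min LL y 0) = 1%R.
  rewrite /exp_run_min (_ : \int[LL]_w _ = 1)//.
  by rewrite -(integral_prob_cst LL 1); apply: eq_integral => w _; rewrite /= oppr0 expR0.
have h := @spitzer_sequence_cvg R (neg_cdf y) (fun n => fine (exp_run_min LL y n)) _ (@neg_cdf_ge0 R y) c0 (ladder_recursion iidLL y) neg_cdf_series_cvg.
have h' : ((fine (exp_run_min LL y n.+1) - fine (exp_run_min LL y n))%:E @[n --> \oo] -->
  (expR (- 2 * \big[+%R/0]_(1 <= n <oo) (n%:R^-1 * std_normal_cdf (- (2^-1 * `|y| * Num.sqrt n%:R))))%R)%:E).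
  by apply: cvg_EFin; [exact: nearW|exact: h].
apply: cvg_trans h'; apply: near_eq_cvg; apply: nearW => n.
rewrite EFinB !fineK ?exp_run_min_fin// -ladder_exp_recursion addeK//.
exact: exp_run_min_fin.
Qed.

Definition neg_mean n : \bar R := \int[LL]_w (- run_min n w)%:E.

Let mrm n : measurable_fun setT (run_min n). Proof. exact: measurable_run_min. Qed.

Let rm0 n w : (0 <= - run_min n w)%R. Proof. by rewrite oppr_ge0 run_min_le0. Qed.

(** Halving the exponent gives E e^{-S_1/2} = e^{-y^2/8} = r < 1, so a_n = E exp(-M_n/2), with M_n =
    [run_min n], satisfies a_{n+1} <= 1 + r a_n and stays below 1/(1 - r); then -M <= 2 e^{-M/2}. *)
Lemma neg_mean_bound : exists C : R, forall n, neg_mean n <= C%:E.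
Proof.
set r := expR (- (y ^+ 2 / 8)).
have r0 : (0 < r)%R by exact: expR_gt0.
have r1 : (r < 1)%R by rewrite -expR0 ltr_expR oppr_lt0 divr_gt0// exprn_even_gt0.
have mexp (f : sample_path -> R) : measurable_fun setT f -> measurable_fun setT (fun w => (expR (- (f w / 2)))%:E).
  move=> mf; apply/measurable_EFinP; apply: measurableT_comp => //; apply: measurableT_comp => //.
  exact: measurable_funM.
have half n : \int[LL]_w (expR (- (run_min n w / 2)))%:E <= ((1 - r)^-1)%:E.
  elim: n => [|n IH].
    rewrite (_ : \int[LL]_w _ = 1).
      by rewrite lee_fin invf_ge1 ?subr_gt0// gerBl ltW.
    rewrite -(integral_prob_cst LL 1); apply: eq_integral => w _.
    by rewrite /= mul0r oppr0 expR0.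
  apply: (@le_trans _ _ (\int[LL]_w (1 + (expR (- (ladder n w / 2)))%:E))).
    apply: ge0_le_integral => //.
    - exact: mexp.
    - by apply: emeasurable_funD => //; exact: mexp.
    - move=> w _; rewrite -EFinD lee_fin /= -/(ladder n w).
      have [h|h] := leP 0%R (ladder n w); first by rewrite mul0r oppr0 expR0 lerDl expR_ge0.
      by rewrite lerDr.
  rewrite ge0_integralD//; last first.
    exact: mexp.
  rewrite (integral_prob_cst LL 1).
  have -> : \int[LL]_w (expR (- (ladder n w / 2)))%:E = r%:E * \int[LL]_w (expR (- (run_min n w / 2)))%:E.
    rewrite /r -N01_exp_half_mart.
    rewrite -(integral_cons_prod iidLL).
    - by apply: eq_integral => w _; rewrite -expRD /ladder mulrDl opprD.
    - apply: measurableT_comp => //; apply: measurableT_comp => //; apply: measurable_funM => //.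
      exact: measurable_step.
    - by move=> z; exact: expR_ge0.
    - by apply/measurable_EFinP; exact: mexp.
    - by move=> w; exact: expR_ge0.
  apply: (@le_trans _ _ (1 + r%:E * ((1 - r)^-1)%:E)).
    by rewrite leeD2l// lee_wpmul2l// lee_fin ltW.
  rewrite -EFinM -EFinD lee_fin le_eqVlt; apply/orP; left; apply/eqP.
  by field; rewrite subr_eq0 gt_eqF.
exists (2 * (1 - r)^-1)%R => n.
apply: (@le_trans _ _ (\int[LL]_w (2%:E * (expR (- (run_min n w / 2)))%:E))).
  apply: ge0_le_integral => //.
  - by move=> w _; rewrite lee_fin.
  - by apply/measurable_EFinP; exact: measurableT_comp.
  - by apply: measurable_funeM; exact: mexp.
  - move=> w _; rewrite -EFinM lee_fin.
    have := expR_ge1Dx (- (run_min n w / 2)); set e := expR _; move: e (run_min n w) => e m; lra.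
rewrite ge0_integralZl//; last first.
  exact: mexp.
by rewrite EFinM lee_wpmul2l.
Qed.

Let neg_mean_fin n : neg_mean n \is a fin_num.
Proof.
have [C hC] := neg_mean_bound; rewrite ge0_fin_numE.
  by apply: le_lt_trans (hC n) _; exact: ltry.
by apply: integral_ge0 => w _; rewrite lee_fin.
Qed.

Lemma step_abs_le z : (`|step z| <= `|y| * (1 + z ^+ 4) + y ^+ 2 / 2)%R.
Proof.
rewrite /step; apply: (le_trans (ler_normD _ _)).
rewrite (ger0_norm (_ : 0 <= y ^+ 2 / 2)%R); last by rewrite divr_ge0// sqr_ge0.
rewrite lerD2r normrM ler_wpM2l// (_ : (z ^+ 4 = (`|z| ^+ 2) ^+ 2)%R); last first.
  by rewrite real_normK ?num_real// -exprM.
have := sqr_ge0 (`|z| ^+ 2 - 1)%R; have := sqr_ge0 (`|z| - 1)%R; have := normr_ge0 z.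
by move: `|z|%R => x; nra.
Qed.

Let stepp z : R := Num.max 0%R (step z)%R.
Let stepn z : R := Num.max 0%R (- step z)%R.

Let mstep : measurable_fun setT step. Proof. exact: measurable_step. Qed.
Let mstepp : measurable_fun setT (fun z => (stepp z)%:E).
Proof. by rewrite /stepp; apply/measurable_EFinP; exact: measurable_maxr. Qed.
Let mstepn : measurable_fun setT (fun z => (stepn z)%:E).
Proof. by rewrite /stepn; apply/measurable_EFinP; apply: measurable_maxr => //; exact: measurableT_comp. Qed.
Let stepp0 z : 0 <= (stepp z)%:E. Proof. by rewrite lee_fin le_max lexx. Qed.
Let stepn0 z : 0 <= (stepn z)%:E. Proof. by rewrite lee_fin le_max lexx. Qed.

(** 65 = 1 + 64 comes from |z| <= 1 + z^4 and the bound on the fourth moment. *)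
Definition step_bound : R := (`|y| * 65 + y ^+ 2 / 2)%R.

Let step_int_le (f : R -> R) : measurable_fun setT (fun z => (f z)%:E) ->
  (forall z, 0 <= f z <= `|step z|)%R -> \int[N01]_z (f z)%:E <= step_bound%:E.
Proof.
move=> mf f01.
have m4 : measurable_fun setT (fun z : R => (z ^+ 4)%:E) by apply/measurable_EFinP; exact: measurable_funX.
have z40 (z : R) : 0 <= (z ^+ 4)%:E by rewrite lee_fin exprn_even_ge0.
have y20 : 0 <= (y ^+ 2 / 2)%:E by rewrite lee_fin divr_ge0// sqr_ge0.
apply: (@le_trans _ _ (\int[N01]_z (`|y|%:E * (1 + (z ^+ 4)%:E) + (y ^+ 2 / 2)%:E))).
  apply: ge0_le_integral => //.
  - by move=> z _; rewrite lee_fin; case/andP: (f01 z).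
  - by apply: emeasurable_funD => //; apply: measurable_funeM; exact: emeasurable_funD.
  - move=> z _; rewrite -(EFinD 1) -EFinM -EFinD lee_fin; case/andP: (f01 z) => _ h.
    exact: le_trans h (step_abs_le z).
have m14 : measurable_fun setT (fun z : R => 1 + (z ^+ 4)%:E) by exact: emeasurable_funD.
rewrite ge0_integralD//; last 2 first.
- by move=> z _; rewrite mule_ge0// adde_ge0.
- exact: measurable_funeM.
rewrite ge0_integralZl//; last by move=> z _; rewrite adde_ge0.
rewrite ge0_integralD// (integral_prob_cst N01 1) (integral_prob_cst N01 (y ^+ 2 / 2)%:E).
rewrite /step_bound EFinD leeD2r// EFinM lee_wpmul2l//.
apply: le_trans (leeD (lexx _) (@normal_fourth_moment R)) _.
by rewrite -EFinD lee_fin; lra.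
Qed.

Let stepp_le : \int[N01]_z (stepp z)%:E <= step_bound%:E.
Proof.
apply: (step_int_le mstepp) => z; rewrite /stepp le_max lexx/= ge_max normr_ge0/=; exact: ler_norm.
Qed.

Let stepn_le : \int[N01]_z (stepn z)%:E <= step_bound%:E.
Proof.
apply: (step_int_le mstepn) => z; rewrite /stepn le_max lexx/= ge_max normr_ge0/= -normrN; exact: ler_norm.
Qed.

(** This is E S_1 = y^2/2 in positive and negative parts; it follows from [step z] + [step (- z)] =
    y^2 and the symmetry of N(0,1). *)
Let step_mean : \int[N01]_z (stepp z)%:E = \int[N01]_z (stepn z)%:E + (y ^+ 2 / 2)%:E.
Proof.
have mN : measurable_fun setT (fun x : R => (- x)%R) by exact: measurable_funN.
have mp' := measurableT_comp mstepp mN; have mn' := measurableT_comp mstepn mN.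
have fp : \int[N01]_z (stepp z)%:E \is a fin_num.
  by rewrite ge0_fin_numE ?integral_ge0//; apply: le_lt_trans stepp_le _; exact: ltry.
have fn : \int[N01]_z (stepn z)%:E \is a fin_num.
  by rewrite ge0_fin_numE ?integral_ge0//; apply: le_lt_trans stepn_le _; exact: ltry.
have e : \int[N01]_z (stepp z)%:E + \int[N01]_z (stepp (- z))%:E =
    (\int[N01]_z (stepn z)%:E + \int[N01]_z (stepn (- z))%:E) + (y ^+ 2)%:E.
  rewrite -ge0_integralD// -ge0_integralD//.
  rewrite -[X in _ + X](integral_prob_cst N01) -ge0_integralD//; last 3 first.
  - by move=> z _; rewrite adde_ge0.
  - exact: emeasurable_funD.
  - by move=> z _; rewrite lee_fin sqr_ge0.
  apply: eq_integral => z _; rewrite -!EFinD /stepp /stepn /step; congr _%:E.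
  have [h1|h1] := leP 0%R (y * z + y ^+ 2 / 2)%R; have [h2|h2] := leP 0%R (y * - z + y ^+ 2 / 2)%R;
    have [h3|h3] := leP 0%R (- (y * z + y ^+ 2 / 2))%R; have [h4|h4] := leP 0%R (- (y * - z + y ^+ 2 / 2))%R; lra.
move: e; rewrite -(N01_sym mstepp)// -(N01_sym mstepn)//.
move: fp fn; case: (\int[N01]_z (stepp z)%:E) => // p _; case: (\int[N01]_z (stepn z)%:E) => // q _.
by rewrite -!EFinD => -[e]; congr _%:E; lra.
Qed.

Definition ladder_mean n : \bar R := \int[LL]_w (Num.max 0%R (ladder n w))%:E.

Let coord0 (f : R -> \bar R) : measurable_fun setT f -> (forall z, 0 <= f z) ->
  \int[LL]_w f (w 0%N) = \int[N01]_z f z.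
Proof. exact: integral_coord. Qed.

Let mc0 (f : R -> \bar R) : measurable_fun setT f -> measurable_fun setT (fun w : sample_path => f (w 0%N)).
Proof. by move=> mf; exact: (measurableT_comp mf (@measurable_coord R 0)). Qed.

Let mrmt n : measurable_fun setT (fun w : sample_path => (- run_min n (tail_path w))%:E).
Proof.
apply/measurable_EFinP; apply: measurableT_comp => //.
exact: (measurableT_comp (mrm n) (@measurable_tail_path R)).
Qed.

Let neg_mean_tail n : \int[LL]_w (- run_min n (tail_path w))%:E = neg_mean n.
Proof.
have m1 : measurable_fun setT (fun x : sample_path => - run_min n x)%R by exact: measurableT_comp.
have := @integral_cons_prod R LL iidLL (cst 1%R) (fun w => - run_min n w)%R (@measurable_cst _ _ _ _ _ _) (fun=> ler01) m1 (fun w => rm0 n w).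
rewrite (integral_prob_cst N01 1) mul1e /neg_mean => <-.
by apply: eq_integral => w _; rewrite /= mul1r.
Qed.

Lemma ladder_mean_le n : ladder_mean n <= step_bound%:E.
Proof.
apply: le_trans stepp_le; rewrite -(coord0 mstepp)//.
apply: ge0_le_integral => //.
- by move=> w _; rewrite lee_fin le_max lexx.
- by apply/measurable_EFinP; exact: measurable_maxr.
- exact: (mc0 mstepp).
move=> w _; rewrite lee_fin /stepp ge_max le_max lexx/= le_max orbC /ladder gerDl.
by rewrite (run_min_le0 y n).
Qed.

Let ladder_mean_fin n : ladder_mean n \is a fin_num.
Proof.
rewrite ge0_fin_numE; first by apply: le_lt_trans (ladder_mean_le n) _; exact: ltry.
by apply: integral_ge0 => w _; rewrite lee_fin le_max lexx.
Qed.

(** Expectation of max(0, L) = L - min(0, L) for L = [ladder n]. The negative part of the first step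
    is added to both sides, so that only nonnegative functions are integrated. *)
Lemma ladder_mean_recursion n : ladder_mean n + neg_mean n = neg_mean n.+1 + (y ^+ 2 / 2)%:E.
Proof.
have fn : \int[N01]_z (stepn z)%:E \is a fin_num.
  by rewrite ge0_fin_numE ?integral_ge0//; apply: le_lt_trans stepn_le _; exact: ltry.
have mlad : measurable_fun setT (fun w => (Num.max 0%R (ladder n w))%:E).
  by apply/measurable_EFinP; exact: measurable_maxr.
have mneg : measurable_fun setT (fun w => (- run_min n.+1 w)%:E).
  by apply/measurable_EFinP; exact: measurableT_comp.
have e : ladder_mean n + neg_mean n + \int[N01]_z (stepn z)%:E =
    neg_mean n.+1 + \int[N01]_z (stepp z)%:E.
  rewrite -neg_mean_tail /ladder_mean /neg_mean -(coord0 mstepn)// -(coord0 mstepp)//.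
  rewrite -ge0_integralD//; last 2 first.
  - by move=> w _; rewrite lee_fin le_max lexx.
  - by move=> w _; rewrite lee_fin.
  rewrite -ge0_integralD//; last 3 first.
  - by move=> w _; rewrite adde_ge0// lee_fin ?le_max ?lexx.
  - exact: emeasurable_funD.
  - exact: (mc0 mstepn).
  rewrite -ge0_integralD//; last 2 first.
  - by move=> w _; rewrite lee_fin.
  - exact: (mc0 mstepp).
  apply: eq_integral => w _; rewrite -!EFinD /stepp /stepn /=; congr _%:E.
  rewrite -/(ladder n w) /ladder.
  move: (step (w 0%N)) (run_min n (tail_path w)) => a m.
  have [h1|h1] := leP 0%R (a + m)%R; have [h2|h2] := leP 0%R a; have [h3|h3] := leP 0%R (- a)%R; lra.
move: e; rewrite step_mean.
move: fn; move: (\int[N01]_z (stepn z)%:E) => q fn.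
rewrite [X in _ = X -> _]addeCA [X in _ = X -> _]addeC.
by move/(congr1 (fun x => x - q)); rewrite !addeK.
Qed.

(** The means of - [run_min n] are nondecreasing and bounded, so their differences vanish. This is
    the case of the constant weight 1, from which the complementary weight follows by
    subtraction. *)
Lemma ladder_mean_cvg : ladder_mean n @[n --> \oo] --> (y ^+ 2 / 2)%:E.
Proof.
have [C hC] := neg_mean_bound.
pose e n := fine (neg_mean n).
have end_ : nondecreasing_seq e.
  apply/nondecreasing_seqP => n; apply: fine_le => //; apply: ge0_le_integral => //.
  - by move=> w _; rewrite lee_fin.
  - by apply/measurable_EFinP; exact: measurableT_comp.
  - by apply/measurable_EFinP; exact: measurableT_comp.
  - by move=> w _; rewrite lee_fin lerN2 run_min_nincr.
have ec : cvgn e.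
  apply: nondecreasing_is_cvgn => //; exists C => _ [n _ <-].
  by rewrite -lee_fin fineK.
have d0 : (e n.+1 - e n @[n --> \oo] --> (0 : R))%R.
  rewrite -(subrr (limn e)); apply: cvgB => //.
  by rewrite (cvg_shiftS e).
have h : ((e n.+1 - e n + y ^+ 2 / 2)%:E @[n --> \oo] --> (y ^+ 2 / 2)%:E).
  apply: cvg_EFin; first exact: nearW.
  by rewrite -[X in _ --> X]add0r; apply: cvgD; [exact: d0|exact: cvg_cst].
apply: cvg_trans h; apply: near_eq_cvg; apply: nearW => n.
have := ladder_mean_recursion n.
rewrite -(fineK (ladder_mean_fin n)) -(fineK (neg_mean_fin n)) -(fineK (neg_mean_fin n.+1)) -!EFinD.
by move=> [h]; congr _%:E; rewrite /e; lra.
Qed.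

Lemma ladder_int_le n (g : R -> R) : measurable_fun setT g -> (forall u, 0 <= g u <= 1)%R ->
  ladder_int n g <= step_bound%:E.
Proof.
move=> mg g01; rewrite ladder_intE//; last by move=> u; case/andP: (g01 u).
apply: le_trans (ladder_mean_le n).
apply: ge0_le_integral => //.
- by move=> w _; apply: integral_ge0 => u _; rewrite lee_fin mulr_ge0//; case/andP: (g01 u).
- exact: measurable_ladder_inner.
- by apply/measurable_EFinP; exact: measurable_maxr.
move=> w _; rewrite -integral_below.
apply: ge0_le_integral => //.
- by move=> u _; rewrite lee_fin mulr_ge0//; case/andP: (g01 u).
- by apply: measurable_funTS; exact: measurable_ladder_row.
- have := measurable_ladder_row n w (@measurable_cst _ _ (measurableTypeR R) R setT 1%R).
  by move=> h; apply: measurable_funTS; apply: eq_measurable_fun h => u _; rewrite /= mulr1.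
by move=> u _; rewrite lee_fin ler_piMr//; case/andP: (g01 u).
Qed.

Let mcompl : measurable_fun setT (fun u : R => (1 - exp_weight u)%R).
Proof. by apply: measurable_funB => //; exact: measurable_exp_weight. Qed.

Let compl01 u : (0 <= 1 - exp_weight u <= 1)%R.
Proof. by have /andP[h1 h2] := exp_weight01 u; rewrite subr_ge0 h2 gerBl h1. Qed.

Let ladder_int_fin n (g : R -> R) : measurable_fun setT g -> (forall u, 0 <= g u <= 1)%R ->
  ladder_int n g \is a fin_num.
Proof.
move=> mg g01; rewrite ge0_fin_numE.
  by apply: le_lt_trans (ladder_int_le n mg g01) _; exact: ltry.
by apply: integral_ge0 => u _; rewrite mule_ge0// lee_fin; case/andP: (g01 u).
Qed.

Lemma ladder_int_compl n :
  ladder_int n exp_weight + ladder_int n (fun u => 1 - exp_weight u)%R = ladder_mean n.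
Proof.
rewrite !ladder_intE; [|exact: mcompl|by move=> u; case/andP: (compl01 u)|exact: measurable_exp_weight|by move=> u; case/andP: (exp_weight01 u)].
rewrite -ge0_integralD//; last 4 first.
- by move=> w _; apply: integral_ge0 => u _; rewrite lee_fin mulr_ge0//; case/andP: (exp_weight01 u).
- by apply: measurable_ladder_inner; [exact: measurable_exp_weight|exact: exp_weight01].
- by move=> w _; apply: integral_ge0 => u _; rewrite lee_fin mulr_ge0//; case/andP: (compl01 u).
- by apply: measurable_ladder_inner; [exact: mcompl|exact: compl01].
apply: eq_integral => w _; rewrite -ge0_integralD//; last 4 first.
- by move=> u _; rewrite lee_fin mulr_ge0//; case/andP: (exp_weight01 u).
- by apply: measurable_funTS; apply: measurable_ladder_row; exact: measurable_exp_weight.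
- by move=> u _; rewrite lee_fin mulr_ge0//; case/andP: (compl01 u).
- by apply: measurable_funTS; apply: measurable_ladder_row; exact: mcompl.
rewrite -integral_below; apply: eq_integral => u _.
by rewrite -EFinD -mulrDr addrC subrK mulr1.
Qed.

Lemma ladder_compl_cvg : ladder_int n (fun u => 1 - exp_weight u)%R @[n --> \oo] -->
  (y ^+ 2 / 2 * (1 - nu y))%:E.
Proof.
rewrite mulrBr mulr1.
have h : (ladder_mean n - ladder_int n exp_weight) @[n --> \oo] --> (y ^+ 2 / 2)%:E - (y ^+ 2 / 2 * nu y)%:E.
  by apply: cvgeB => //; [exact: ladder_mean_cvg|exact: ladder_exp_cvg].
rewrite EFinB; apply: cvg_trans h; apply: near_eq_cvg; apply: nearW => n.
rewrite -ladder_int_compl addeAC subee ?add0e//.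
by apply: ladder_int_fin; [exact: measurable_exp_weight|exact: exp_weight01].
Qed.

(** The integral with weight e^{-u} is at most the one with weight 1; their limits are compared. *)
Lemma nu_le1 : (0 <= nu y <= 1)%R.
Proof.
have y20 : (0 < y ^+ 2 / 2)%R by rewrite divr_gt0// exprn_even_gt0.
apply/andP; split; first by rewrite /nu mulr_ge0 ?expR_ge0// mulr_ge0// invr_ge0 sqr_ge0.
rewrite -(ler_pM2l y20) mulr1 -lee_fin.
apply: (lee_cvg_to ladder_exp_cvg ladder_mean_cvg) => //.
apply: nearW => n; rewrite -ladder_int_compl leeDl//.
by apply: integral_ge0 => u _; rewrite mule_ge0// lee_fin; case/andP: (compl01 u).
Qed.

End ladder_limits.

(** * Late crossings and the conclusion *)

Section stopping_tail.
Context (R : realType).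
Local Notation mu := (@lebesgue_measure R).
Local Notation N01 := (normal_prob 0 1 : probability (measurableTypeR R) R).
Local Notation sample_path := (sample_path R).
Local Open Scope ereal_scope.

Lemma N01_interval_le (p q : R) : (p <= q)%R -> N01 `[p, q]%classic <= (q - p)%:E.
Proof.
move=> pq; rewrite /= /normal_prob.
apply: (@le_trans _ _ (\int[mu]_(x in `[p, q]) (1 : R)%:E)).
  apply: ge0_le_integral => //.
  - by move=> x _; rewrite lee_fin normal_pdf_ge0.
  - by apply/measurable_EFinP; apply: measurable_funTS; exact: measurable_normal_pdf.
  - by move=> x _; rewrite lee_fin normal_pdf_le1.
by rewrite integral_cst//= mul1e lebesgue_measure_itv/= lte_fin; case: ltP => //; rewrite lee_fin subr_ge0.
Qed.

Lemma N01_second_moment : \int[N01]_z (z ^+ 2)%:E <= 65%:E.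
Proof.
have m4 : measurable_fun setT (fun z : R => (z ^+ 4)%:E) by apply/measurable_EFinP; exact: measurable_funX.
have z40 (z : R) : 0 <= (z ^+ 4)%:E by rewrite lee_fin exprn_even_ge0.
apply: (@le_trans _ _ (\int[N01]_z (1 + (z ^+ 4)%:E))).
  apply: ge0_le_integral => //.
  - by move=> z _; rewrite lee_fin sqr_ge0.
  - by apply/measurable_EFinP; exact: measurable_funX.
  - exact: emeasurable_funD.
  - move=> z _; rewrite -EFinD lee_fin (_ : (z ^+ 4 = (z ^+ 2) ^+ 2)%R); last by rewrite -exprM.
    have := sqr_ge0 (z ^+ 2 - 1)%R; have := sqr_ge0 z; move: (z ^+ 2)%R => x; nra.
rewrite ge0_integralD// (integral_prob_cst N01 1).
apply: le_trans (leeD (lexx _) (@normal_fourth_moment R)) _.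
by rewrite -EFinD lee_fin; lra.
Qed.

Variable LL : probability sample_path R.
Hypothesis iidLL : iid_map LL idfun.
Variables (s t : R).
Hypothesis st : (0 < t \/ (s = 0 /\ t = 0))%R.

(** Given the other innovations, the first one endows the mean with a density at most 1 + t. *)
Lemma post_mean_small (c : R) n : (0 < n)%N -> (0 <= c)%R ->
  LL [set z | (`|post_mean s t z n| <= c)%R] <= (2 * c * (1 + t))%:E.
Proof.
move=> n0 c0; have t0 := t_ge0 st; have t1 : (0 < 1 + t)%R by rewrite ltr_wpDr.
have mA : measurable [set z : sample_path | (`|post_mean s t z n| <= c)%R].
  rewrite (_ : [set z | _] = (fun z => `|post_mean s t z n|%R) @^-1` `]-oo, c]%classic).
    rewrite -[X in measurable X]setTI; apply: measurableT_comp => //; exact: measurable_post_mean.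
  by apply/seteqP; split => z /=; rewrite in_itv.
set A := [set z | _] in mA *.
have -> : LL A = \int[LL]_z (\1_A z)%:E by rewrite integral_indic// setIT.
have mF : measurable_fun setT (fun z : sample_path => (\1_A z : R)%:E).
  by apply/measurable_EFinP; exact: measurable_indic.
rewrite (integral_resample iidLL 0)//.
rewrite -[leRHS](integral_prob_cst LL).
apply: ge0_le_integral => //.
- by move=> z _; apply: integral_ge0 => x _; rewrite lee_fin.
- have m2 : measurable_fun setT (fun p : sample_path * R => (\1_A (upd p.1 0 p.2) : R)%:E).
    exact: (measurableT_comp mF (@measurable_upd R 0)).
  have := @measurable_fun_fubini_tonelli_F _ _ _ _ _ N01 (fun p : sample_path * R => (\1_A (upd p.1 0 p.2) : R)%:E).
  by apply => // p; rewrite lee_fin.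
move=> z _; set a := tail_mean s t z n.
apply: (@le_trans _ _ (N01 `[((1 + t) * (- c - a))%R, ((1 + t) * (c - a))%R]%classic)); last first.
  apply: le_trans (N01_interval_le _) _; last by rewrite lee_fin; lra.
  by rewrite ler_wpM2l ?(ltW t1)// lerB// ge0_cp.
have mI : measurable (`[((1 + t) * (- c - a))%R, ((1 + t) * (c - a))%R]%classic : set R) by [].
rewrite (_ : N01 `[_, _]%classic = \int[N01]_x (\1_(`[((1 + t) * (- c - a))%R, ((1 + t) * (c - a))%R]%classic) x)%:E); last first.
  by rewrite integral_indic// setIT.
rewrite le_eqVlt; apply/orP; left; apply/eqP; apply: eq_integral => x _; rewrite !indicE.
have -> : (upd z 0 x \in A) = (`|post_mean s t (upd z 0 x) n| <= c)%R by apply/idP/idP; rewrite inE.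
rewrite [in RHS]mem_setE in_itv/= post_mean_first// -/a; congr (_%:R)%:E.
have key (v : R) : (`|a + v / (1 + t)| <= c)%R = ((1 + t) * (- c - a) <= v <= (1 + t) * (c - a))%R.
  rewrite ler_norml; congr andb; first by rewrite -lerBlDl ler_pdivlMr// mulrC.
  by rewrite -lerBrDl ler_pdivrMr// mulrC.
by rewrite key.
Qed.

Let Q n (z : sample_path) : R := (\sum_(i < n) z i ^+ 2 / (i.+1%:R + t))%R.

Let mQ n : measurable_fun setT (fun z => (Q n z)%:E).
Proof.
apply/measurable_EFinP; apply: measurable_sum => i; apply: measurable_funM => //.
by apply: measurable_funX; exact: measurable_coord.
Qed.

Let Q0 n z : (0 <= Q n z)%R.
Proof. by apply: sumr_ge0 => i _; rewrite divr_ge0 ?sqr_ge0// ltW// (tS_gt0 st). Qed.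

(** 130 = 65 * 2: the second moment is at most 65, each 1/(i+1+t) at most 1/sqrt(i+1), and these sum
    to at most 2 sqrt n. *)
Lemma weighted_square_mean n : \int[LL]_z (Q n z)%:E <= (130 * Num.sqrt n%:R)%:E.
Proof.
rewrite /Q; under eq_integral do rewrite -sumEFin.
have h0 (i : nat) (z : sample_path) : 0 <= (z i ^+ 2 / (i.+1%:R + t))%:E by rewrite lee_fin divr_ge0 ?sqr_ge0// ltW// (tS_gt0 st).
have mh i : measurable_fun setT (fun z : sample_path => (z i ^+ 2 / (i.+1%:R + t))%:E).
  apply/measurable_EFinP; apply: measurable_funM => //; apply: measurable_funX; exact: measurable_coord.
rewrite (ge0_integral_sum LL measurableT (fun i : 'I_n => mh i) (fun (i : 'I_n) z _ => h0 i z)).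
apply: (@le_trans _ _ (\sum_(i < n) (65 * (Num.sqrt i.+1%:R)^-1)%:E)); last first.
  rewrite sumEFin lee_fin -mulr_sumr (_ : 130 = 65 * 2 :> R)%R; last by rewrite -natrM.
  by rewrite -mulrA ler_wpM2l// sum_inv_sqrt_le.
apply: lee_sum => i _.
have t0 := t_ge0 st.
rewrite (_ : \int[LL]_z _ = (i.+1%:R + t)^-1%:E * \int[LL]_z (z i ^+ 2)%:E); last first.
  rewrite -ge0_integralZl//.
  - by apply: eq_integral => z _; rewrite -EFinM mulrC.
  - by apply/measurable_EFinP; apply: measurable_funX; exact: measurable_coord.
  - by move=> z _; rewrite lee_fin sqr_ge0.
  - by rewrite lee_fin invr_ge0 ltW// (tS_gt0 st).
rewrite mulrC EFinM; apply: lee_pmul => //.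
- by rewrite lee_fin invr_ge0 ltW// (tS_gt0 st).
- by apply: integral_ge0 => z _; rewrite lee_fin sqr_ge0.
- rewrite lee_fin lef_pV2 ?posrE ?sqrtr_gt0 ?ltr0n ?(tS_gt0 st)//.
  apply: (@le_trans _ _ (i.+1%:R : R)%R); last by rewrite lerDl.
  rewrite -[leRHS]ger0_norm// -sqrtr_sqr ler_sqrt ?sqr_ge0// -natrX ler_nat.
  by rewrite -mulnn leq_pmull.
rewrite (integral_coord iidLL i (f := fun x => (x ^+ 2)%:E)); first exact: N01_second_moment.
  by apply/measurable_EFinP; exact: measurable_funX.
by move=> x; rewrite lee_fin sqr_ge0.
Qed.

(** If the mean exceeds 2 dl in absolute value, the square in log Lambda_n contributes at least 2 n
    dl^2, while b < (n+1) dl^2/2 <= n dl^2. Staying below b then forces [Q n] >= 2 n dl^2 - t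
    (s/t)^2, and Markov's inequality applies. *)
Lemma log_lr_small (b dl : R) n : (0 < n)%N -> (0 < dl)%R -> (b < n.+1%:R * dl ^+ 2 / 2)%R ->
  (0 < 2 * n%:R * dl ^+ 2 - t * (s / t) ^+ 2)%R ->
  LL [set z | (log_lr s t z n < b)%R] <=
  (4 * dl * (1 + t) + 130 * Num.sqrt n%:R / (2 * n%:R * dl ^+ 2 - t * (s / t) ^+ 2))%:E.
Proof.
move=> n0 d0 bn; set c := (_ - _)%R => c0.
have mL : measurable [set z : sample_path | (log_lr s t z n < b)%R].
  rewrite (_ : [set z | _] = (fun z => log_lr s t z n) @^-1` `]-oo, b[%classic).
    by rewrite -[X in measurable X]setTI; exact: measurable_log_lr.
  by apply/seteqP; split => z /=; rewrite in_itv.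
have mM : measurable [set z : sample_path | (`|post_mean s t z n| <= 2 * dl)%R].
  rewrite (_ : [set z | _] = (fun z => `|post_mean s t z n|%R) @^-1` `]-oo, (2 * dl)%R]%classic).
    rewrite -[X in measurable X]setTI; apply: measurableT_comp => //; exact: measurable_post_mean.
  by apply/seteqP; split => z /=; rewrite in_itv.
have mQc : measurable [set z : sample_path | (c <= Q n z)%R].
  rewrite (_ : [set z | _] = (Q n) @^-1` `[c, +oo[%classic).
    by rewrite -[X in measurable X]setTI; have /measurable_EFinP := mQ n; apply.
  by apply/seteqP; split => z /=; rewrite in_itv/= andbT.
apply: (@le_trans _ _ (LL ([set z | (`|post_mean s t z n| <= 2 * dl)%R] `|` [set z | (c <= Q n z)%R]))).
  apply: le_measure; rewrite ?inE//; first exact: measurableU.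
  move=> z /= Lb; have [?|hM] := leP `|post_mean s t z n|%R (2 * dl)%R; [by left|right].
  move: Lb; rewrite (log_lr_quadratic st) -mulr_suml -/(Q n z) => Lb.
  have hM2 : (4 * dl ^+ 2 < post_mean s t z n ^+ 2)%R.
    rewrite -[ltRHS]real_normK ?num_real// (_ : 4 * dl ^+ 2 = (2 * dl) ^+ 2)%R; last by ring.
    by rewrite ltrXn2r// ?nnegrE// ltW// mulr_gt0.
  have n1 : (1 <= n%:R :> R)%R by rewrite ler1n.
  have t0 := t_ge0 st; have dd : (0 < dl ^+ 2)%R by rewrite exprn_gt0.
  move: Lb bn hM2; rewrite -[n.+1%:R]natr1 /c.
  move: (post_mean s t z n ^+ 2)%R (Q n z) ((s / t) ^+ 2)%R (n%:R : R)%R (dl ^+ 2)%R n1 dd => M q A k D k1 D0 Lb bn hM2.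
  have h1 : (k * (4 * D) <= k * M)%R by rewrite ler_wpM2l ?(ltW hM2)//; lra.
  have h2 : (t * (4 * D) <= t * M)%R by rewrite ler_wpM2l ?(ltW hM2).
  have h3 : (0 <= t * D)%R by rewrite mulr_ge0// ltW.
  have h4 : (D <= k * D)%R by rewrite ler_peMl// ltW.
  by nra.
apply: (le_trans (measureU2 _ _ _)) => //.
rewrite EFinD; apply: leeD.
  apply: le_trans (post_mean_small n0 _) _; first by rewrite mulr_ge0// ltW.
  by rewrite lee_fin; lra.
apply: (@le_trans _ _ ((c^-1)%:E * (c%:E * LL [set z | (c <= Q n z)%R]))).
  by rewrite muleA -EFinM mulVf ?gt_eqF// mul1e.
rewrite mulrC EFinM lee_wpmul2l//; first by rewrite lee_fin invr_ge0 ltW.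
apply: le_trans (weighted_square_mean n).
rewrite (_ : LL _ = \int[LL]_z (\1_[set z | (c <= Q n z)%R] z)%:E); last by rewrite integral_indic// setIT.
have mI : measurable_fun setT (fun z : sample_path => (\1_[set z | (c <= Q n z)%R] z : R)%:E).
  by apply/measurable_EFinP; exact: measurable_indic.
rewrite -(ge0_integralZl _ _ mI)//; last first.
  by rewrite lee_fin ltW.
apply: ge0_le_integral => //.
- by move=> z _; rewrite mule_ge0// lee_fin// ltW.
- exact: measurable_funeM.
- move=> z _; rewrite indicE -EFinM lee_fin.
  have [h|h] := leP c (Q n z); first by rewrite mem_set// mulr1.
  by rewrite memNset ?mulr0//= leNgt h.
Qed.

End stopping_tail.

(** * Complementary weights and two-sided bounds *)

Section sandwich.
Context (R : realType).
Local Notation mu := (@lebesgue_measure R).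
Local Notation sample_path := (sample_path R).
Local Open Scope ereal_scope.
Variable LL : probability sample_path R.
Hypothesis iidLL : iid_map LL idfun.
Variables (s t : R).
Hypothesis st : (0 < t \/ (s = 0 /\ t = 0))%R.
Local Notation L := (log_lr s t).
Local Notation hit b g n := (hit_term s t LL b g n).
Local Notation ew := (@exp_weight R).
Local Notation ew' := (fun u : R => (1 - exp_weight u)%R).
Implicit Types (b : R) (g : R -> R) (z : sample_path).

Lemma exp_weight_compl01 (u : R) : (0 <= 1 - exp_weight u <= 1)%R.
Proof. by have /andP[h1 h2] := exp_weight01 u; rewrite subr_ge0 h2 gerBl h1. Qed.

Lemma measurable_exp_weight_compl : measurable_fun setT ew'.
Proof. by apply: measurable_funB => //; exact: measurable_exp_weight. Qed.

Let mH b n : measurable [set z : sample_path | first_hit b (L z) n].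
Proof. by apply: (measurable_first_hit b n (l := fun n z => L z n)) => j; exact: measurable_log_lr. Qed.

Let m1 b n : measurable_fun setT (fun z : sample_path => (\1_[set z | first_hit b (L z) n] z : R)).
Proof. exact: measurable_indic. Qed.

Let mint b g n : measurable_fun setT g ->
  measurable_fun setT (fun z : sample_path => ((\1_[set z | first_hit b (L z) n] z * g (L z n - b))%R)%:E).
Proof.
move=> mg; apply/measurable_EFinP; apply: measurable_funM => //.
by apply: measurableT_comp => //; apply: measurable_funB => //; exact: measurable_log_lr.
Qed.

Lemma hit_term_ge0 b g n : (forall u, 0 <= g u)%R -> 0 <= hit b g n.
Proof. by move=> g0; apply: integral_ge0 => z _; rewrite lee_fin mulr_ge0. Qed.

Lemma hit_term_le b g n : measurable_fun setT g -> (forall u, 0 <= g u <= 1)%R -> hit b g n <= hit b (cst 1%R) n.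
Proof.
move=> mg g01; apply: ge0_le_integral => //.
- by move=> z _; rewrite lee_fin mulr_ge0//; case/andP: (g01 (L z n - b)%R).
- exact: mint.
- exact: mint.
- by move=> z _; rewrite lee_fin ler_wpM2l//; case/andP: (g01 (L z n - b)%R).
Qed.

Lemma hit_term_compl b n : hit b ew n + hit b ew' n = hit b (cst 1%R) n.
Proof.
rewrite /hit_term -ge0_integralD//; last 4 first.
- by move=> z _; rewrite lee_fin mulr_ge0//; case/andP: (exp_weight01 (L z n - b)%R).
- by apply: mint; exact: measurable_exp_weight.
- by move=> z _; rewrite lee_fin mulr_ge0//; case/andP: (exp_weight_compl01 (L z n - b)%R).
- exact: (mint b n measurable_exp_weight_compl).
by apply: eq_integral => z _; rewrite -EFinD -mulrDr addrC subrK.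
Qed.

Lemma hit_term_exp b n : hit b (fun u => expR (- u))%R n = hit b ew n.
Proof.
apply: eq_integral => z _; rewrite !indicE; congr (_%:E).
have [|] := boolP (z \in [set z | first_hit b (L z) n]); last by rewrite !mul0r.
by rewrite inE /= => /first_hitP[_ h _]; rewrite /exp_weight max_r// subr_ge0.
Qed.

(** The indicator that the first crossing occurs before time [M], as a sum over the crossing
    times. *)
Let count b M z : R := (\sum_(0 <= n < M) \1_[set z | first_hit b (L z) n] z)%R.

Let count_sum b M : \sum_(0 <= n < M) hit b (cst 1%R) n = \int[LL]_z (count b M z)%:E.
Proof.
rewrite /count; under [RHS]eq_integral do rewrite -sumEFin.
rewrite (ge0_integral_sum LL measurableT (f := fun n (z : sample_path) => (\1_[set z | first_hit b (L z) n] z)%:E)).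
- by apply: eq_bigr => n _; apply: eq_integral => z _; rewrite mulr1.
- by move=> n; apply/measurable_EFinP.
- by move=> n z _; rewrite lee_fin.
Qed.

Let count_le1 b M z : (count b M z <= 1)%R.
Proof.
rewrite /count; elim: M => [|M IH]; first by rewrite big_nil.
rewrite big_nat_recr//= indicE.
have [|] := boolP (z \in [set z | first_hit b (L z) M]); last by rewrite addr0.
rewrite inE /= => hM; rewrite big_nat big1 ?add0r// => n nM.
rewrite indicE memNset//= => hn; move: nM; rewrite (first_hit_uniq hn hM).
by rewrite ltnn andbF.
Qed.

Let count_ge1 b m z : (0 < m)%N -> (b <= L z m)%R -> (1 <= count b m.+1 z)%R.
Proof.
move=> m0 bm; have [n hn] := first_hit_ex m0 bm.
have nm : (n < m.+1)%N.
  rewrite ltnS leqNgt; apply/negP => mn; have [_ _ h] := first_hitP hn.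
  by have := h m; rewrite m0 mn => /(_ isT); rewrite ltNge bm.
rewrite /count (bigD1_seq n) ?mem_index_iota ?iota_uniq//.
by rewrite indicE mem_set// lerDl sumr_ge0.
Qed.

Let mcount b M : measurable_fun setT (fun z => (count b M z)%:E).
Proof. by apply/measurable_EFinP; apply: measurable_sum. Qed.

Let count0 b M z : (0 <= count b M z)%R.
Proof. by apply: sumr_ge0. Qed.

Lemma hit_sum_le1 b M : \sum_(0 <= n < M) hit b (cst 1%R) n <= 1.
Proof.
rewrite count_sum -(integral_prob_cst LL 1); apply: ge0_le_integral => //.
- by move=> z _; rewrite lee_fin.
- by move=> z _; rewrite lee_fin.
Qed.

(** Either the level has been reached by time [m], or log Lambda_m is below it. *)
Lemma hit_sum_ge1 b m : (0 < m)%N ->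
  1 <= \sum_(0 <= n < m.+1) hit b (cst 1%R) n + LL [set z | (L z m < b)%R].
Proof.
move=> m0; set A : set sample_path := [set z | _].
have mA : measurable A.
  rewrite (_ : A = (fun z => L z m) @^-1` `]-oo, b[%classic).
    by rewrite -[X in measurable X]setTI; exact: measurable_log_lr.
  by apply/seteqP; split => z /=; rewrite in_itv.
have mI : measurable_fun setT (fun z : sample_path => (\1_A z : R)%:E).
  by apply/measurable_EFinP; exact: measurable_indic.
rewrite count_sum (_ : LL A = \int[LL]_z (\1_A z)%:E); last by rewrite integral_indic// setIT.
rewrite -ge0_integralD//; last first.
  by move=> z _; rewrite lee_fin.
rewrite -[leLHS](integral_prob_cst LL 1); apply: ge0_le_integral => //.
- exact: emeasurable_funD.
- move=> z _; rewrite -EFinD lee_fin indicE.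
  have [h|h] := ltP (L z m) b; first by rewrite mem_set// lerDr.
  have nA : ~ A z by rewrite /A /= ltNge h.
  by rewrite (memNset nA) addr0 count_ge1.
Qed.

Let hit_fin b g n : measurable_fun setT g -> (forall u, 0 <= g u <= 1)%R -> hit b g n \is a fin_num.
Proof.
move=> mg g01; rewrite ge0_fin_numE; last by apply: hit_term_ge0 => u; case/andP: (g01 u).
apply: (@le_lt_trans _ _ 1); last exact: ltry.
apply: le_trans (hit_term_le b n mg g01) _; apply: le_trans (hit_sum_le1 b n.+1).
rewrite big_nat_recr//= leeDr//; apply: sume_ge0 => i _; exact: hit_term_ge0.
Qed.

(** Crossing times are disjoint events, so those after [m] have total probability at most P(log
    Lambda_m < b). *)
Lemma hit_series_le b m : (0 < m)%N ->
  \sum_(0 <= n <oo) hit b (fun u => expR (- u))%R n <=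
  \sum_(0 <= n < m.+1) hit b ew n + LL [set z | (L z m < b)%R].
Proof.
move=> m0.
have e0 n : 0 <= hit b ew n by apply: hit_term_ge0 => u; case/andP: (exp_weight01 u).
rewrite (eq_eseriesr (fun n _ => hit_term_exp b n)).
apply: lime_le; first exact: is_cvg_nneseries.
near=> M.
have mM : (m.+1 <= M)%N by near: M; exact: nbhs_infty_ge.
rewrite (@big_cat_nat _ _ _ m.+1)//= leeD2l//.
apply: (@le_trans _ _ (\sum_(m.+1 <= n < M) hit b (cst 1%R) n)).
  apply: lee_sum => n _; apply: hit_term_le; [exact: measurable_exp_weight|exact: exp_weight01].
have f : \sum_(0 <= n < m.+1) hit b (cst 1%R) n \is a fin_num.
  apply/sum_fin_numP => n _ _; apply: hit_fin => // u; by rewrite ler01 lexx.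
rewrite -(leeD2lE _ _ f); apply: le_trans (hit_sum_ge1 b m0).
by rewrite -(@big_cat_nat _ _ _ m.+1)//; exact: hit_sum_le1.
Unshelve. all: end_near. Qed.

(* The complementary weight turns the upper bounds on partial sums into a lower bound. *)
Lemma hit_series_ge b m : (0 < m)%N ->
  1 <= \sum_(0 <= n <oo) hit b (fun u => expR (- u))%R n +
    (\sum_(0 <= n < m.+1) hit b ew' n + LL [set z | (L z m < b)%R]).
Proof.
move=> m0; apply: (le_trans (hit_sum_ge1 b m0)); rewrite addeA leeD2r//.
have e0 n : 0 <= hit b ew n by apply: hit_term_ge0 => u; case/andP: (exp_weight01 u).
rewrite (eq_eseriesr (fun n _ => hit_term_exp b n)).
apply: (@le_trans _ _ (\sum_(0 <= n < m.+1) hit b ew n + \sum_(0 <= n < m.+1) hit b ew' n)); last first.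
  by rewrite leeD2r//; apply: nneseries_lim_ge.
rewrite -big_split/= le_eqVlt; apply/orP; left; apply/eqP; apply: eq_bigr => n _.
by rewrite hit_term_compl.
Qed.

(** Time 0 is never a crossing time, and time 1 is set apart because the quadratic in the mean needs
    n >= 2. *)
Lemma hit_sum_first b g N : measurable_fun setT g -> (forall u, 0 <= g u <= 1)%R ->
  \sum_(0 <= n < N.+2) hit b g n <= LL [set z | (b <= L z 1)%R] + \sum_(1 <= k < N.+1) hit b g k.+1.
Proof.
move=> mg g01; have g0 u : (0 <= g u)%R by case/andP: (g01 u).
rewrite big_nat_recl// big_nat_recl// addeA [X in _ <= _ + X]big_add1 leeD//.
have -> : hit b g 0 = 0.
  rewrite /hit_term (_ : (fun z => _) = cst 0) ?integral0//; apply/funext => z /=.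
  by rewrite indicE memNset ?mul0r//=.
rewrite add0e; apply: le_trans (hit_term_le b 1 mg g01) _.
have mA : measurable [set z : sample_path | (b <= L z 1)%R].
  rewrite (_ : [set z | _] = (fun z => L z 1) @^-1` `[b, +oo[%classic).
    by rewrite -[X in measurable X]setTI; exact: measurable_log_lr.
  by apply/seteqP; split => z /=; rewrite in_itv/= andbT.
rewrite /hit_term; under eq_integral do rewrite mulr1.
rewrite integral_indic// setIT; apply: le_measure; rewrite ?inE//.
by move=> z /= /first_hitP[].
Qed.

Lemma first_step_cvg (b_ : nat -> R) : b_ j @[j --> \oo] --> +oo%R ->
  LL [set z | (b_ j <= L z 1)%R] @[j --> \oo] --> 0.
Proof.
move=> b_y.
have mA j : measurable [set z : sample_path | (b_ j <= L z 1)%R].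
  rewrite (_ : [set z | _] = (fun z => L z 1) @^-1` `[b_ j, +oo[%classic).
    by rewrite -[X in measurable X]setTI; exact: measurable_log_lr.
  by apply/seteqP; split => z /=; rewrite in_itv/= andbT.
rewrite (_ : (fun j => _) = (fun j => \int[LL]_z (\1_[set z | (b_ j <= L z 1)%R] z)%:E)); last first.
  by apply/funext => j; rewrite integral_indic// setIT.
apply: (@bounded_cvg0 R _ _ LL _ 1).
- by move=> j; apply/measurable_EFinP; exact: measurable_indic.
- by move=> j z; rewrite lee_fin.
- by move=> j z; rewrite lee_fin indicE; case: (_ \in _).
- apply: aeW => z; apply: (@cvg_near_cst _ _ _ _ _ _).
  have h : \forall j \near \oo, (L z 1 < b_ j)%R by move/cvgryPgt : b_y; apply.
  by apply: filterS h => j h; rewrite indicE memNset//= leNgt h.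
Qed.

End sandwich.

(** * The limit of the mean overshoot factor *)

Section limit_law.
Context (R : realType).
Local Notation mu := (@lebesgue_measure R).
Local Notation N01 := (normal_prob 0 1 : probability (measurableTypeR R) R).
Local Notation sample_path := (sample_path R).
Local Open Scope ereal_scope.

Lemma ereal_near_lt (f_ : nat -> \bar R) (l c : \bar R) : f_ j @[j --> \oo] --> l -> l < c ->
  \forall j \near \oo, f_ j < c.
Proof.
move=> fl lc; have h : nbhs l [set x | x < c].
  by apply: open_nbhs_nbhs; split => //; exact: open_ereal_lt_ereal.
exact: fl _ h.
Qed.

Lemma nuN (y : R) : nu (- y) = nu y.
Proof. by rewrite /nu sqrrN normrN. Qed.

Lemma nu_gt0 (y : R) : y != 0%R -> (0 < nu y)%R.
Proof. by move=> y0; rewrite /nu mulr_gt0 ?expR_gt0// mulr_gt0// invr_gt0 exprn_even_gt0. Qed.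

Lemma measurable_std_normal_cdf : measurable_fun setT (@std_normal_cdf R).
Proof.
apply: (@measurableT_comp _ _ _ _ _ _ fine); first exact: fine_measurable.
pose A := [set p : measurableTypeR R * measurableTypeR R | (p.2 <= p.1)%R].
have mA : measurable A.
  rewrite (_ : A = (fun p => (p.1 - p.2)%R) @^-1` `[0%R, +oo[%classic).
    by rewrite -[X in measurable X]setTI; apply: measurable_funB.
  by apply/seteqP; split => p /=; rewrite in_itv/= andbT subr_ge0.
have h := measurable_fun_xsection N01 mA.
apply: eq_measurable_fun h => y _ /=; congr (N01 _).
by apply/seteqP; split => x; rewrite /xsection/= inE /A /= in_itv.
Qed.

(** For y > 0 the series is a pointwise limit of measurable partial sums; evenness covers y < 0, and
    the point 0 is split off. *)
Lemma measurable_nu : measurable_fun setT (@nu R).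
Proof.
have mpos : measurable_fun (`]0%R, +oo[%classic : set R) (@nu R).
  apply: measurable_funM.
    apply: measurable_funM => //; apply: measurable_funTS.
    by apply: (measurableT_comp (@measurable_inv R)); exact: measurable_funX.
  apply: measurableT_comp => //; apply: measurable_funM => //.
  apply: (measurable_fun_cvg (h := fun n y => (\sum_(k < n) neg_cdf y k.+1 / k.+1%:R)%R)).
    move=> n; apply: measurable_funTS; apply: measurable_sum => k; apply: measurable_funM => //.
    apply: (measurableT_comp measurable_std_normal_cdf); apply: measurableT_comp => //.
    by apply: measurable_funM => //; apply: measurable_funM => //; exact: measurable_normr.
  by move=> y; rewrite /= in_itv/= andbT => y0; apply: neg_cdf_series_cvg; rewrite gt_eqF.
have mp : measurable_fun setT ((@nu R) \_ (`]0%R, +oo[%classic : set R)).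
  by apply/(measurable_restrictT _ _).1.
have mE : measurable_fun setT (fun y : R => ((@nu R) \_ (`]0%R, +oo[%classic : set R)) `|y|%R).
  by apply: measurableT_comp => //; exact: measurable_normr.
rewrite (_ : @nu R = (fun y => if y == 0%R then nu 0%R else ((@nu R) \_ (`]0%R, +oo[%classic : set R)) `|y|%R)); last first.
  apply/funext => y; case: eqVneq => [->//|y0].
  have yp : (`|y|%R \in (`]0%R, +oo[%classic : set R)) by rewrite mem_setE in_itv/= andbT normr_gt0.
  rewrite patchE yp.
  have [h|h] := leP 0%R y; first by rewrite (ger0_norm h).
  by rewrite (ltr0_norm h) nuN.
apply: measurable_fun_ifT; [|exact: measurable_cst|exact: mE].
by apply: measurable_fun_eqr; [exact: measurable_id|exact: measurable_cst].
Qed.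

Lemma ge0_integral_fold (f : R -> \bar R) : measurable_fun setT f -> (forall y, 0 <= f y) ->
  \int[mu]_y f y = \int[mu]_(y in `]0%R, +oo[) (f y + f (- y)%R).
Proof.
move=> mf f0.
have mN : measurable_fun setT (fun y : R => f (- y)%R) by apply: measurableT_comp => //; exact: measurable_funN.
have mneg : measurable (`]-oo, 0%R[%classic : set R) by [].
rewrite ge0_integralD//; [|exact: measurable_funTS|exact: measurable_funTS].
rewrite integral_itv_obnd_cbnd; last exact: measurable_funTS.
have -> : \int[mu]_(y in `]0%R, +oo[) f (- y)%R = \int[mu]_(y in `]-oo, 0%R[) f y.
  rewrite [RHS]integral_mkcond ge0_integral_opp; last 2 first.
  - by apply/(measurable_restrictT _ _).1 => //; exact: measurable_funTS.
  - by move=> y; rewrite patchE; case: ifP.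
  rewrite integral_mkcond; apply: eq_integral => y _; rewrite !patchE !mem_setE !in_itv/= andbT.
  by rewrite oppr_lt0.
rewrite addeC -ge0_integral_setU//.
- congr (integral _ _ _); apply/seteqP; split => y //= _; rewrite !in_itv/= andbT.
  by have [h|h] := ltP y 0%R; [left|right].
- exact: measurable_funTS.
- apply/disj_setPS => y /=; rewrite !in_itv/= andbT => -[h1 h2].
  by move: h1; rewrite ltNge h2.
Qed.

Variable LL : probability sample_path R.
Hypothesis iidLL : iid_map LL idfun.
Variables (s t : R).
Hypothesis st : (0 < t \/ (s = 0 /\ t = 0))%R.
Local Notation ew := (@exp_weight R).
Local Notation ew' := (fun u : R => (1 - exp_weight u)%R).

(** The density of |Y| for Y of law G, the two branches of the mean being merged. *)
Definition fold_pdf (y : R) : R := (limit_pdf s t y + limit_pdf s t (- y))%R.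

Let sd_gt0 : (0 < Num.sqrt (G_variance t))%R.
Proof. by rewrite sqrtr_gt0; have [] := old_sd_cvg st. Qed.

Lemma limit_pdfE y : limit_pdf s t y = normal_pdf (s / t) (Num.sqrt (G_variance t)) y.
Proof.
rewrite /limit_pdf /mean_pdf /normal_pdf oner_eq0 gt_eqF// /normal_fun /normal_peak expr1n !mul1r.
set v := Num.sqrt (G_variance t); have v0 : v != 0%R by rewrite gt_eqF.
rewrite -mulrnAr sqrtrM ?sqr_ge0// sqrtr_sqr gtr0_norm// invfM mulrA; congr (_ * expR _)%R.
rewrite subr0 exprMn exprVn -mulr_natr -(mulr_natr (v ^+ 2)) mul1r.
by move: ((y - s / t) ^+ 2)%R => q; field; rewrite v0.
Qed.

Lemma measurable_limit_pdf : measurable_fun setT (limit_pdf s t).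
Proof.
rewrite (_ : limit_pdf s t = normal_pdf (s / t) (Num.sqrt (G_variance t))); first exact: measurable_normal_pdf.
by apply/funext => y; exact: limit_pdfE.
Qed.

Lemma measurable_fold_pdf : measurable_fun setT fold_pdf.
Proof.
apply: measurable_funD; first exact: measurable_limit_pdf.
by apply: (measurableT_comp measurable_limit_pdf); exact: measurable_funN.
Qed.

Lemma fold_pdf_ge0 y : (0 <= fold_pdf y)%R.
Proof. by rewrite addr_ge0 ?limit_pdf_ge0. Qed.

Lemma fold_pdf_gt0 y : (0 < fold_pdf y)%R.
Proof.
rewrite ltr_pwDl ?limit_pdf_ge0// limit_pdfE /normal_pdf gt_eqF//.
by rewrite mulr_gt0 ?expR_gt0// normal_peak_gt0// gt_eqF.
Qed.

Lemma integral_fold_pdf : \int[mu]_(y in `]0%R, +oo[) (fold_pdf y)%:E = 1.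
Proof.
rewrite -(integral_normal_pdf (s / t) (Num.sqrt (G_variance t))).
rewrite ge0_integral_fold.
- by apply: eq_integral => y _; rewrite /fold_pdf !limit_pdfE EFinD.
- by apply/measurable_EFinP; exact: measurable_normal_pdf.
- by move=> y; rewrite lee_fin normal_pdf_ge0.
Qed.

Definition gamma_pos : \bar R := \int[mu]_(y in `]0%R, +oo[) (fold_pdf y * nu y)%:E.
Definition gamma_neg : \bar R := \int[mu]_(y in `]0%R, +oo[) (fold_pdf y * (1 - nu y))%:E.

Let mfn (D : set R) : measurable_fun D (fun y => (fold_pdf y * nu y)%:E).
Proof.
apply: measurable_funTS; apply/measurable_EFinP.
apply: measurable_funM; [exact: measurable_fold_pdf|exact: measurable_nu].
Qed.

Let mfn' (D : set R) : measurable_fun D (fun y => (fold_pdf y * (1 - nu y))%:E).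
Proof.
apply: measurable_funTS; apply/measurable_EFinP.
by apply: measurable_funM; [exact: measurable_fold_pdf|apply: measurable_funB => //; exact: measurable_nu].
Qed.

Let fn0 y : (0 < y)%R -> 0 <= (fold_pdf y * nu y)%:E.
Proof. by move=> y0; rewrite lee_fin mulr_ge0 ?fold_pdf_ge0// ltW// nu_gt0// gt_eqF. Qed.

Let fn0' y : (0 < y)%R -> 0 <= (fold_pdf y * (1 - nu y))%:E.
Proof.
move=> y0; rewrite lee_fin mulr_ge0 ?fold_pdf_ge0// subr_ge0.
by have /andP[] := nu_le1 iidLL (lt0r_neq0 y0).
Qed.

Lemma gamma_posneg : gamma_pos + gamma_neg = 1.
Proof.
rewrite -integral_fold_pdf -ge0_integralD//.
- by apply: eq_integral => y _; rewrite -EFinD -mulrDr addrC subrK mulr1.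
- by move=> y; rewrite /= in_itv/= andbT; exact: fn0.
- exact: mfn.
- by move=> y; rewrite /= in_itv/= andbT; exact: fn0'.
- exact: mfn'.
Qed.

Lemma gamma_posE : gamma s t = gamma_pos.
Proof.
have [v0 _] := old_sd_cvg st.
have mnu : measurable_fun setT (fun y : R => (nu y)%:E) by apply/measurable_EFinP; exact: measurable_nu.
have nu0 y : 0 <= (nu y : R)%:E.
  by rewrite lee_fin /nu mulr_ge0 ?expR_ge0// mulr_ge0// invr_ge0 sqr_ge0.
rewrite /gamma (@ge0_integral_transfer _ _ (measurableTypeR R) (measurableTypeR R) R mu
  idfun (limit_pdf s t) (@measurable_id _ _ _) measurable_limit_pdf
  (limit_pdf_ge0 s t) (G s t) _ (fun y : R => (nu y)%:E) mnu nu0); last first.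
  move=> A mA; rewrite /= /normal_prob integral_mkcond.
  apply: eq_integral => x _; rewrite patchE indicE limit_pdfE.
  by case: (x \in A); rewrite ?mul1r ?mul0r.
rewrite ge0_integral_fold.
- by apply: eq_integral => y _; rewrite nuN /fold_pdf -!EFinM -EFinD; congr _%:E; ring.
- apply: emeasurable_funM => //; apply/measurable_EFinP; exact: measurable_limit_pdf.
- by move=> y; rewrite mule_ge0// lee_fin limit_pdf_ge0.
Qed.

(** Finiteness comes from the total mass 1. Were the integral 0, the positivity of the integrand
    would make ]0, +oo[ a null set. *)
Lemma gamma_fin_gt0 : gamma s t \is a fin_num /\ 0 < gamma s t.
Proof.
have p0 : 0 <= gamma_pos by apply: integral_ge0 => y; rewrite /= in_itv/= andbT; exact: fn0.
have n0 : 0 <= gamma_neg by apply: integral_ge0 => y; rewrite /= in_itv/= andbT; exact: fn0'.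
rewrite gamma_posE; split.
  by rewrite ge0_fin_numE// (@le_lt_trans _ _ 1) ?ltry// -gamma_posneg leeDl.
rewrite lt_neqAle p0 andbT eq_sym; apply/eqP => g0.
have mD : measurable (`]0%R, +oo[%classic : set R) by [].
have e0 : \int[mu]_(y in `]0%R, +oo[) `|(fold_pdf y * nu y)%:E| = 0.
  rewrite -[RHS]g0; apply: eq_integral => y; rewrite inE /= in_itv/= andbT => y0.
  by rewrite -[LHS]/(`|(fold_pdf y * nu y)%:E|) gee0_abs// fn0.
have [h _] := ae_eq_integral_abs mu mD (@mfn _).
have [N [mN N0 sN]] := h e0.
have : mu `]0%R, +oo[%classic <= mu N.
  apply: le_measure; rewrite ?inE// => y y0; apply: sN => /= /(_ y0) [] /eqP.
  move: y0; rewrite /= in_itv/= andbT => y0.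
  by rewrite mulf_eq0 !gt_eqF// ?fold_pdf_gt0// nu_gt0// gt_eqF.
by rewrite N0 lebesgue_measure_itv/= ltry oppr0 leye_eq.
Qed.

Let measurable_walk_above_prob n (x : R) :
  measurable_fun setT (fun u : R => LL [set w | walk_above n.+1 x w u]).
Proof.
pose A := [set p : measurableTypeR R * sample_path | (p.1 < ladder x n p.2)%R].
have mA : measurable A.
  rewrite (_ : A = (fun p => (ladder x n p.2 - p.1)%R) @^-1` `]0%R, +oo[%classic).
    rewrite -[X in measurable X]setTI; apply: measurable_funB => //.
    exact: (measurableT_comp (@measurable_ladder R x n) (@measurable_snd _ _ _ _)).
  by apply/seteqP; split => p /=; rewrite in_itv/= andbT subr_gt0.
have h := measurable_fun_xsection LL mA.
apply: eq_measurable_fun h => u _ /=; congr (LL _).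
by apply/seteqP; split => w; rewrite /xsection/= inE /A /= walk_above_ladder.
Qed.

Lemma limit_termE n (g : R -> R) y : measurable_fun setT g -> (forall u, 0 <= g u)%R ->
  limit_term s t LL n.+1 g y = (2 / y ^+ 2)%:E *
   ((limit_pdf s t y)%:E * ladder_int LL y n g + (limit_pdf s t (- y))%:E * ladder_int LL (- y) n g).
Proof.
move=> mg g0; rewrite /limit_term mul1r mulN1r /ladder_int; congr (_ * _).
pose h (x u : R) := LL [set w | walk_above n.+1 x w u] * (g u)%:E.
have mD : measurable (`]0%R, +oo[%classic : set R) by [].
have mh (x : R) : measurable_fun (`]0%R, +oo[%classic : set R) (h x).
  apply: measurable_funTS; apply: emeasurable_funM; last by apply/measurable_EFinP.
  exact: measurable_walk_above_prob.
have h0 (x u : R) : 0 <= h x u by rewrite mule_ge0// lee_fin.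
have l0 x : 0 <= (limit_pdf s t x)%:E by rewrite lee_fin limit_pdf_ge0.
rewrite -(ge0_integralZl mu mD (mh y) (fun u _ => h0 y u) (l0 y)).
rewrite -(ge0_integralZl mu mD (mh (- y)%R) (fun u _ => h0 (- y)%R u) (l0 (- y)%R)).
rewrite -(ge0_integralD mu mD (fun u _ => mule_ge0 (l0 y) (h0 y u)) (measurable_funeM _ (mh y))
  (fun u _ => mule_ge0 (l0 (- y)%R) (h0 (- y)%R u)) (measurable_funeM _ (mh (- y)%R))).
by apply: eq_integral => u _; rewrite /h !muleA ge0_muleDl// mule_ge0.
Qed.

Lemma limit_term_cvg (g : R -> R) (l : R -> R) y : measurable_fun setT g -> (forall u, 0 <= g u)%R ->
  (0 < y)%R -> l (- y)%R = l y ->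
  (forall x, x != 0%R -> ladder_int LL x n g @[n --> \oo] --> (x ^+ 2 / 2 * l x)%:E) ->
  limit_term s t LL n.+1 g y @[n --> \oo] --> (fold_pdf y * l y)%:E.
Proof.
move=> mg g0 y0 ly lc; have y1 : y != 0%R by rewrite gt_eqF.
under eq_fun do rewrite limit_termE//.
rewrite (_ : (fold_pdf y * l y)%:E = (2 / y ^+ 2)%:E *
  ((limit_pdf s t y)%:E * (y ^+ 2 / 2 * l y)%:E + (limit_pdf s t (- y))%:E * ((- y) ^+ 2 / 2 * l (- y))%:E)); last first.
  by rewrite -!EFinM ly /fold_pdf sqrrN; congr _%:E; field.
apply: cvgeM => //; first exact: cvg_cst.
apply: cvgeD => //; apply: cvgeM => //; try exact: cvg_cst; apply: lc => //.
by rewrite oppr_eq0.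
Qed.

(** 2 [step_bound y] / y^2 = 130/y + 1, which is bounded for y > dl. *)
Lemma limit_term_le n (g : R -> R) (dl y : R) : measurable_fun setT g -> (forall u, 0 <= g u <= 1)%R ->
  (0 < dl)%R -> (dl < y)%R ->
  limit_term s t LL n.+1 g y <= (fold_pdf y * (130 / dl + 1))%:E.
Proof.
move=> mg g01 d0 dy; have y0 := lt_trans d0 dy.
rewrite limit_termE//; last by move=> u; case/andP: (g01 u).
have sb x : ladder_int LL x n g <= (step_bound x)%:E by exact: ladder_int_le.
apply: (@le_trans _ _ ((2 / y ^+ 2)%:E * ((limit_pdf s t y)%:E * (step_bound y)%:E + (limit_pdf s t (- y))%:E * (step_bound (- y))%:E))).
  rewrite lee_wpmul2l ?lee_fin ?divr_ge0 ?sqr_ge0//.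
  by rewrite leeD// lee_wpmul2l// lee_fin limit_pdf_ge0.
rewrite -!EFinM lee_fin /step_bound normrN sqrrN -mulrDl -/(fold_pdf y).
rewrite mulrCA ler_wpM2l ?fold_pdf_ge0// gtr0_norm//.
rewrite (_ : 2 / y ^+ 2 * (y * 65 + y ^+ 2 / 2) = 130 / y + 1)%R; last by field; rewrite gt_eqF.
by rewrite lerD2r ler_wpM2l// lef_pV2 ?posrE// ltW.
Qed.

(** A sample sequence tending to infinity, along which [limit_term] is a limit of functions
    measurable in y. *)
Let b1 (j : nat) : R := j.+1%:R.

Let b1_y : b1 j @[j --> \oo] --> +oo%R.
Proof. by rewrite /b1; rewrite (cvg_shiftS (fun n => n%:R : R)); exact: cvgr_idn. Qed.

(** The passage K -> oo, made after b -> oo and at fixed [dl]. *)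
Lemma limit_integral_cvg (g : R -> R) (l : R -> R) (dl : R) : measurable_fun setT g -> (forall u, 0 <= g u <= 1)%R ->
  (0 < dl)%R -> (forall y, l (- y)%R = l y) ->
  (forall x, x != 0%R -> ladder_int LL x n g @[n --> \oo] --> (x ^+ 2 / 2 * l x)%:E) ->
  \int[mu]_(y in `]dl, +oo[) limit_term s t LL n.+1 g y @[n --> \oo] -->
  \int[mu]_(y in `]dl, +oo[) (fold_pdf y * l y)%:E.
Proof.
move=> mg g01 d0 ly lc.
have mD : measurable (`]dl, +oo[%classic : set R) by [].
apply: (@ge0_dominated_cvg R _ _ mu `]dl, +oo[%classic (fun n y => limit_term s t LL n.+1 g y) _ (fun y => (fold_pdf y * (130 / dl + 1))%:E) mD).
- move=> n; apply: (emeasurable_fun_cvg (fun j y => kern_term s t LL n.+1 g (b1 j) (grid_index (b1 j) y))).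
    by move=> j; apply: measurable_funTS; exact: measurable_grid_index.
  move=> y; rewrite /= in_itv/= andbT => dy.
  by apply: (kern_term_cvg st iidLL _ mg g01 b1_y) => //; exact: lt_trans d0 dy.
- move=> n y _; rewrite limit_termE//; last by move=> u; case/andP: (g01 u).
  have i0 x : 0 <= ladder_int LL x n g.
    by apply: integral_ge0 => u _; rewrite mule_ge0// lee_fin; case/andP: (g01 u).
  by rewrite mule_ge0 ?lee_fin ?divr_ge0 ?sqr_ge0// adde_ge0// mule_ge0// lee_fin limit_pdf_ge0.
- by move=> n y; rewrite /= in_itv/= andbT => dy; exact: limit_term_le.
- have mf : measurable_fun `]dl, +oo[%classic (fun y => (fold_pdf y * (130 / dl + 1))%:E).
    apply: measurable_funTS; apply/measurable_EFinP; apply: measurable_funM => //; exact: measurable_fold_pdf.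
  have c0 : (0 <= 130 / dl + 1)%R by rewrite addr_ge0// divr_ge0// ltW.
  apply/integrableP; split => //.
  apply: (@le_lt_trans _ _ ((130 / dl + 1)%:E * 1)); last by rewrite mule1 ltry.
  rewrite -integral_fold_pdf -ge0_integralZl//.
  + under eq_integral do rewrite gee0_abs ?lee_fin ?mulr_ge0 ?fold_pdf_ge0//.
    under eq_integral do rewrite mulrC EFinM.
    apply: ge0_subset_integral => //.
    * by apply: measurable_funeM; apply: measurable_funTS; apply/measurable_EFinP; exact: measurable_fold_pdf.
    * by move=> y _; rewrite mule_ge0// lee_fin fold_pdf_ge0.
    * by move=> y; rewrite /= !in_itv/= !andbT; exact: lt_trans.
  + by apply: measurable_funTS; apply/measurable_EFinP; exact: measurable_fold_pdf.
  + by move=> y _; rewrite lee_fin fold_pdf_ge0.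
- move=> y; rewrite /= in_itv/= andbT => dy.
  by apply: limit_term_cvg => // [u|]; [case/andP: (g01 u)|exact: lt_trans d0 dy].
Qed.

(** The parameters are chosen in the order [dl], K, b: [dl] makes late crossings rare, K brings the
    limiting upper bound close to [V], and then b is large. Both weights are treated by this
    statement, each with its own [l] and [V]. *)
Lemma near_partial_sum_le (g : R -> R) (l : R -> R) (V e : R) (b_ : nat -> R) :
  measurable_fun setT g -> (forall u, 0 <= g u <= 1)%R ->
  (forall y, l (- y)%R = l y) ->
  (forall x, x != 0%R -> ladder_int LL x n g @[n --> \oo] --> (x ^+ 2 / 2 * l x)%:E) ->
  (forall dl : R, (0 < dl)%R -> \int[mu]_(y in `]dl, +oo[) (fold_pdf y * l y)%:E <= V%:E) ->
  (0 < e)%R -> b_ j @[j --> \oo] --> +oo%R -> (forall j, 0 < b_ j)%R ->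
  \forall j \near \oo, exists2 m, (0 < m)%N &
    \sum_(0 <= n < m.+1) hit_term s t LL (b_ j) g n + LL [set z | (log_lr s t z m < b_ j)%R] <= (V + e)%:E.
Proof.
move=> mg g01 ly lc lV e0 b_y b0.
have t0 := t_ge0 st; have t1 : (0 < 1 + t)%R by rewrite ltr_wpDr.
(* Four errors of e/4: the excess of the integral, a crossing at time 1, a small mean, a large sum
   of squares. The choice of [dl] makes 4 dl (1 + t) equal to e/4. *)
pose e4 := (e / 4)%R; have e40 : (0 < e4)%R by rewrite divr_gt0.
pose dl := (e4 / (4 * (1 + t)))%R.
have d0 : (0 < dl)%R by rewrite divr_gt0// mulr_gt0.
have d2 : (0 < dl ^+ 2)%R by rewrite exprn_gt0.
have [n hn] : exists n, \int[mu]_(y in `]dl, +oo[) limit_term s t LL n.+1 g y < (V + e4)%:E.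
  have h : \int[mu]_(y in `]dl, +oo[) (fold_pdf y * l y)%:E < (V + e4)%:E.
    by apply: le_lt_trans (lV _ d0) _; rewrite lte_fin ltrDl.
  have [n _ hn] := ereal_near_lt (limit_integral_cvg mg g01 d0 ly lc) h.
  by exists n; apply: hn => /=.
have near1 := ereal_near_lt (kern_integral_cvg st iidLL (ltn0Sn n) mg g01 d0 b_y b0) hn.
have near2 : \forall j \near \oo, LL [set z | (b_ j <= log_lr s t z 1)%R] < e4%:E.
  by apply: (ereal_near_lt (first_step_cvg LL s t b_y)); rewrite lte_fin.
(* The last time whose grid point sqrt(2 b / m) is still at least [dl]. *)
pose m j := Num.truncn (2 * b_ j / dl ^+ 2).
have m_y M : \forall j \near \oo, (M <= m j)%N.
  have /cvgryPge/(_ (M%:R * dl ^+ 2 / 2)%R) h := b_y.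
  apply: filterS h => j h; rewrite /m -(@natrK R M); apply: le_truncn.
  by rewrite ler_pdivlMr//; lra.
have near3 : \forall j \near \oo, ((Num.sqrt (m j)%:R)^-1 < e4 * dl ^+ 2 / 130)%R.
  have h : \forall k \near \oo, ((Num.sqrt (k%:R : R))^-1 < e4 * dl ^+ 2 / 130)%R.
    by apply: (cvgr_lt _ (@cvg_inv_sqrt R)); rewrite divr_gt0// mulr_gt0.
  have [M _ hM] := h; apply: filterS (m_y M) => j; exact: hM.
have near4 : \forall j \near \oo, (t * (s / t) ^+ 2 / dl ^+ 2 <= (m j)%:R)%R.
  have := m_y (Num.truncn (t * (s / t) ^+ 2 / dl ^+ 2)%R).+1; apply: filterS => j h.
  by apply: le_trans (ltW (truncnS_gt _)) _; rewrite ler_nat.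
near=> j.
have mj : (0 < m j)%N by near: j; exact: m_y.
have h1 : \int[mu]_(y in `]dl, +oo[) kern_term s t LL n.+1 g (b_ j) (grid_index (b_ j) y) < (V + e4)%:E.
  by near: j.
have h2 : LL [set z | (b_ j <= log_lr s t z 1)%R] < e4%:E by near: j.
have h3 : ((Num.sqrt (m j)%:R)^-1 < e4 * dl ^+ 2 / 130)%R by near: j.
have h4 : (t * (s / t) ^+ 2 / dl ^+ 2 <= (m j)%:R)%R by near: j.
exists (m j) => //.
have bd0 : (0 <= 2 * b_ j / dl ^+ 2)%R by rewrite divr_ge0 ?(ltW d2)// mulr_ge0// ltW.
have /andP[mle mgt] := truncn_itv bd0.
move: mj mle mgt h3 h4; rewrite -/(m j); case: (m j) => // N _ mle mgt h3 h4.
have S1 : \sum_(0 <= n0 < N.+2) hit_term s t LL (b_ j) g n0 <= e4%:E + (V + e4)%:E.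
  apply: le_trans (hit_sum_first LL s t (b_ j) N mg g01) _.
  apply: leeD (ltW h2) _; apply: le_trans (ltW h1).
  exact: hit_sum_le.
have bm : (b_ j < N.+2%:R * dl ^+ 2 / 2)%R by move: mgt; rewrite ltr_pdivrMr//; lra.
have n1 : (0 < N.+1%:R :> R)%R by rewrite ltr0n.
have c1 : (N.+1%:R * dl ^+ 2 <= 2 * N.+1%:R * dl ^+ 2 - t * (s / t) ^+ 2)%R.
  by move: h4; rewrite ler_pdivrMr//; lra.
have c0 : (0 < N.+1%:R * dl ^+ 2)%R by rewrite mulr_gt0.
have S2 : LL [set z | (log_lr s t z N.+1 < b_ j)%R] <= (e4 + e4)%:E.
  apply: le_trans (log_lr_small iidLL st (ltn0Sn N) d0 bm (lt_le_trans c0 c1)) _.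
  rewrite lee_fin; apply: lerD.
    by rewrite /dl le_eqVlt; apply/orP; left; apply/eqP; field; rewrite gt_eqF.
  apply: (@le_trans _ _ (130 * Num.sqrt N.+1%:R / (N.+1%:R * dl ^+ 2))%R).
    by rewrite ler_wpM2l ?mulr_ge0// lef_pV2 ?posrE// (lt_le_trans c0 c1).
  rewrite (_ : 130 * Num.sqrt N.+1%:R / (N.+1%:R * dl ^+ 2) = 130 / dl ^+ 2 * (Num.sqrt N.+1%:R)^-1)%R; last first.
    have q : (N.+1%:R = Num.sqrt N.+1%:R ^+ 2 :> R)%R by rewrite sqr_sqrtr.
    have q0 : Num.sqrt N.+1%:R != 0%R :> R by rewrite gt_eqF// sqrtr_gt0.
    by rewrite {2}q; field; rewrite q0 gt_eqF.
  apply: (@le_trans _ _ (130 / dl ^+ 2 * (e4 * dl ^+ 2 / 130))%R).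
    by rewrite ler_wpM2l ?(ltW h3)// divr_ge0// ltW.
  by rewrite le_eqVlt; apply/orP; left; apply/eqP; field; rewrite gt_eqF.
apply: le_trans (leeD S1 S2) _; rewrite -!EFinD lee_fin /e4; lra.
Unshelve. all: end_near. Qed.

(** E[exp(-(log Lambda_tau - b)); tau < oo] for i.i.d. innovations, that is e^b times the crossing
    probability under the null hypothesis. *)
Definition overshoot_mean b : \bar R := \sum_(0 <= n <oo) hit_term s t LL b (fun u => expR (- u))%R n.

Lemma overshoot_mean_ge0 b : 0 <= overshoot_mean b.
Proof. by apply: nneseries_ge0 => n _ _; apply: hit_term_ge0 => u; exact: expR_ge0. Qed.

Lemma overshoot_mean_fin b : overshoot_mean b \is a fin_num.
Proof.
rewrite ge0_fin_numE ?overshoot_mean_ge0//; apply: (@le_lt_trans _ _ 1); last exact: ltry.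
apply: lime_le.
  by apply: is_cvg_nneseries => n _ _; apply: hit_term_ge0 => u; exact: expR_ge0.
apply: nearW => M; apply: le_trans (hit_sum_le1 LL s t b M); apply: lee_sum => n _.
by rewrite hit_term_exp; apply: hit_term_le; [exact: measurable_exp_weight|exact: exp_weight01].
Qed.

(** The weight e^{-u} bounds the limit from above; the complementary weight bounds it from below,
    since [gamma_neg] is 1 minus gamma. *)
Lemma overshoot_mean_cvg (b_ : nat -> R) : b_ j @[j --> \oo] --> +oo%R -> (forall j, 0 < b_ j)%R ->
  overshoot_mean (b_ j) @[j --> \oo] --> gamma s t.
Proof.
move=> b_y b0; have [gf g0] := gamma_fin_gt0.
have pn := gamma_posneg.
have gE := gamma_posE; rewrite -gE in pn.
have nf : gamma_neg \is a fin_num.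
  by move: pn gf; case: (gamma s t) => // r; case: gamma_neg.
have up e : (0 < e)%R -> \forall j \near \oo, overshoot_mean (b_ j) <= (fine (gamma s t) + e)%:E.
  move=> e0.
  have h := @near_partial_sum_le ew nu (fine (gamma s t)) e b_ (@measurable_exp_weight R) (@exp_weight01 R) nuN
    (fun x x0 => ladder_exp_cvg iidLL x0) _ e0 b_y b0.
  apply: filterS (h _) => [j [m m0 hm]|dl d0]; first exact: le_trans (hit_series_le LL s t (b_ j) m0) hm.
  rewrite fineK// gE; apply: ge0_subset_integral => //.
  - exact: mfn.
  - by move=> y; rewrite /= in_itv/= andbT; exact: fn0.
  - by move=> y; rewrite /= !in_itv/= !andbT; exact: lt_trans.
have down e : (0 < e)%R -> \forall j \near \oo, 1 <= overshoot_mean (b_ j) + (fine gamma_neg + e)%:E.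
  move=> e0.
  have h := @near_partial_sum_le ew' (fun y => 1 - nu y)%R (fine gamma_neg) e b_ (@measurable_exp_weight_compl R) (@exp_weight_compl01 R)
    (fun y => congr1 (fun x => 1 - x)%R (nuN y)) (fun x x0 => ladder_compl_cvg iidLL x0) _ e0 b_y b0.
  apply: filterS (h _) => [j [m m0 hm]|dl d0].
    by apply: le_trans (hit_series_ge LL s t (b_ j) m0) _; rewrite leeD2l.
  rewrite fineK//; apply: ge0_subset_integral => //.
  - exact: mfn'.
  - by move=> y; rewrite /= in_itv/= andbT; exact: fn0'.
  - by move=> y; rewrite /= !in_itv/= !andbT; exact: lt_trans.
rewrite -(fineK gf); apply/fine_cvgP; split; first by apply: nearW => j; exact: overshoot_mean_fin.
apply/cvgrPdist_le => e e0; near=> j.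
have fj := overshoot_mean_fin (b_ j).
have uj : overshoot_mean (b_ j) <= (fine (gamma s t) + e)%:E by near: j; exact: up.
have dj : 1 <= overshoot_mean (b_ j) + (fine gamma_neg + e)%:E by near: j; exact: down.
move: uj dj pn; rewrite /= -(fineK fj) -(fineK gf) -(fineK nf) -!EFinD !lee_fin => uj dj [pn].
by rewrite ler_distlC; apply/andP; split; lra.
Unshelve. all: end_near. Qed.

End limit_law.

(** * The significance level *)

Theorem theorem1 (R : realType) (d : measure_display) (T : measurableType d)
  (P : probability T R) (X : nat -> {RV P >-> R}) (s t : R)
  (st : 0 < t \/ (s = 0 /\ t = 0)) (H0 : iid_std_normal X) :
  exists o1 : R -> R, (o1 b @[b --> +oo] --> 0) /\
    forall b : R,
      P [set w | (crossing_time s t b (fun i => X i w) < +oo)%E] =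
        ((1 + o1 b)%:E * gamma s t * (expR (- b))%:E)%E.
Proof.
have [LL [iidLL hP]] := crossing_prob st H0.
have [gf g0] := gamma_fin_gt0 iidLL st.
have Ff := overshoot_mean_fin LL s t.
pose f b := fine (overshoot_mean LL s t b); pose c := fine (gamma s t).
have c0 : c != 0 by rewrite gt_eqF// fine_gt0// g0 ltey_eq gf.
(* With gamma finite and positive, this choice makes the equality exact for every real b, and only
   its limit at infinity is left to prove. *)
exists (fun b => f b / c - 1); split.
  apply/cvg_pinftyP => u uy.
  (* The levels are raised to at least 1 to be positive, as [overshoot_mean_cvg] requires;
     eventually they agree with the given ones. *)
  have vy : Num.max 1 (u j) @[j --> \oo] --> +oo.
    by apply: (ger_cvgy _ uy); apply: nearW => j; rewrite le_max lexx orbT.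
  have v0 j : 0 < Num.max 1 (u j) by rewrite lt_max ltr01.
  have := overshoot_mean_cvg iidLL st vy v0.
  rewrite -(fineK gf) => /fine_cvgP[_ h].
  rewrite -(subrr 1); apply: cvgB; last exact: cvg_cst.
  rewrite -(divff c0); apply: cvgM; last exact: cvg_cst.
  apply: cvg_trans h; apply: near_eq_cvg.
  have /cvgryPge/(_ 1) h := uy.
  by apply: filterS h => j h; rewrite /f /= max_r.
move=> b; rewrite hP -/(overshoot_mean LL s t b) addrC subrK muleC; congr (_ * _)%E.
by rewrite -(fineK gf) -EFinM -/c divfK// fineK.
Qed.
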